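(* For every $\eta,\eta'>0$ there exist constants $c,c'>0$ (depending only on $\eta,\eta'$) such that for all finite-dimensional $\mathcal{H}_A,\mathcal{H}_B,\mathcal{H}_C$ and every state $\rho_{ABC}$ on $\mathcal{H}_A\otimes\mathcal{H}_B\otimes\mathcal{H}_C$, with $d_{A,B}=\min(d_A,d_B)$, $d_{A,C}=\min(d_A,d_C)$: \[ E_F(\rho_{A:BC})\ge\max\Big(E_F(\rho_{A:B})+\frac{c\,[E_F(\rho_{A:C})]^{4+\eta}}{d_Ad_C\log^{4+\eta}d_{A,C}},\ E_F(\rho_{A:C})+\frac{c\,[E_F(\rho_{A:B})]^{4+\eta}}{d_Ad_B\log^{4+\eta}d_{A,B}}\Big), \] \[ E_R^\infty(\rho_{A:BC})\ge\max\Big(E_R^\infty(\rho_{A:B})+\frac{c'\,[E_R^\infty(\rho_{A:C})]^{2+\eta'}}{d_Ad_C\log^{2+\eta'}d_{A,C}},\ E_R^\infty(\rho_{A:C})+\frac{c'\,[E_R^\infty(\rho_{A:B})]^{2+\eta'}}{d_Ad_B\log^{2+\eta'}d_{A,B}}\Big). \]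
   Context: Logarithms are base 2; $d_X=\dim\mathcal{H}_X$. $\rho_{AB}=\operatorname{tr}_C\rho_{ABC}$, $\rho_{AC}=\operatorname{tr}_B\rho_{ABC}$. $E_F$ is the entanglement of formation: $E_F(\rho_{X:Y})=\inf\sum_ip_iS(\operatorname{tr}_Y|\psi_i\rangle\langle\psi_i|)$ over pure-state decompositions $\rho=\sum_ip_i|\psi_i\rangle\langle\psi_i|$. $E_R(\rho_{X:Y})=\inf_\sigma \operatorname{tr}[\rho\log\rho-\rho\log\sigma]$ over separable $\sigma$, and $E_R^\infty(\rho_{X:Y})=\lim_{n\to\infty}\frac1nE_R(\rho^{\otimes n}_{X^n:Y^n})$ is its regularization. *)

(* Defs.v *)
From mathcomp Require Import all_boot all_order all_algebra.
From mathcomp Require Import all_classical all_reals all_analysis.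
From mathcomp Require Import complex.
Set Implicit Arguments. Unset Strict Implicit. Unset Printing Implicit Defensive.
Import Order.TTheory GRing.Theory Num.Theory.
Import numFieldNormedType.Exports.
Local Open Scope ring_scope.
Local Open Scope classical_set_scope.

Section Quantum.
Variable R : realType.
Local Notation C := R[i].

(* Linear operators on the Hilbert space C^T (T a finite index type =
   orthonormal basis), represented by their matrix entries. *)
Definition op (T : finType) := T -> T -> C.
Definition vec (T : finType) := T -> C.

Definition opmul (T : finType) (A B : op T) : op T :=
  fun i j => \sum_k A i k * B k j.
Definition adj (T : finType) (A : op T) : op T := fun i j => (A j i)^*.
Definition tr (T : finType) (A : op T) : C := \sum_i A i i.
Definition opapply (T : finType) (A : op T) (v : vec T) : vec T :=
  fun i => \sum_j A i j * v j.
Definition idop (T : finType) : op T := fun i j => (i == j)%:R.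
Definition diagop (T : finType) (l : T -> R) : op T :=
  fun i j => if i == j then (real_complex R (l i)) else 0.
Definition outer (T : finType) (v : vec T) : op T := fun i j => v i * (v j)^*.
Definition vnorm2 (T : finType) (v : vec T) : C := \sum_i (v i)^* * v i.

Definition hermitian (T : finType) (A : op T) := adj A = A.
Definition psd (T : finType) (A : op T) :=
  hermitian A /\ forall v : vec T, 0 <= \sum_i \sum_j (v i)^* * A i j * v j.
Definition state (T : finType) (rho : op T) := psd rho /\ tr rho = 1.
Definition unitary (T : finType) (U : op T) := opmul (adj U) U = @idop T.

Definition spec_decomp (T : finType) (A : op T) (U : op T) (l : T -> R) :=
  unitary U /\ A = opmul (opmul U (diagop l)) (adj U).

(* functional calculus f(A) for hermitian A (0 if A has no spectral
   decomposition, i.e. is not hermitian); independent of the chosen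
   decomposition. *)
Definition mfun (T : finType) (f : R -> R) (A : op T) : op T :=
  match pselect (exists p : op T * (T -> R), spec_decomp A p.1 p.2) with
  | left H => let: exist p _ := cid H in
              opmul (opmul p.1 (diagop (f \o p.2))) (adj p.1)
  | right _ => fun _ _ => 0
  end.

(* logarithm base 2, with the convention log 0 = 0 (used on the support) *)
Definition log2 (x : R) : R := if 0 < x then ln x / ln 2 else 0.
Definition mlog2 (T : finType) (A : op T) : op T := mfun log2 A.

Definition vN_entropy (T : finType) (rho : op T) : R :=
  - complex.Re (tr (opmul rho (mlog2 rho))).

Definition supp_incl (T : finType) (rho sigma : op T) :=
  forall v : vec T, opapply sigma v = (fun _ => 0) -> opapply rho v = (fun _ => 0).

(* relative entropy tr[rho log rho - rho log sigma] (finite case) *)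
Definition relent (T : finType) (rho sigma : op T) : R :=
  complex.Re (tr (opmul rho (mlog2 rho))) - complex.Re (tr (opmul rho (mlog2 sigma))).

Definition ptrace2 (X Y : finType) (A : op (X * Y)%type) : op X :=
  fun x x' => \sum_y A (x, y) (x', y).
Definition tensor (X Y : finType) (A : op X) (B : op Y) : op (X * Y)%type :=
  fun p q => A p.1 q.1 * B p.2 q.2.

Definition pure_decomp (T : finType) (rho : op T) (n : nat)
    (p : 'I_n -> R) (psi : 'I_n -> vec T) :=
  [/\ forall i, 0 <= p i, \sum_i p i = 1, forall i, vnorm2 (psi i) = 1
    & rho = fun a b => \sum_i (real_complex R (p i)) * outer (psi i) a b].

Definition EF (X Y : finType) (rho : op (X * Y)%type) : R :=
  inf [set r : R | exists n (p : 'I_n -> R) (psi : 'I_n -> vec (X * Y)%type),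
        pure_decomp rho p psi /\
        r = \sum_i p i * vN_entropy (ptrace2 (outer (psi i)))].

Definition separable (X Y : finType) (sigma : op (X * Y)%type) :=
  exists n (p : 'I_n -> R) (al : 'I_n -> op X) (be : 'I_n -> op Y),
    [/\ forall i, 0 <= p i, \sum_i p i = 1,
        forall i, state (al i), forall i, state (be i)
      & sigma = fun a b => \sum_i (real_complex R (p i)) * tensor (al i) (be i) a b].

(* relative entropy of entanglement E_R(rho_{X:Y}); separable sigma
   whose support does not contain that of rho give +oo and are excluded *)
Definition ER (X Y : finType) (rho : op (X * Y)%type) : R :=
  inf [set r : R | exists sigma, separable sigma /\ supp_incl rho sigma /\
                                 r = relent rho sigma].

Definition tpow (X Y : finType) (n : nat) (rho : op (X * Y)%type)
  : op ({ffun 'I_n -> X} * {ffun 'I_n -> Y})%type :=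
  fun a b => \prod_(k < n) rho (a.1 k, a.2 k) (b.1 k, b.2 k).

Definition ERinf (X Y : finType) (rho : op (X * Y)%type) : R :=
  limn (fun n : nat => ER (@tpow X Y n.+1 rho) / n.+1%:R : R).

Definition red_AB (A B D : finType) (rho : op (A * (B * D))%type)
  : op (A * B)%type :=
  fun p q => \sum_c rho (p.1, (p.2, c)) (q.1, (q.2, c)).
Definition red_AC (A B D : finType) (rho : op (A * (B * D))%type)
  : op (A * D)%type :=
  fun p q => \sum_b rho (p.1, (b, p.2)) (q.1, (b, q.2)).

End Quantum.

(* Main.v *)
(* Measure C with a fixed frame of vectors v_k.  A random-sign (Khinchine) argument
   shows that the blocks <v_k|X|v_k> satisfy |X| <= 72 * \sum_k |<v_k|X|v_k>| for all
   hermitian X on AC, in Hilbert-Schmidt norm and with no loss in the dimension.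

   For E_F, take a pure decomposition of rho_ABC.  Measuring C refines it to one of
   rho_AB, and by Pinsker the entropy decreases by the squared distance, on A, of the
   post-measurement states to their average.  The frame bound turns this into
   |rho_AC - s|^2 for an explicit separable s.

   For E_R^oo, minimax duality turns the distance m of rho_AC to the separable states
   into a test on A, controlled by the outcome k, with a gap proportional to m.  On n
   copies a Chernoff bound gives an exponent of order m^2, so a test with
   error exp (- n m^2) discriminates rho^(x)n from the separable states while
   leaving rho_AB^(x)n almost undisturbed; hence E_R (rho_ABC^(x)n) exceeds
   E_R (rho_AB^(x)n) by a multiple of n m^2.

   In both cases the distance of rho_AC to a separable state s is bounded below by a
   continuity estimate for E_F(rho_AC), which dominates E_R^oo(rho_AC):
   E_F <= C_g log d_min (sqrt (d_A d_C) |rho_AC - s|)^g for every 0 < g < 1. *)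
Require Import Defs.
From HB Require Import structures.
From mathcomp Require Import all_boot all_order all_algebra.
From mathcomp Require Import all_classical all_reals all_analysis.
From mathcomp Require Import complex.
From mathcomp Require Import ring lra.
Import Defs.
Set Implicit Arguments. Unset Strict Implicit. Unset Printing Implicit Defensive.
Import Order.TTheory GRing.Theory Num.Theory.
Import numFieldNormedType.Exports.
Local Open Scope ring_scope.

(** * Operators with rectangular index sets *)

(** The factor d_A d_C has a single source, the passage from trace norm to Hilbert-Schmidt norm in
    the Powers-Stormer step, which costs sqrt (d_A d_C). The measurement of C must therefore lose
    nothing in the dimension. A basis measurement sees only the diagonal blocks of an operator on
    AC, signs alone miss the anti-Hermitian part of the others, signs together with phases 1 and 'i
    see everything. Both gains are quadratic in the distance to the separable states, while the
    continuity estimate has an exponent g < 1. Inverting it produces the exponent p = 2 / g, hence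
    any p > 2, with a constant that degenerates as p tends to 2. For E_F one copy suffices, because
    a decomposition can be refined vector by vector. E_R has no such structure, and each use of a
    test costs additive constants; they are free of the dimension and vanish after division by the
    number of copies. Separable states of many copies may be correlated between the copies, so
    outcomes of the test are not independent on them; a bound for product operators that is
    multiplicative under tensor powers takes the place of independence. *)

Section OpAlg.
Variable R : realType.
Local Notation C := R[i].
Local Notation toC := (real_complex R).
Implicit Types S T W : finType.

Definition sqn (z : C) : R := complex.Re (z * z^*).

Lemma sqnE z : toC (sqn z) = z * z^*.
Proof. by rewrite /sqn RRe_real // ger0_real // mul_conjC_ge0. Qed.
Lemma toC_inj : injective toC. Proof. by move=> x y []. Qed.
Lemma toC_ge0 x : (0 <= toC x) = (0 <= x).
Proof. by rewrite lecE /= eqxx. Qed.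
Lemma ReM_real (a : R) (z : C) : complex.Re (toC a * z) = a * complex.Re z.
Proof. by case: z => x y /=; rewrite mul0r subr0. Qed.
Lemma ReC_conj (z : C) : complex.Re (z^*) = complex.Re z.
Proof. by apply: toC_inj; rewrite !complexRe Re_conj. Qed.
Lemma conj_toC (a : R) : (toC a)^* = toC a.
Proof. by apply/CrealP; rewrite complex_real. Qed.
Lemma sqn_ge0 z : 0 <= sqn z.
Proof. by rewrite -toC_ge0 sqnE mul_conjC_ge0. Qed.
Lemma sqn0 : sqn 0 = 0. Proof. by apply: toC_inj; rewrite sqnE mul0r. Qed.
Lemma sqnM x y : sqn (x * y) = sqn x * sqn y.
Proof. by apply: toC_inj; rewrite rmorphM /= !sqnE rmorphM /= mulrACA. Qed.
Lemma sqn_conj x : sqn (x^*) = sqn x.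
Proof. by apply: toC_inj; rewrite !sqnE conjCK mulrC. Qed.
Lemma sqn_toC a : sqn (toC a) = a ^+ 2.
Proof. by apply: toC_inj; rewrite sqnE conj_toC -rmorphM. Qed.
Lemma sqn_eq0 z : (sqn z == 0) = (z == 0).
Proof. by rewrite -(inj_eq toC_inj) sqnE mul_conjC_eq0. Qed.
Lemma sqn1 : sqn 1 = 1.
Proof. by apply: toC_inj; rewrite sqnE rmorph1 mulr1. Qed.
Lemma sqnN z : sqn (- z) = sqn z.
Proof. by apply: toC_inj; rewrite !sqnE rmorphN mulrNN. Qed.
Lemma toC_sum (I : Type) (r : seq I) (P : pred I) (F : I -> R) :
  toC (\sum_(i <- r | P i) F i) = \sum_(i <- r | P i) toC (F i).
Proof. exact: rmorph_sum. Qed.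
Lemma Re_sum (I : Type) (r : seq I) (P : pred I) (F : I -> C) :
  complex.Re (\sum_(i <- r | P i) F i) = \sum_(i <- r | P i) complex.Re (F i).
Proof. exact: raddf_sum. Qed.
Lemma ReD (x y : C) : complex.Re (x + y) = complex.Re x + complex.Re y.
Proof. exact: raddfD. Qed.
Lemma ReB (x y : C) : complex.Re (x - y) = complex.Re x - complex.Re y.
Proof. exact: raddfB. Qed.
Lemma ReN (x : C) : complex.Re (- x) = - complex.Re x.
Proof. exact: raddfN. Qed.
Lemma sqnD x y : sqn (x + y) = sqn x + sqn y + 2 * complex.Re (x^* * y).
Proof.
rewrite /sqn rmorphD mulrDl !mulrDr !ReD.
have -> : complex.Re (y * x^*) = complex.Re (x^* * y) by rewrite mulrC.
have -> : complex.Re (x * y^*) = complex.Re (x^* * y).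
  by rewrite -ReC_conj rmorphM /= conjCK.
ring.
Qed.
Lemma sqnB x y : sqn (x - y) = sqn x + sqn y - 2 * complex.Re (x^* * y).
Proof. by rewrite sqnD sqnN mulrN ReN mulrN. Qed.

(* Rectangular operators.  [op R T] is convertible to [rop R T T]; only the latter
   carries the module structure, whence the casts [(A : rop T T)]. *)
Definition rop (S T : finType) := S -> T -> C.
HB.instance Definition _ S T := GRing.Lmodule.copy (rop S T) (S -> T -> C).

Definition mul S T W (A : rop S T) (B : rop T W) : rop S W :=
  fun i j => \sum_k A i k * B k j.
Definition ct S T (A : rop S T) : rop T S := fun i j => (A j i)^*.

End OpAlg.
Notation "A ** B" := (mul A B) (at level 40, left associativity) : ring_scope.
Notation "A ^H" := (ct A) (at level 8, format "A ^H") : ring_scope.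

Section OpAlg2.
Variable R : realType.
Local Notation C := R[i].
Local Notation toC := (real_complex R).
Local Notation rop := (rop R).
Local Notation "'id1'" := (@idop R _).
Implicit Types S T W : finType.

Lemma ropP S T (A B : rop S T) : (forall i j, A i j = B i j) -> A = B.
Proof. by move=> h; apply/funext => i; apply/funext => j. Qed.

Lemma ropD S T (A B : rop S T) i j : (A + B) i j = A i j + B i j. Proof. by []. Qed.
Lemma ropN S T (A : rop S T) i j : (- A) i j = - A i j. Proof. by []. Qed.
Lemma ropB S T (A B : rop S T) i j : (A - B) i j = A i j - B i j. Proof. by []. Qed.
Lemma ropZ S T a (A : rop S T) i j : (a *: A) i j = a * A i j. Proof. by []. Qed.
Lemma rop0 S T i j : (0 : rop S T) i j = 0. Proof. by []. Qed.
Lemma rop_sum S T (I : Type) (r : seq I) (P : pred I) (F : I -> rop S T) i j :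
  (\sum_(k <- r | P k) F k) i j = \sum_(k <- r | P k) F k i j.
Proof. by elim/big_rec2: _ => // k y1 y2 _ <-. Qed.
Definition ropE := (ropD, ropN, ropB, ropZ, rop0, rop_sum).

Lemma mulA S T W X (A : rop S T) (B : rop T W) (D : rop W X) :
  A ** (B ** D) = A ** B ** D.
Proof.
apply: ropP => i j; rewrite /mul.
under eq_bigr do rewrite big_distrr /=.
rewrite exchange_big /=; apply: eq_bigr => k _.
by rewrite big_distrl /=; apply: eq_bigr => l _; rewrite mulrA.
Qed.
Lemma mul1 S T (A : rop S T) : id1 ** A = A.
Proof.
apply: ropP => i j; rewrite /mul (bigD1 i) //= /idop eqxx mul1r big1 ?addr0 //.
by move=> k /negbTE; rewrite eq_sym => ->; rewrite mul0r.
Qed.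
Lemma mulI S T (A : rop S T) : A ** id1 = A.
Proof.
apply: ropP => i j; rewrite /mul (bigD1 j) //= /idop eqxx mulr1 big1 ?addr0 //.
by move=> k /negbTE ->; rewrite mulr0.
Qed.
Lemma mulDl S T W (A B : rop S T) (D : rop T W) : (A + B) ** D = A ** D + B ** D.
Proof.
apply: ropP => i j; rewrite ropE /mul -big_split /=.
by apply: eq_bigr => k _; rewrite ropE mulrDl.
Qed.
Lemma mulDr S T W (A : rop S T) (B D : rop T W) : A ** (B + D) = A ** B + A ** D.
Proof.
apply: ropP => i j; rewrite ropE /mul -big_split /=.
by apply: eq_bigr => k _; rewrite ropE mulrDr.
Qed.
Lemma mulZl S T W a (A : rop S T) (B : rop T W) : (a *: A) ** B = a *: (A ** B).
Proof.
apply: ropP => i j; rewrite ropE /mul big_distrr /=.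
by apply: eq_bigr => k _; rewrite ropE mulrA.
Qed.
Lemma mulZr S T W a (A : rop S T) (B : rop T W) : A ** (a *: B) = a *: (A ** B).
Proof.
apply: ropP => i j; rewrite ropE /mul big_distrr /=.
by apply: eq_bigr => k _; rewrite ropE mulrCA.
Qed.
Lemma mulNl S T W (A : rop S T) (B : rop T W) : (- A) ** B = - (A ** B).
Proof. by rewrite -scaleN1r mulZl scaleN1r. Qed.
Lemma mulrop_N S T W (A : rop S T) (B : rop T W) : A ** (- B) = - (A ** B).
Proof. by rewrite -scaleN1r mulZr scaleN1r. Qed.
Lemma mulBl S T W (A B : rop S T) (D : rop T W) : (A - B) ** D = A ** D - B ** D.
Proof. by rewrite mulDl mulNl. Qed.
Lemma mulBr S T W (A : rop S T) (B D : rop T W) : A ** (B - D) = A ** B - A ** D.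
Proof. by rewrite mulDr mulrop_N. Qed.
Lemma mul0l S T W (B : rop T W) : (0 : rop S T) ** B = 0.
Proof. by rewrite -(scale0r (0 : rop S T)) mulZl !scale0r. Qed.
Lemma mulop0 S T W (A : rop S T) : A ** (0 : rop T W) = 0.
Proof. by rewrite -(scale0r (0 : rop T W)) mulZr !scale0r. Qed.
Lemma mul_suml S T W (I : Type) (r : seq I) (P : pred I) (F : I -> rop S T) (B : rop T W) :
  (\sum_(k <- r | P k) F k) ** B = \sum_(k <- r | P k) F k ** B.
Proof. by elim/big_rec2: _ => [|k y1 y2 _ <-]; rewrite ?mul0l ?mulDl. Qed.
Lemma mul_sumr S T W (I : Type) (r : seq I) (P : pred I) (F : I -> rop T W) (B : rop S T) :
  B ** (\sum_(k <- r | P k) F k) = \sum_(k <- r | P k) B ** F k.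
Proof. by elim/big_rec2: _ => [|k y1 y2 _ <-]; rewrite ?mulop0 ?mulDr. Qed.

Lemma ctK S T (A : rop S T) : A^H^H = A.
Proof. by apply: ropP => i j; rewrite /ct conjCK. Qed.
Lemma ctM S T W (A : rop S T) (B : rop T W) : (A ** B)^H = B^H ** A^H.
Proof.
apply: ropP => i j; rewrite /ct /mul rmorph_sum; apply: eq_bigr => k _.
by rewrite rmorphM mulrC.
Qed.
Lemma ctD S T (A B : rop S T) : (A + B)^H = A^H + B^H.
Proof. by apply: ropP => i j; rewrite /ct !ropE rmorphD. Qed.
Lemma ctZ S T a (A : rop S T) : (a *: A)^H = a^* *: A^H.
Proof. by apply: ropP => i j; rewrite /ct !ropE rmorphM. Qed.
Lemma ctN S T (A : rop S T) : (- A)^H = - A^H.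
Proof. by apply: ropP => i j; rewrite /ct !ropE rmorphN. Qed.
Lemma ctB S T (A B : rop S T) : (A - B)^H = A^H - B^H.
Proof. by rewrite ctD ctN. Qed.
Lemma ct1 T : (id1 : rop T T)^H = id1.
Proof. by apply: ropP => i j; rewrite /ct /idop eq_sym rmorph_nat. Qed.
Lemma ct0 S T : (0 : rop S T)^H = 0.
Proof. by apply: ropP => i j; rewrite /ct !ropE rmorph0. Qed.
Lemma ct_sum S T (I : Type) (r : seq I) (P : pred I) (F : I -> rop S T) :
  (\sum_(k <- r | P k) F k)^H = \sum_(k <- r | P k) (F k)^H.
Proof. by elim/big_rec2: _ => [|k y1 y2 _ <-]; rewrite ?ct0 ?ctD. Qed.

Definition rtr T (A : rop T T) : R := complex.Re (tr A).
Lemma trC S T (A : rop S T) (B : rop T S) : tr (A ** B) = tr (B ** A).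
Proof.
rewrite /tr /mul exchange_big /=; apply: eq_bigr => i _.
by apply: eq_bigr => j _; rewrite mulrC.
Qed.
Lemma rtrC S T (A : rop S T) (B : rop T S) : rtr (A ** B) = rtr (B ** A).
Proof. by rewrite /rtr trC. Qed.
Lemma trD T (A B : rop T T) : tr (A + B) = tr A + tr B.
Proof. by rewrite /tr -big_split. Qed.
Lemma trZ T a (A : rop T T) : tr (a *: A) = a * tr A.
Proof. by rewrite /tr big_distrr. Qed.
Lemma tr_ct T (A : rop T T) : tr (A^H) = (tr A)^*.
Proof. by rewrite /tr rmorph_sum. Qed.
Lemma rtr_ct T (A : rop T T) : rtr (A^H) = rtr A.
Proof. by rewrite /rtr tr_ct ReC_conj. Qed.
Lemma rtrD T (A B : rop T T) : rtr (A + B) = rtr A + rtr B.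
Proof. by rewrite /rtr trD ReD. Qed.
Lemma rtrZ T a (A : rop T T) : rtr (toC a *: A) = a * rtr A.
Proof. by rewrite /rtr trZ ReM_real. Qed.
Lemma rtrN T (A : rop T T) : rtr (- A) = - rtr A.
Proof. by rewrite -scaleN1r -(rmorph1 toC) -rmorphN rtrZ mulN1r. Qed.
Lemma rtrB T (A B : rop T T) : rtr (A - B) = rtr A - rtr B.
Proof. by rewrite rtrD rtrN. Qed.
Lemma rtr0 T : rtr (0 : rop T T) = 0.
Proof. by rewrite /rtr /tr big1. Qed.
Lemma rtr_sum T (I : Type) (r : seq I) (P : pred I) (F : I -> rop T T) :
  rtr (\sum_(k <- r | P k) F k) = \sum_(k <- r | P k) rtr (F k).
Proof. by elim/big_rec2: _ => [|k y1 y2 _ <-]; rewrite ?rtr0 ?rtrD. Qed.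

(* [fn] is the squared Hilbert-Schmidt norm, [nm] the norm, and [ip] the real part
   of the Hilbert-Schmidt inner product. *)
Definition fn S T (A : rop S T) : R := \sum_i \sum_j sqn (A i j).
Definition ip S T (A B : rop S T) : R := rtr (A^H ** B).

Lemma fn_ge0 S T (A : rop S T) : 0 <= fn A.
Proof. by apply: sumr_ge0 => i _; apply: sumr_ge0 => j _; apply: sqn_ge0. Qed.
Lemma fnE S T (A : rop S T) : toC (fn A) = tr (A ** A^H).
Proof.
rewrite /fn /tr /mul toC_sum; apply: eq_bigr => i _; rewrite toC_sum.
by apply: eq_bigr => j _; rewrite sqnE.
Qed.
Lemma fn_rtr S T (A : rop S T) : fn A = rtr (A ** A^H).
Proof. by rewrite /rtr -fnE. Qed.
Lemma fn_ip S T (A : rop S T) : fn A = ip A A.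
Proof. by rewrite fn_rtr rtrC. Qed.
Lemma fn_ct S T (A : rop S T) : fn (A^H) = fn A.
Proof. by rewrite !fn_rtr ctK rtrC. Qed.
Lemma ipC S T (A B : rop S T) : ip A B = ip B A.
Proof. by rewrite /ip -rtr_ct ctM ctK. Qed.
Lemma ipDr S T (A B D : rop S T) : ip A (B + D) = ip A B + ip A D.
Proof. by rewrite /ip mulDr rtrD. Qed.
Lemma ipDl S T (A B D : rop S T) : ip (A + B) D = ip A D + ip B D.
Proof. by rewrite /ip ctD mulDl rtrD. Qed.
Lemma ipNr S T (A B : rop S T) : ip A (- B) = - ip A B.
Proof. by rewrite /ip mulrop_N rtrN. Qed.
Lemma ipBr S T (A B D : rop S T) : ip A (B - D) = ip A B - ip A D.
Proof. by rewrite ipDr ipNr. Qed.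
Lemma ipZr S T a (A B : rop S T) : ip A (toC a *: B) = a * ip A B.
Proof. by rewrite /ip mulZr rtrZ. Qed.
Lemma ipZl S T a (A B : rop S T) : ip (toC a *: A) B = a * ip A B.
Proof. by rewrite ipC ipZr ipC. Qed.
Lemma ip_sumr S T (I : Type) (r : seq I) (P : pred I) (F : I -> rop S T) A :
  ip A (\sum_(k <- r | P k) F k) = \sum_(k <- r | P k) ip A (F k).
Proof. by rewrite /ip mul_sumr rtr_sum. Qed.
Lemma fnD S T (A B : rop S T) : fn (A + B) = fn A + fn B + 2 * ip A B.
Proof. rewrite !fn_ip ipDl !ipDr (ipC B A); ring. Qed.
Lemma fnB S T (A B : rop S T) : fn (A - B) = fn A + fn B - 2 * ip A B.
Proof. by rewrite fnD ipNr mulrN !fn_ip ipNr ipC ipNr opprK -!fn_ip. Qed.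
Lemma fnZ S T a (A : rop S T) : fn (a *: A) = sqn a * fn A.
Proof.
rewrite /fn big_distrr /=; apply: eq_bigr => i _; rewrite big_distrr /=.
by apply: eq_bigr => j _; rewrite ropE sqnM.
Qed.
Lemma fn0 S T : fn (0 : rop S T) = 0.
Proof. by rewrite /fn big1 // => i _; rewrite big1 // => j _; rewrite sqn0. Qed.
Lemma fn_eq0 S T (A : rop S T) : fn A = 0 -> A = 0.
Proof.
move=> h; apply: ropP => i j; apply/eqP; rewrite -sqn_eq0.
have := psumr_eq0P _ h; rewrite /= => /(_ _ i isT) hi.
have {hi}/psumr_eq0P hi : \sum_j sqn (A i j) = 0.
  by apply: hi => k _; apply: sumr_ge0 => l _; apply: sqn_ge0.
by rewrite hi // => l _; apply: sqn_ge0.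
Qed.
Lemma ip_le S T (A B : rop S T) : 2 * ip A B <= fn A + fn B.
Proof. by rewrite -subr_ge0 -fnB fn_ge0. Qed.
Lemma ip_CS S T (A B : rop S T) : ip A B ^+ 2 <= fn A * fn B.
Proof.
have [h|h] := eqVneq (fn B) 0.
  by rewrite (fn_eq0 h) fn0 /ip mulop0 rtr0 mulr0 expr0n.
have hB : 0 < fn B by rewrite lt_def h fn_ge0.
have := fn_ge0 (A - toC (ip A B / fn B) *: B).
rewrite fnB ipZr fnZ sqn_toC => h1.
have h2 : ip A B / fn B * fn B = ip A B by rewrite divfK.
move: h1 h2; set x := _ / _ => h1 h2; rewrite -h2; rewrite -h2 in h1; nra.
Qed.
Definition nm S T (A : rop S T) : R := Num.sqrt (fn A).
Lemma nm_ge0 S T (A : rop S T) : 0 <= nm A. Proof. exact: sqrtr_ge0. Qed.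
Lemma nm2 S T (A : rop S T) : nm A ^+ 2 = fn A.
Proof. by rewrite sqr_sqrtr // fn_ge0. Qed.
Lemma ip_nm S T (A B : rop S T) : ip A B <= nm A * nm B.
Proof.
rewrite -(sqrtrM _ (fn_ge0 A)); apply: (le_trans (ler_norm _)).
by rewrite -sqrtr_sqr ler_wsqrtr // ip_CS.
Qed.
Lemma nmD S T (A B : rop S T) : nm (A + B) <= nm A + nm B.
Proof.
rewrite -ler_sqr ?nnegrE ?addr_ge0 ?nm_ge0 // sqrrD !nm2 fnD.
have := ip_nm A B; lra.
Qed.
Lemma nm0 S T : nm (0 : rop S T) = 0. Proof. by rewrite /nm fn0 sqrtr0. Qed.
Lemma nm_sum S T (I : Type) (r : seq I) (P : pred I) (F : I -> rop S T) :
  nm (\sum_(k <- r | P k) F k) <= \sum_(k <- r | P k) nm (F k).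
Proof.
elim/big_rec2: _ => [|k y1 y2 _ h]; first by rewrite nm0.
by apply: (le_trans (nmD _ _)); rewrite lerD2l.
Qed.
Lemma nmZ S T a (A : rop S T) : 0 <= a -> nm (toC a *: A) = a * nm A.
Proof. by move=> a0; rewrite /nm fnZ sqn_toC sqrtrM ?sqr_ge0 // sqrtr_sqr ger0_norm. Qed.

Lemma fn_isol S T W (U : rop S T) (A : rop T W) : U^H ** U = id1 -> fn (U ** A) = fn A.
Proof. by move=> h; rewrite !fn_ip /ip ctM -mulA (mulA U^H) h mul1. Qed.
Lemma fn_isor S T W (U : rop S T) (A : rop W S) : U ** U^H = id1 -> fn (A ** U) = fn A.
Proof. by move=> h; rewrite -fn_ct ctM fn_isol ?ctK // fn_ct. Qed.
End OpAlg2.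

(** * Spectral theorem and functional calculus *)

Section Spectral.
Variable R : realType.
Local Notation C := R[i].
Local Notation toC := (real_complex R).
Local Notation rop := (rop R).
Local Notation "'id1'" := (@idop R _).
Implicit Types S T W : finType.

(* The spectral theorem is imported from matrices indexed by [enum T]. *)
Definition mxop T (A : rop T T) : 'M[C]_#|T| := \matrix_(i, j) A (enum_val i) (enum_val j).
Lemma mxopM T (A B : rop T T) : mxop (A ** B) = mxop A *m mxop B.
Proof.
apply/matrixP => i j; rewrite !mxE /mul.
rewrite (reindex_onto (@enum_val T T) enum_rank) /=; last first.
  by move=> k _; rewrite enum_rankK.
by apply: eq_big => [k|k _]; rewrite ?enum_valK ?eqxx // !mxE.
Qed.
Lemma mxop_inj T : injective (@mxop T).
Proof.
move=> A B h; apply: ropP => i j; have /matrixP/(_ (enum_rank i) (enum_rank j)) := h.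
by rewrite !mxE !enum_rankK.
Qed.
Lemma mxop1 T : mxop (id1 : rop T T) = 1%:M.
Proof. by apply/matrixP => i j; rewrite !mxE /idop (inj_eq enum_val_inj). Qed.
Lemma mul1C T (A B : rop T T) : A ** B = id1 -> B ** A = id1.
Proof.
move=> /(congr1 (@mxop T)); rewrite mxopM mxop1 => h; apply: mxop_inj.
by rewrite mxopM mxop1; apply: mulmx1C.
Qed.

Lemma unitary_r T (U : rop T T) : unitary U -> U ** U^H = id1.
Proof. exact: mul1C. Qed.

Lemma diagopE T (l : T -> R) i j : diagop l i j = (i == j)%:R * toC (l i).
Proof. by rewrite /diagop; case: ifP; rewrite ?mul1r ?mul0r. Qed.

Lemma spectral T (A : op R T) : Defs.hermitian A -> exists U l, spec_decomp A U l.
Proof.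
move=> hA; set M := mxop A.
have hM : M \is hermsymmx.
  rewrite qualifE /= expr0 scale1r; apply/eqP/matrixP => i j.
  by rewrite !mxE -{1}hA.
have /hermitian_normalmx/orthomx_spectralP := hM.
have Pu := spectral_unitarymx M.
have spR := hermitian_spectral_diag_real hM.
rewrite invmx_unitary //; move: Pu spR.
set P := spectralmx M; set d := spectral_diag M => Pu spR MP.
pose U : rop T T := fun i a => (P (enum_rank a) (enum_rank i))^*.
exists U, (fun a => complex.Re (d 0 (enum_rank a))).
have mU : mxop U = (P ^t Num.conj)%sesqui by apply/matrixP => i j; rewrite !mxE /U !enum_valK.
have mU' : mxop U^H = P by apply/matrixP => i j; rewrite !mxE /ct /U !enum_valK conjCK.
split.
  apply: mxop_inj; rewrite mxop1 -[opmul _ _]/(U^H ** U) mxopM mU mU'.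
  exact/unitarymxP.
apply: mxop_inj.
rewrite -[opmul _ (adj U)]/(U ** _ ** U^H) !mxopM mU mU' -/M {1}MP.
congr (_ *m _ *m _); apply/matrixP => i j; rewrite !mxE /diagop (inj_eq enum_val_inj).
case: eqP => [_|_]; last by rewrite mulr0n.
rewrite mulr1n enum_valK; have /mxOverP/(_ 0 i) := spR.
by move=> h; rewrite RRe_real.
Qed.

Lemma mul_diag S T (A : rop S T) (l : T -> R) i j :
  (A ** diagop l) i j = A i j * toC (l j).
Proof.
rewrite /mul (bigD1 j) //= diagopE eqxx mul1r big1 ?addr0 //.
by move=> k /negbTE h; rewrite diagopE h mul0r mulr0.
Qed.
Lemma diag_mul S T (A : rop S T) (l : S -> R) i j :
  ((diagop l : rop S S) ** A) i j = toC (l i) * A i j.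
Proof.
rewrite /mul (bigD1 i) //= diagopE eqxx mul1r big1 ?addr0 //.
by move=> k /negbTE h; rewrite diagopE eq_sym h mul0r mul0r.
Qed.

(** The change of basis U^H V intertwines the two diagonal forms, so its entry (i, j) vanishes
    unless l i = m j; hence it also intertwines f(l) and f(m). This makes [mfun] independent of the
    decomposition chosen in its definition. *)
Lemma spec_intertw T (A : op R T) U l V m f :
  spec_decomp A U l -> spec_decomp A V m ->
  U ** diagop (f \o l) ** U^H = V ** diagop (f \o m) ** V^H.
Proof.
move=> [Uu eU] [Vu eV].
have Uu' : U^H ** U = id1 by exact: Uu.
have Vu' : V^H ** V = id1 by exact: Vu.
have UU := unitary_r Uu; have VV := unitary_r Vu.
have h : (diagop l : rop T T) ** (U^H ** V) = (U^H ** V) ** diagop m.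
  have : U^H ** (U ** diagop l ** U^H) ** V = U^H ** (V ** diagop m ** V^H) ** V.
    by rewrite -[_ ** U^H]/(opmul (opmul U (diagop l)) (adj U)) -eU eV.
  by rewrite !mulA Uu' mul1 -!mulA Vu' mulI !mulA.
have h2 : (diagop (f \o l) : rop T T) ** (U^H ** V) = (U^H ** V) ** diagop (f \o m).
  apply: ropP => i j; move/(congr1 (fun x : rop T T => x i j)): h.
  rewrite !diag_mul !mul_diag /=; have [->|nz] := eqVneq ((U^H ** V) i j) 0.
    by rewrite !mulr0 !mul0r.
  by rewrite mulrC => /(mulfI nz)/toC_inj ->; rewrite mulrC.
have -> : U ** diagop (f \o l) ** U^H
    = U ** (diagop (f \o l) ** (U^H ** V)) ** V^H.
  by rewrite -!mulA VV mulI.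
by rewrite h2 !mulA UU mul1.
Qed.

Lemma mfunE T f (A : op R T) U l :
  spec_decomp A U l -> mfun f A = U ** diagop (f \o l) ** U^H.
Proof.
move=> h; rewrite /mfun; case: pselect => [H|[]]; last by exists (U, l).
by case: (cid H) => [[V m] /= hV]; apply: (spec_intertw _ hV h).
Qed.

Lemma mfun_id T (A : op R T) U l : spec_decomp A U l -> A = U ** diagop l ** U^H.
Proof. by case. Qed.

End Spectral.

(** * Positive operators, supports, and entropies written in eigenbases *)

Section Psd.
Variable R : realType.
Local Notation C := R[i].
Local Notation toC := (real_complex R).
Local Notation rop := (rop R).
Local Notation "'id1'" := (@idop R _).
Implicit Types S T W : finType.

Lemma diag_ct T (l : T -> R) : (diagop l : rop T T)^H = diagop l.
Proof.
apply: ropP => i j; rewrite /ct !diagopE rmorphM /= rmorph_nat conj_toC eq_sym.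
by case: eqP => [->|]; rewrite ?mul0r.
Qed.
Lemma diagM T (l m : T -> R) : (diagop l : rop T T) ** diagop m = diagop (fun i => l i * m i).
Proof.
apply: ropP => i j; rewrite mul_diag !diagopE rmorphM /= mulrA.
by case: eqP => [->|]; rewrite ?mul0r.
Qed.

(** The argument Z is rectangular: with [unit] as index type it is a vector, in general the form is
    summed over the columns of Z. One notion thus serves for positivity and for the variational
    formulas below. *)
Definition qf S T (A : rop T T) (Z : rop T S) : R := rtr (Z^H ** A ** Z).

Lemma sum_unit (V : nmodType) (F : unit -> V) : \sum_u F u = F tt.
Proof. by rewrite (bigD1 tt) //= big1 ?addr0 // => -[]. Qed.
Lemma qfE T (A : rop T T) (v : vec R T) :
  \sum_i \sum_j (v i)^* * A i j * v j
  = tr (((fun i _ => v i) : rop T unit)^H ** A ** ((fun i _ => v i) : rop T unit)).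
Proof.
rewrite /tr /mul sum_unit exchange_big; apply: eq_bigr => j _.
by rewrite big_distrl.
Qed.

Lemma qfD S T (A B : rop T T) (Z : rop T S) : qf (A + B) Z = qf A Z + qf B Z.
Proof. by rewrite /qf mulDr mulDl rtrD. Qed.
Lemma qfZ S T a (A : rop T T) (Z : rop T S) : qf (toC a *: A) Z = a * qf A Z.
Proof. by rewrite /qf mulZr mulZl rtrZ. Qed.
Lemma qf_sum S T (I : Type) (r : seq I) (P : pred I) (F : I -> rop T T) (Z : rop T S) :
  qf (\sum_(k <- r | P k) F k) Z = \sum_(k <- r | P k) qf (F k) Z.
Proof. by rewrite /qf mul_sumr mul_suml rtr_sum. Qed.
Lemma qf_fn S T W (X : rop T W) (Z : rop T S) : qf (X ** X^H) Z = fn (X^H ** Z).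
Proof. by rewrite /qf -!mulA mulA fn_ip /ip ctM ctK !mulA. Qed.

Lemma psd_factor S T (X : rop T S) : psd (X ** X^H).
Proof.
split; first by rewrite /Defs.hermitian -[adj _]/((_)^H) ctM ctK.
move=> v; rewrite qfE; set x := (fun _ _ => _) : rop T unit.
have -> : x^H ** (X ** X^H) ** x = (x^H ** X) ** (x^H ** X)^H by rewrite ctM ctK !mulA.
by rewrite -fnE toC_ge0 fn_ge0.
Qed.

Lemma psd_spec T (A : op R T) : psd A -> exists U l, spec_decomp A U l /\ forall a, 0 <= l a.
Proof.
move=> [hA pA]; have [U [l h]] := spectral hA; exists U, l; split => // a.
have [Uu eA] := h; have Uu' : U^H ** U = id1 by exact: Uu.
have := pA (fun i => U i a).
suff -> : \sum_i \sum_j (U i a)^* * A i j * U j a = toC (l a) by rewrite toC_ge0.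
have -> : toC (l a) = ((diagop l : rop T T)) a a by rewrite diagopE eqxx mul1r.
have -> : (diagop l : rop T T) = U^H ** A ** U.
  by rewrite (mfun_id h) !mulA Uu' mul1 -mulA Uu' mulI.
rewrite /mul exchange_big /=; apply: eq_bigr => j _.
by rewrite big_distrl.
Qed.

Lemma psd_sqrt T (A : op R T) : psd A -> exists2 B : op R T, psd B & B ** B = A.
Proof.
move=> /psd_spec[U [l [h l0]]]; exists (U ** diagop (fun a => Num.sqrt (l a)) ** U^H).
  have -> : U ** diagop (fun a => Num.sqrt (l a)) ** U^H =
      (U ** diagop (fun a => Num.sqrt (Num.sqrt (l a)))) ** (U ** diagop (fun a => Num.sqrt (Num.sqrt (l a))))^H.
    rewrite ctM diag_ct -[in RHS]mulA [diagop _ ** (diagop _ ** _)]mulA diagM mulA.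
    by congr (_ ** diagop _ ** _); apply/funext => a; rewrite -expr2 sqr_sqrtr ?sqrtr_ge0.
  exact: psd_factor.
rewrite [RHS](mfun_id h) !mulA -[_ ** U^H ** U]mulA.
have -> : U^H ** U = id1 by case: h.
rewrite mulI -[U ** _ ** diagop _]mulA diagM; congr (_ ** diagop _ ** _).
by apply/funext => a; rewrite -expr2 sqr_sqrtr.
Qed.

Lemma psd_herm T (A : op R T) : psd A -> A^H = A. Proof. by case. Qed.

Lemma psdP T (A : op R T) : psd A <-> exists X : rop T T, A = X ** X^H.
Proof.
split=> [/psd_sqrt[B B0 <-]|[X ->]]; last exact: psd_factor.
by exists B; rewrite (psd_herm B0).
Qed.

Lemma psd_conj S T (A : op R T) (V : rop S T) : psd A -> psd (V ** A ** V^H).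
Proof.
move=> /psdP[X ->]; have -> : V ** (X ** X^H) ** V^H = (V ** X) ** (V ** X)^H.
  by rewrite ctM !mulA.
exact: psd_factor.
Qed.
Lemma psd_conj' S T (A : op R T) (V : rop T S) : psd A -> psd (V^H ** A ** V).
Proof. by move=> /(psd_conj (V^H)); rewrite ctK. Qed.

Lemma psd_def T (A : rop T T) : A^H = A -> (forall v : rop T unit, 0 <= qf A v) -> psd A.
Proof.
move=> hA h; split=> // v; rewrite qfE; set x := (fun _ _ => _) : rop T unit.
have := h x; rewrite /qf /rtr -toC_ge0 RRe_real //.
by apply/CrealP; rewrite -tr_ct !ctM ctK hA mulA.
Qed.
Lemma qf_ge0 S T (A : op R T) (Z : rop T S) : psd A -> 0 <= qf A Z.
Proof. by move=> /psdP[X ->]; rewrite qf_fn fn_ge0. Qed.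

Lemma psdD T (A B : op R T) : psd A -> psd B -> psd ((A : rop T T) + B).
Proof.
move=> hA hB; apply: psd_def; first by rewrite ctD !psd_herm.
by move=> v; rewrite qfD addr_ge0 // qf_ge0.
Qed.
Lemma psdZ T a (A : op R T) : 0 <= a -> psd A -> psd (toC a *: (A : rop T T)).
Proof.
move=> a0 hA; apply: psd_def; first by rewrite ctZ conj_toC !psd_herm.
by move=> v; rewrite qfZ mulr_ge0 // qf_ge0.
Qed.
Lemma psd0 T : psd (0 : rop T T).
Proof. by rewrite -(mul0l T (0 : rop T T)) -{2}(ct0 R T T); apply: psd_factor. Qed.
Lemma psd1 T : psd (id1 : rop T T).
Proof. by rewrite -(mulI (id1 : rop T T)) -{2}(ct1 R T); apply: psd_factor. Qed.
Lemma psd_sum T (I : Type) (r : seq I) (P : pred I) (F : I -> rop T T) :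
  (forall i, P i -> psd (F i)) -> psd (\sum_(i <- r | P i) F i).
Proof. by move=> h; elim/big_ind: _ => //; [apply: psd0|move=> *; apply: psdD]. Qed.
Lemma psd_diag T (l : T -> R) : (forall i, 0 <= l i) -> psd (diagop l).
Proof.
move=> h; have -> : diagop l = (diagop (fun a => Num.sqrt (l a)) : rop T T) ** (diagop (fun a => Num.sqrt (l a)))^H.
  by rewrite diag_ct diagM; congr diagop; apply/funext => a; rewrite -expr2 sqr_sqrtr.
exact: psd_factor.
Qed.

Lemma rtr_ge0 T (A : op R T) : psd A -> 0 <= rtr (A : rop T T).
Proof. by move=> /psdP[X ->]; rewrite -fn_rtr fn_ge0. Qed.
Lemma tr_psd T (A : op R T) : psd A -> tr A = toC (rtr (A : rop T T)).
Proof. by move=> /psdP[X ->]; rewrite -fn_rtr fnE. Qed.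
Lemma rtr_mul_ge0 T (A B : op R T) : psd A -> psd B -> 0 <= rtr ((A : rop T T) ** B).
Proof.
move=> pA /psdP[X ->]; rewrite mulA rtrC mulA.
exact: (rtr_ge0 (psd_conj' X pA)).
Qed.
Lemma rtr_psd_eq0 T (A : op R T) : psd A -> rtr (A : rop T T) = 0 -> A = (0 : rop T T).
Proof. by move=> /psdP[X ->]; rewrite -fn_rtr => /fn_eq0 ->; rewrite mul0l. Qed.
Lemma qf_eq0 S T (A : op R T) (Z : rop T S) : psd A -> qf A Z = 0 -> (A : rop T T) ** Z = 0.
Proof. by move=> /psdP[X ->]; rewrite qf_fn => /fn_eq0 h; rewrite -mulA h mulop0. Qed.
Lemma qf0 S T (A : rop T T) (Z : rop T S) : A ** Z = 0 -> qf A Z = 0.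
Proof. by move=> h; rewrite /qf -mulA h mulop0 rtr0. Qed.
Lemma qf_le S T (A B : rop T T) (Z : rop T S) : psd (B - A) -> qf A Z <= qf B Z.
Proof. by move=> h; rewrite -[B](subrK A) qfD lerDr qf_ge0. Qed.

(** Kernel inclusion read column by column. In this form it composes with operator products. *)
Lemma suppP T (A B : op R T) : supp_incl A B <->
  (forall S (Z : rop T S), (B : rop T T) ** Z = 0 -> (A : rop T T) ** Z = 0).
Proof.
split=> [h S Z BZ|h v].
  apply: ropP => i j; have := h (fun i => Z i j).
  have -> : opapply B (fun i => Z i j) = (fun=> 0).
    by apply/funext => k; apply: (congr1 (fun X : rop T S => X k j) BZ).
  by move=> /(_ erefl) /(congr1 (fun f => f i)).
move=> hv; apply/funext => i; have := h unit (fun i _ => v i).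
have -> : (B : rop T T) ** ((fun i _ => v i) : rop T unit) = 0.
  by apply: ropP => k j; apply: (congr1 (fun X => X k) hv).
by move=> /(_ erefl) /(congr1 (fun f : rop T unit => f i tt)).
Qed.

Lemma supp_le T (A B : op R T) M : psd A -> psd (toC M *: (B : rop T T) - A) -> supp_incl A B.
Proof.
move=> pA h; apply/suppP => S Z BZ; apply: qf_eq0 => //.
apply/eqP; rewrite eq_le qf_ge0 // andbT; apply: (le_trans (qf_le Z h)).
by rewrite qf0 // mulZl BZ scaler0.
Qed.

Lemma rtr_diag S T (r : S -> R) (m : T -> R) (W : rop S T) :
  rtr (diagop r ** W ** diagop m ** W^H) = \sum_a \sum_b sqn (W a b) * r a * m b.
Proof.
rewrite /rtr /tr Re_sum; apply: eq_bigr => a _; rewrite {1}/mul Re_sum.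
apply: eq_bigr => b _; rewrite mul_diag diag_mul /ct.
rewrite -[toC _ * W a b * _ * _]mulrA [toC (m b) * _]mulrC.
rewrite mulrA -[toC _ * _ * _]mulrA -sqnE -!rmorphM /=; ring.
Qed.
(* Overlaps of two eigenbases: a doubly stochastic matrix through which every
   relative entropy below becomes a scalar sum. *)
Definition ovl T (U V : rop T T) a b : R := sqn ((U^H ** V) a b).

Lemma rtr_mfun T f g (A B : op R T) U r V s :
  spec_decomp A U r -> spec_decomp B V s ->
  rtr ((Defs.mfun f A : rop T T) ** Defs.mfun g B) = \sum_a \sum_b ovl U V a b * f (r a) * g (s b).
Proof.
move=> hA hB; rewrite (mfunE f hA) (mfunE g hB) -rtr_diag ctM ctK.
by rewrite -!mulA rtrC !mulA.
Qed.
Lemma mfun_idE T (A : op R T) U r : spec_decomp A U r -> Defs.mfun id A = A.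
Proof. by move=> h; rewrite (mfunE id h) [RHS](mfun_id h). Qed.

Lemma ovl_ge0 T (U V : rop T T) a b : 0 <= ovl U V a b.
Proof. exact: sqn_ge0. Qed.
Lemma unitary_row T (W : rop T T) a : W ** W^H = id1 -> \sum_b sqn (W a b) = 1.
Proof.
move=> h; apply: (@toC_inj R); rewrite toC_sum rmorph1.
have -> : 1 = (W ** W^H) a a by rewrite h /idop eqxx.
by apply: eq_bigr => b _; rewrite sqnE.
Qed.
Lemma ovl_row T (U V : rop T T) a : unitary U -> unitary V -> \sum_b ovl U V a b = 1.
Proof.
move=> uU uV; apply: unitary_row; rewrite ctM ctK -mulA (mulA V) (unitary_r uV) mul1.
exact: uU.
Qed.
Lemma ovlC T (U V : rop T T) a b : ovl U V a b = ovl V U b a.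
Proof. by rewrite /ovl -sqn_conj -[(_ ** _) b a]/(_ b a) -[LHS]/(sqn (((U^H ** V)^H) b a)) ctM ctK. Qed.
Lemma ovl_col T (U V : rop T T) b : unitary U -> unitary V -> \sum_a ovl U V a b = 1.
Proof. by move=> uU uV; under eq_bigr do rewrite ovlC; apply: ovl_row. Qed.

Lemma rtr_spec T (A : op R T) U r : spec_decomp A U r -> rtr (A : rop T T) = \sum_a r a.
Proof.
move=> h; have [uU _] := h; rewrite {1}(mfun_id h) rtrC mulA.
have -> : U^H ** U = id1 by exact: uU.
rewrite mul1 /rtr /tr Re_sum; apply: eq_bigr => a _.
by rewrite diagopE eqxx mul1r.
Qed.

Lemma rtr_mfun_self T f (A : op R T) U r : spec_decomp A U r ->
  rtr ((A : rop T T) ** Defs.mfun f A) = \sum_a r a * f (r a).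
Proof.
move=> h; have [uU _] := h; rewrite -{1}(mfun_idE h) (mfunE _ h) (mfunE _ h).
have uU' : U^H ** U = id1 by exact: uU.
rewrite !mulA rtrC !mulA uU' mul1 -(mulA _ U^H) uU' mulI diagM.
rewrite /rtr /tr Re_sum; apply: eq_bigr => a _.
by rewrite diagopE eqxx mul1r.
Qed.
(** The rows of [ovl] sum to 1, which spreads the entropy term over the second index. Relative
    entropy becomes an average of scalar terms, and operator inequalities follow by averaging scalar
    ones. *)
Lemma relentE T (A B : op R T) U r V s :
  spec_decomp A U r -> spec_decomp B V s ->
  relent A B = \sum_a \sum_b ovl U V a b * (r a * (log2 (r a) - log2 (s b))).
Proof.
move=> hA hB; rewrite /relent -[complex.Re (tr (opmul A (mlog2 A)))]/(rtr ((A : rop T T) ** mlog2 A)).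
rewrite -[complex.Re _]/(rtr ((A : rop T T) ** mlog2 B)) (rtr_mfun_self _ hA).
rewrite -{1}(mfun_idE hA) (rtr_mfun _ _ hA hB) -sumrB; apply: eq_bigr => a _.
have [uU _] := hA; have [uV _] := hB.
rewrite -[r a * _]mul1r -(ovl_row a uU uV) big_distrl /= -sumrB.
by apply: eq_bigr => b _; ring.
Qed.
Lemma vN_entropyE T (A : op R T) U r : spec_decomp A U r ->
  vN_entropy A = - \sum_a r a * log2 (r a).
Proof.
move=> h; rewrite /vN_entropy -[complex.Re _]/(rtr ((A : rop T T) ** mlog2 A)).
by rewrite (rtr_mfun_self _ h).
Qed.

(** An eigenvector of B for the eigenvalue 0 is killed by A, so it is orthogonal to every
    eigenvector of A of nonzero eigenvalue. This scalar form is what makes the convention log 0 = 0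
    harmless. *)
Lemma supp_spec T (A B : op R T) U r V s : supp_incl A B ->
  spec_decomp A U r -> spec_decomp B V s ->
  forall a b, s b = 0 -> ovl U V a b * r a = 0.
Proof.
move=> hs hA hB a b sb; have [uU _] := hA; have [uV _] := hB.
have uU' : U^H ** U = id1 by exact: uU. have uV' : V^H ** V = id1 by exact: uV.
pose v : rop T unit := fun i _ => V i b.
have hv : (B : rop T T) ** v = 0.
  rewrite (mfun_id hB) -!mulA; apply: ropP => i [].
  rewrite {1}/mul big1 // => k _; rewrite diag_mul.
  have -> : (V^H ** v) k tt = (id1 : rop T T) k b by rewrite -uV'.
  by rewrite /idop; case: eqP => [->|_]; rewrite ?sb ?mul0r !mulr0.
have /(congr1 (fun X => (U^H ** X) a tt)) := (suppP A B).1 hs _ _ hv.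
rewrite (mfun_id hA) !mulA uU' mul1 mulop0 -mulA diag_mul.
have -> : (U^H ** v) a tt = (U^H ** V) a b by [].
move=> /eqP; rewrite mulf_eq0 -(rmorph0 toC) (inj_eq (@toC_inj R)) rmorph0.
by move=> /orP[]/eqP e; rewrite /ovl e ?mulr0 ?sqn0 ?mul0r.
Qed.
End Psd.

(** * Relative entropy: monotonicity and convexity *)

Section LogCmp.
Variable R : realType.
Implicit Types x y : R.

Lemma ln_le_sub1 x : 0 < x -> ln x <= x - 1.
Proof. by move=> x0; rewrite -{1}(subrK 1 x) addrC le_ln1Dx //; rewrite ltrBrDr addNr. Qed.

Lemma ln_ge_sub1 x : 0 < x -> 1 - x^-1 <= ln x.
Proof.
move=> x0; have := @ln_le_sub1 x^-1; rewrite invr_gt0 => /(_ x0).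
by rewrite lnV ?posrE // => h; lra.
Qed.

Lemma is_derive_bigsum (I : Type) (r : seq I) (f : I -> R -> R) (df : I -> R) x :
  (forall i, is_derive x 1 (f i) (df i)) ->
  is_derive x 1 (fun t => \sum_(i <- r) f i t) (\sum_(i <- r) df i).
Proof.
move=> h; elim: r => [|i r IH].
  under [X in is_derive _ _ X _]funext do rewrite big_nil.
  by rewrite big_nil; apply: is_derive_cst.
under [X in is_derive _ _ X _]funext do rewrite big_cons.
by rewrite big_cons; apply: is_deriveD.
Qed.

Lemma is_derive_affine (a b x : R) : is_derive x 1 (fun t => a + t * b) b.
Proof.
have h := is_deriveD (is_derive_cst a x 1)
  (is_deriveM (is_derive_id x 1) (is_derive_cst b x 1)).
by apply: (is_derive_eq h); rewrite add0r scaler0 add0r /GRing.scale /= mulr1.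
Qed.

(** With z = x / y the expression collapses to ln ((1 + T) / (z + T)), which is O(1 / T) by the two
    tangent bounds on ln. It is the rate of the limit used in [log_cmp]. *)
Lemma ln_ratio_bound x y (T : R) : 0 < x -> 0 < y -> 0 < T ->
  `|ln (1 + T) - ln (x + T * y) + ln x - (ln x - ln y)| <= (x / y + 1) / T.
Proof.
move=> x0 y0 T0.
have xy0 : 0 < x / y by rewrite divr_gt0.
set z := x / y in xy0 *.
have e : x + T * y = y * (z + T) by rewrite /z; field; lra.
have zT : 0 < z + T by lra.
rewrite e lnM ?posrE //.
have -> : ln (1 + T) - (ln y + ln (z + T)) + ln x - (ln x - ln y)
   = ln ((1 + T) / (z + T)).
  by rewrite lnM ?posrE ?invr_gt0 ?lnV ?posrE //; lra.
have h0 : 0 < (1 + T) / (z + T) by rewrite divr_gt0 //; lra.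
rewrite ler_norml; apply/andP; split.
  apply: le_trans (ln_ge_sub1 h0).
  rewrite invf_div lerNl opprB lerBlDr -(@ler_pM2r _ (1 + T)) ?divfK; try lra.
  rewrite mulrDl mul1r -(@ler_pM2r _ T) // mulrDl mulrAC divfK; nra.
apply: (le_trans (ln_le_sub1 h0)).
rewrite lerBlDr -(@ler_pM2r _ (z + T)) ?divfK; try lra.
rewrite mulrDl mul1r -(@ler_pM2r _ T) // mulrDl mulrAC divfK; nra.
Qed.

(* Integrate the hypothesis from 0 to T; as T grows, the primitive
   ln (1+T) - ln (r+Ts) + ln r tends to ln r - ln s. *)
Lemma log_cmp (P : finType) (c r s : P -> R) :
  (forall p, 0 < r p) -> (forall p, 0 < s p) ->
  (forall t : R, 0 < t -> 0 <= \sum_p c p * ((1 + t)^-1 - s p / (r p + t * s p))) ->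
  0 <= \sum_p c p * (ln (r p) - ln (s p)).
Proof.
move=> r0 s0 h.
pose f p (T : R) := c p * (ln (1 + T) - ln (r p + T * s p) + ln (r p)).
pose F (T : R) := \sum_p f p T.
have dF (T : R) : 0 <= T -> is_derive T 1 F (\sum_p c p * ((1 + T)^-1 - s p / (r p + T * s p))).
  move=> T0; apply: is_derive_bigsum => p.
  have h1 : 0 < 1 + T by lra.
  have h2 : 0 < r p + T * s p by rewrite ltr_pwDl // mulr_ge0 // ltW.
  have d1 : is_derive T (1 : R) (fun T => ln (1 + T)) (1 + T)^-1.
    have -> : (fun T => ln (1 + T)) = @ln R \o (fun T => 1 + T * 1).
      by apply/funext => u /=; rewrite mulr1.
    rewrite -[(1 + T)^-1]mulr1; apply: is_derive1_comp; last exact: is_derive_affine.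
    by rewrite mulr1; apply: is_derive1_ln.
  have d2 : is_derive T (1 : R) (fun T => ln (r p + T * s p)) (s p / (r p + T * s p)).
    have -> : (fun T => ln (r p + T * s p)) = @ln R \o (fun T => r p + T * s p) by [].
    rewrite mulrC; apply: is_derive1_comp; last exact: is_derive_affine.
    exact: is_derive1_ln.
  have d3 : is_derive T (1 : R) (fun T => ln (1 + T) - ln (r p + T * s p) + ln (r p))
     ((1 + T)^-1 - s p / (r p + T * s p)).
    by rewrite -[X in is_derive _ _ _ X]addr0; apply: is_deriveD; apply: is_deriveB.
  exact: is_deriveZ.
have F0 : F 0 = 0.
  rewrite /F /f big1 // => p _.
  by rewrite addr0 ln1 mul0r addr0 sub0r addNr mulr0.
have Fge (T : R) : 0 < T -> 0 <= F T.
  move=> T0; rewrite -F0.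
  apply: (@ger0_derive1_ndecr _ F 0 T) => //.
  - move=> x; rewrite in_itv /= => /andP[x0 _].
    by have [] := dF x (ltW x0).
  - move=> x; rewrite in_itv /= => /andP[x0 _].
    by rewrite derive1E; have [_ ->] := dF x (ltW x0); apply: h.
  - apply: derivable_within_continuous => x; rewrite in_itv /= => /andP[x0 _].
    by have [] := dF x x0.
  - exact: ltW.
set L := \sum_p _.
pose M := \sum_p `|c p| * (r p / s p + 1).
have M0 : 0 <= M by apply: sumr_ge0 => p _; rewrite mulr_ge0 // addr_ge0 // divr_ge0 // ltW.
have LF (T : R) : 0 < T -> F T - L <= M / T.
  move=> T0; rewrite -sumrB /M big_distrl /=; apply: ler_sum => p _.
  rewrite /f -mulrBr; apply: (le_trans (ler_norm _)); rewrite normrM -mulrA.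
  by apply: ler_wpM2l => //; apply: ln_ratio_bound.
rewrite leNgt; apply/negP => L0.
(* At this T the error M / T equals - L * M / (M + 1), strictly below - L, so F T would be
   negative. *)
have T0 : 0 < (M + 1) / - L by rewrite divr_gt0 // ?ltr_wpDl // oppr_gt0.
have := LF _ T0; have := Fge _ T0; rewrite invf_div.
have h1 : M * (- L / (M + 1)) < - L.
  rewrite mulrCA -[X in _ < X]mulr1 ltr_pM2l ?oppr_gt0 // ltr_pdivrMr; lra.
lra.
Qed.
End LogCmp.

(** * Comparison of relative entropies through a variational formula *)

Section Comparison.
Variable R : realType.
Local Notation C := R[i].
Local Notation toC := (real_complex R).
Local Notation rop := (rop R).
Local Notation "'id1'" := (@idop R _).
Implicit Types S T W : finType.

(* [kval] is the minimum of [Qt] over X, and integrating it over t gives the relative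
   entropy.  Monotonicity of relative entropy thus reduces to transporting a trial
   operator X, with no appeal to operator convexity. *)
Definition Qt T (t : R) (A B X : rop T T) : R := qf A (id1 - X) + t * qf B X^H.
Definition kval T (t : R) (U : rop T T) (r : T -> R) (V : rop T T) (s : T -> R) : R :=
  \sum_a \sum_b ovl U V a b * (r a * (t * s b) / (r a + t * s b)).

Lemma qf_spec T (A : op R T) U r V (Z : rop T T) : spec_decomp A U r -> unitary V ->
  qf A Z = \sum_a \sum_b r a * sqn ((U^H ** Z ** V) a b).
Proof.
move=> hA uV; rewrite /qf {1}(mfun_id hA).
have -> : Z^H ** (U ** diagop r ** U^H) ** Z = (U^H ** Z)^H ** (diagop r ** (U^H ** Z)).
  by rewrite ctM ctK !mulA.
rewrite rtrC -mulA.
have -> : (U^H ** Z) ** (U^H ** Z)^H = (U^H ** Z ** V) ** (U^H ** Z ** V)^H.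
  by rewrite (ctM _ V) mulA -(mulA _ V) (unitary_r uV) mulI.
rewrite mulA.
have -> : diagop r ** (U^H ** Z ** V) ** (U^H ** Z ** V)^H =
   diagop r ** (U^H ** Z ** V) ** diagop (fun=> 1) ** (U^H ** Z ** V)^H.
  by congr (_ ** _); apply: ropP => i j; rewrite mul_diag rmorph1 mulr1.
rewrite rtr_diag; apply: eq_bigr => a _; apply: eq_bigr => b _.
by rewrite mulr1 mulrC.
Qed.

Lemma Qt_spec T t (A B : op R T) U r V s (X : rop T T) :
  spec_decomp A U r -> spec_decomp B V s ->
  Qt t A B X = \sum_a \sum_b
    (r a * sqn ((U^H ** V) a b - (U^H ** X ** V) a b) + t * s b * sqn ((U^H ** X ** V) a b)).
Proof.
move=> hA hB; have [uU _] := hA; have [uV _] := hB.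
rewrite /Qt (qf_spec _ hA uV) (qf_spec _ hB uU) [X in _ + _ * X]exchange_big /= big_distrr -big_split /=.
apply: eq_bigr => a _; rewrite big_distrr -big_split /=; apply: eq_bigr => b _.
rewrite mulBr mulBl mulI ropB mulrA; congr (_ + _ * _).
by rewrite -sqn_conj -[X in sqn X]/((V^H ** X^H ** U)^H a b) !ctM !ctK mulA.
Qed.

(** Completing the square: multiplied by r + u, the right side minus the left side is |r c - (r + u)
    x|^2. The left side is the parallel sum of r and u, weighted by |c|^2. *)
Lemma par_min (r u : R) (c x : C) : 0 <= r -> 0 <= u ->
  sqn c * (r * u / (r + u)) <= r * sqn (c - x) + u * sqn x.
Proof.
move=> r0 u0; have [h|h] := eqVneq (r + u) 0.
  by rewrite h invr0 !mulr0 addr_ge0 // mulr_ge0 // sqn_ge0.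
have ru : 0 < r + u by rewrite lt_def h addr_ge0.
rewrite mulrA ler_pdivrMr //.
have := sqn_ge0 (toC r * c - toC (r + u) * x).
rewrite !sqnB !sqnM !sqn_toC rmorphM /= conj_toC.
have -> : toC r * c^* * (toC (r + u) * x) = toC (r * (r + u)) * (c^* * x).
  by rewrite rmorphM /= !mulrA; congr (_ * _); rewrite mulrAC.
rewrite ReM_real; move: (complex.Re _) => z; nra.
Qed.

Lemma par_min_eq (r u : R) (c : C) : 0 <= r -> 0 <= u ->
  r * sqn (c - c * toC (r / (r + u))) + u * sqn (c * toC (r / (r + u)))
   = sqn c * (r * u / (r + u)).
Proof.
move=> r0 u0.
have -> : c - c * toC (r / (r + u)) = c * toC (1 - r / (r + u)).
  by rewrite rmorphB /= mulrBr rmorph1 mulr1.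
rewrite !sqnM !sqn_toC; have [h|h] := eqVneq (r + u) 0.
  have -> : r = 0 by lra. have -> : u = 0 by lra.
  by rewrite !(mul0r, mulr0) addr0.
by field.
Qed.

Lemma kval_le T t (A B : op R T) U r V s (X : rop T T) : 0 < t ->
  spec_decomp A U r -> spec_decomp B V s -> (forall a, 0 <= r a) -> (forall a, 0 <= s a) ->
  kval t U r V s <= Qt t A B X.
Proof.
move=> t0 hA hB r0 s0; rewrite (Qt_spec _ _ hA hB).
apply: ler_sum => a _; apply: ler_sum => b _; apply: par_min => //.
by rewrite mulr_ge0 // ltW.
Qed.

Lemma kval_attained T t (A B : op R T) U r V s : 0 < t ->
  spec_decomp A U r -> spec_decomp B V s -> (forall a, 0 <= r a) -> (forall a, 0 <= s a) ->
  exists X, Qt t A B X = kval t U r V s.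
Proof.
move=> t0 hA hB r0 s0; have [uU _] := hA; have [uV _] := hB.
pose x : rop T T := fun a b => (U^H ** V) a b * toC (r a / (r a + t * s b)).
exists (U ** x ** V^H).
rewrite (Qt_spec _ _ hA hB); apply: eq_bigr => a _; apply: eq_bigr => b _.
have -> : U^H ** (U ** x ** V^H) ** V = x.
  have -> : U^H ** (U ** x ** V^H) ** V = (U^H ** U) ** x ** (V^H ** V) by rewrite !mulA.
  have -> : V^H ** V = id1 by exact: uV.
  have -> : U^H ** U = id1 by exact: uU.
  by rewrite mul1 mulI.
by rewrite par_min_eq // mulr_ge0 // ltW.
Qed.

Lemma ln2_gt0 : 0 < ln 2 :> R.
Proof. by rewrite ln_gt0 // ltr1n. Qed.

Lemma sum_triple (V : nmodType) (I : finType) T (F : I -> T -> T -> V) :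
  \sum_(p : I * (T * T)) F p.1 p.2.1 p.2.2 = \sum_i \sum_a \sum_b F i a b.
Proof.
rewrite -(pair_bigA _ (fun i (q : T * T) => F i q.1 q.2)) /=.
by apply: eq_bigr => i _; rewrite (pair_bigA _ (fun a b => F i a b)).
Qed.

(** Both sums are gathered into one family over a disjoint union, the primed terms with negative
    weights, and submitted to [log_cmp]. At each t the trace terms cancel by the equality of traces,
    and what remains is the difference of the minima [kval] divided by t; a trial X obtained from an
    optimal Y decides its sign. *)
Lemma relent_cmp (I J T T' : finType) (A B : I -> op R T) (A' B' : J -> op R T') :
  (forall i, psd (A i)) -> (forall i, psd (B i)) -> (forall i, supp_incl (A i) (B i)) ->
  (forall i, psd (A' i)) -> (forall i, psd (B' i)) -> (forall i, supp_incl (A' i) (B' i)) ->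
  \sum_i rtr (A i) = \sum_j rtr (A' j) ->
  (forall t : R, 0 < t -> forall Y : J -> rop T' T', exists X : I -> rop T T,
     \sum_i Qt t (A i) (B i) (X i) <= \sum_j Qt t (A' j) (B' j) (Y j)) ->
  \sum_j relent (A' j) (B' j) <= \sum_i relent (A i) (B i).
Proof.
move=> pA pB sAB pA' pB' sAB' htr hQ.
have [U hU] := choice (fun i => psd_spec (pA i)); have [r hr] := choice hU.
have [V hV] := choice (fun i => psd_spec (pB i)); have [s hs] := choice hV.
have [U' hU'] := choice (fun i => psd_spec (pA' i)); have [r' hr'] := choice hU'.
have [V' hV'] := choice (fun i => psd_spec (pB' i)); have [s' hs'] := choice hV'.
pose c (p : (I * (T * T)) + (J * (T' * T'))) : R := match p with
  | inl q => ovl (U q.1) (V q.1) q.2.1 q.2.2 * r q.1 q.2.1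
  | inr q => - (ovl (U' q.1) (V' q.1) q.2.1 q.2.2 * r' q.1 q.2.1) end.
(* Where the weight vanishes the eigenvalues are replaced by 1, because [log_cmp] wants them
   positive. By [supp_spec] no term of nonzero weight has a zero eigenvalue. *)
pose rr p : R := if c p == 0 then 1 else match p with
  | inl q => r q.1 q.2.1 | inr q => r' q.1 q.2.1 end.
pose ss p : R := if c p == 0 then 1 else match p with
  | inl q => s q.1 q.2.2 | inr q => s' q.1 q.2.2 end.
have rr0 p : 0 < rr p.
  rewrite /rr; case: eqP => // /eqP; case: p => q /=; rewrite ?oppr_eq0 mulf_eq0 negb_or => /andP[_ h].
    by rewrite lt_def h; case: (hr q.1) => _ ->.
  by rewrite lt_def h; case: (hr' q.1) => _ ->.
have ss0 p : 0 < ss p.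
  rewrite /ss; case: eqP => // /eqP; case: p => q /= h; rewrite lt_def.
    have [h1 ->] := hs q.1; rewrite andbT; apply: contra h => /eqP h.
    by rewrite (supp_spec (sAB q.1) (hr q.1).1 h1).
  have [h1 ->] := hs' q.1; rewrite andbT; apply: contra h => /eqP h.
  by rewrite (supp_spec (sAB' q.1) (hr' q.1).1 h1) // oppr0.
have L := log_cmp rr0 ss0 (c := c).
have ln2 := ln2_gt0.
have key1 (o x y : R) : 0 <= x -> 0 <= y -> (y = 0 -> o * x = 0) ->
  o * x * (ln (if o * x == 0 then 1 else x) - ln (if o * x == 0 then 1 else y))
   = ln 2 * (o * (x * (log2 x - log2 y))).
  move=> x0 y0 h; case: eqP => e; first by rewrite e mul0r (mulrA o) e mul0r mulr0.
  have y1 : 0 < y by rewrite lt_def y0 andbT; apply/eqP => /h.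
  have x1 : 0 < x by rewrite lt_def x0 andbT; apply/eqP => e'; apply: e; rewrite e' mulr0.
  by rewrite /log2 x1 y1; field; rewrite gt_eqF.
have key2 (t o x y : R) : 0 < t -> 0 <= x -> 0 <= y -> (y = 0 -> o * x = 0) ->
  o * x * ((1 + t)^-1 - (if o * x == 0 then 1 else y) /
     ((if o * x == 0 then 1 else x) + t * (if o * x == 0 then 1 else y)))
   = o * x / (1 + t) - (o * (x * (t * y) / (x + t * y))) / t.
  move=> t0 x0 y0 h; case: eqP => e; first by rewrite e !mul0r -(mulrA x) (mulrA o) e !mul0r subr0.
  have y1 : 0 < y by rewrite lt_def y0 andbT; apply/eqP => /h.
  have ty : 0 < t * y by rewrite mulr_gt0.
  field; rewrite !gt_eqF //; lra.
rewrite -(ler_pM2l ln2) -subr_ge0.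
have -> : ln 2 * \sum_i relent (A i) (B i) - ln 2 * \sum_j relent (A' j) (B' j)
  = \sum_p c p * (ln (rr p) - ln (ss p)).
  rewrite big_sumType /= (sum_triple (fun i a b => ovl (U i) (V i) a b * r i a *
    (ln (if ovl (U i) (V i) a b * r i a == 0 then 1 else r i a) -
     ln (if ovl (U i) (V i) a b * r i a == 0 then 1 else s i b)))).
  congr (_ + _).
    rewrite big_distrr; apply: eq_bigr => i _ /=.
    rewrite (relentE (hr i).1 (hs i).1) big_distrr; apply: eq_bigr => a _ /=.
    rewrite big_distrr; apply: eq_bigr => b _ /=.
    rewrite key1 //; [by case: (hr i)|by case: (hs i)|].
    exact: (supp_spec (sAB i) (hr i).1 (hs i).1).
  rewrite /rr /ss /=.
  under [RHS]eq_bigr do rewrite oppr_eq0 mulNr.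
  rewrite sumrN (sum_triple (fun i a b => ovl (U' i) (V' i) a b * r' i a *
    (ln (if ovl (U' i) (V' i) a b * r' i a == 0 then 1 else r' i a) -
     ln (if ovl (U' i) (V' i) a b * r' i a == 0 then 1 else s' i b)))).
  congr (- _); rewrite big_distrr; apply: eq_bigr => i _ /=.
  rewrite (relentE (hr' i).1 (hs' i).1) big_distrr; apply: eq_bigr => a _ /=.
  rewrite big_distrr; apply: eq_bigr => b _ /=.
  rewrite key1 //; [by case: (hr' i)|by case: (hs' i)|].
  exact: (supp_spec (sAB' i) (hr' i).1 (hs' i).1).
apply: L => t t0.
have -> : \sum_p c p * ((1 + t)^-1 - ss p / (rr p + t * ss p)) =
   (\sum_j kval t (U' j) (r' j) (V' j) (s' j) - \sum_i kval t (U i) (r i) (V i) (s i)) / t.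
  have trS (K S : finType) (D E : K -> op R S) X x Y y :
     (forall k, spec_decomp (D k) (X k) (x k)) -> (forall k, spec_decomp (E k) (Y k) (y k)) ->
     (forall k a, 0 <= x k a) -> (forall k a, 0 <= y k a) -> (forall k, supp_incl (D k) (E k)) ->
     \sum_k \sum_a \sum_b ovl (X k) (Y k) a b * x k a * ((1 + t)^-1 - (if ovl (X k) (Y k) a b * x k a == 0 then 1 else y k b) /
     ((if ovl (X k) (Y k) a b * x k a == 0 then 1 else x k a) + t * (if ovl (X k) (Y k) a b * x k a == 0 then 1 else y k b)))
     = (\sum_k rtr (D k)) / (1 + t) - (\sum_k kval t (X k) (x k) (Y k) (y k)) / t.
    move=> hD hE x0 y0 hs0; rewrite !big_distrl -sumrB /=; apply: eq_bigr => k _.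
    rewrite (rtr_spec (hD k)) /kval !big_distrl -sumrB /=; apply: eq_bigr => a _.
    have -> : x k a / (1 + t) = \sum_b ovl (X k) (Y k) a b * x k a / (1 + t).
      by rewrite -!big_distrl /= (ovl_row a (hD k).1 (hE k).1) mul1r.
    rewrite [X in _ = _ - X]big_distrl -sumrB /=.
    apply: eq_bigr => b _; rewrite key2 //.
    exact: (supp_spec (hs0 k) (hD k) (hE k)).
  rewrite big_sumType /= (sum_triple (fun k a b => ovl (U k) (V k) a b * r k a * ((1 + t)^-1 - (if ovl (U k) (V k) a b * r k a == 0 then 1 else s k b) /
     ((if ovl (U k) (V k) a b * r k a == 0 then 1 else r k a) + t * (if ovl (U k) (V k) a b * r k a == 0 then 1 else s k b))))).
  rewrite (trS _ _ A B) //; try by [move=> k; case: (hr k)|move=> k; case: (hs k)].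
  rewrite /rr /ss /=.
  under [X in _ + X]eq_bigr do rewrite oppr_eq0 mulNr.
  rewrite sumrN (sum_triple (fun k a b => ovl (U' k) (V' k) a b * r' k a * ((1 + t)^-1 - (if ovl (U' k) (V' k) a b * r' k a == 0 then 1 else s' k b) /
     ((if ovl (U' k) (V' k) a b * r' k a == 0 then 1 else r' k a) + t * (if ovl (U' k) (V' k) a b * r' k a == 0 then 1 else s' k b))))).
  rewrite (trS _ _ A' B') //; try by [move=> k; case: (hr' k)|move=> k; case: (hs' k)].
  rewrite htr; ring.
rewrite mulr_ge0 ?invr_ge0 ?(ltW t0) // subr_ge0.
(* Y is chosen optimal for the primed pairs, so that the hypothesis compares a value of [Qt] with
   the minimum itself. *)
have hY j : exists X, Qt t (A' j) (B' j) X = kval t (U' j) (r' j) (V' j) (s' j).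
  by apply: kval_attained; case: (hr' j); case: (hs' j).
have [Y eY] := choice hY; have [X] := hQ t t0 Y.
under [X in _ <= X]eq_bigr do rewrite eY.
apply: le_trans; apply: ler_sum => i _.
by apply: kval_le; case: (hr i); case: (hs i).
Qed.
End Comparison.

(** * Data processing, joint convexity and Pinsker's inequality *)

Section RelEnt.
Variable R : realType.
Local Notation C := R[i].
Local Notation toC := (real_complex R).
Local Notation rop := (rop R).
Local Notation "'id1'" := (@idop R _).
Implicit Types S T W : finType.

Lemma ip_mulr S T W (A : rop S T) (M : rop S W) (V : rop W T) : ip A (M ** V) = ip (A ** V^H) M.
Proof. by rewrite /ip ctM ctK mulA rtrC !mulA. Qed.

(** Duality: pairing the sum x with itself moves each V_k onto x, and the squared norms of the x
    V_k^H add up to that of x by completeness. Then 2 <a, b> <= |a|^2 + |b|^2 concludes. *)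
Lemma contraction S T W (K : finType) (M : K -> rop S W) (V : K -> rop W T) :
  \sum_k (V k)^H ** V k = id1 -> fn (\sum_k M k ** V k) <= \sum_k fn (M k).
Proof.
move=> hV; set x := \sum_k _.
have h1 : fn x = \sum_k ip (x ** (V k)^H) (M k).
  by rewrite fn_ip {2}/x ip_sumr; apply: eq_bigr => k _; rewrite ip_mulr.
have h2 : \sum_k fn (x ** (V k)^H) = fn x.
  rewrite [RHS]fn_rtr -[X in rtr (X ** _)]mulI -hV mul_sumr mul_suml rtr_sum.
  by apply: eq_bigr => k _; rewrite fn_rtr ctM ctK !mulA.
have h3 : 2 * fn x <= \sum_k (fn (x ** (V k)^H) + fn (M k)).
  by rewrite h1 big_distrr; apply: ler_sum => k _; apply: ip_le.
rewrite big_split h2 /= in h3; lra.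
Qed.

Lemma qf_conj S T W (A : rop T T) (V : rop S T) (Z : rop S W) :
  qf (V ** A ** V^H) Z = qf A (V^H ** Z).
Proof. by rewrite /qf ctM ctK !mulA. Qed.

(** The operator Schwarz inequality for the unital map Z -> \sum_k V_k^H Z_k V_k, tested against A
    through a factorisation A = G G^H. *)
Lemma qf_contr T W (K : finType) (A : op R T) (V : K -> rop W T) (Z : K -> rop W W) :
  \sum_k (V k)^H ** V k = id1 -> psd A ->
  qf A (\sum_k (V k)^H ** Z k ** V k) <= \sum_k qf (V k ** A ** (V k)^H) (Z k).
Proof.
move=> hV /psdP[G ->]; rewrite qf_fn mul_sumr.
under eq_bigr do rewrite mulA.
apply: (le_trans (contraction _ hV)); apply: ler_sum => k _.
by rewrite qf_conj qf_fn.
Qed.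

Lemma conj_sum_psd T W (K : finType) (A : op R T) (V : K -> rop W T) :
  psd A -> psd (\sum_k V k ** A ** (V k)^H).
Proof. by move=> pA; apply: psd_sum => k _; apply: psd_conj. Qed.

Lemma conj_sum_supp T W (K : finType) (A B : op R T) (V : K -> rop W T) :
  psd A -> psd B -> supp_incl A B ->
  supp_incl (\sum_k V k ** A ** (V k)^H) (\sum_k V k ** B ** (V k)^H).
Proof.
move=> pA pB /suppP h; apply/suppP => S Z /qf0.
rewrite qf_sum => h1; apply: qf_eq0; first exact: conj_sum_psd.
rewrite qf_sum big1 // => k _; rewrite qf_conj; apply: qf0; apply: h.
apply: qf_eq0 => //; rewrite -qf_conj.
have := psumr_eq0P _ h1; apply=> // i _; apply: qf_ge0; exact: psd_conj.
Qed.

(* Transport Y to the Heisenberg image \sum V^H Y V and use the Schwarz inequality. *)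
Lemma dpi T W (F J : finType) (A B : op R T) (V : F -> J -> rop W T) :
  \sum_f \sum_j (V f j)^H ** V f j = id1 ->
  psd A -> psd B -> supp_incl A B ->
  \sum_f relent (\sum_j V f j ** A ** (V f j)^H) (\sum_j V f j ** B ** (V f j)^H) <= relent A B.
Proof.
move=> hV pA pB sAB.
have := @relent_cmp R unit F T W (fun=> A) (fun=> B)
   (fun f => \sum_j V f j ** A ** (V f j)^H) (fun f => \sum_j V f j ** B ** (V f j)^H).
rewrite !sum_unit; apply=> //; try by move=> f; apply: conj_sum_psd.
- by move=> f; apply: conj_sum_supp.
- under eq_bigr do rewrite rtr_sum; rewrite -{1}(mul1 A) -hV mul_suml rtr_sum.
  apply: eq_bigr => f _; rewrite mul_suml rtr_sum; apply: eq_bigr => j _.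
  by rewrite -mulA rtrC.
move=> t t0 Y; pose X Z := \sum_(p : F * J) (V p.1 p.2)^H ** Z p.1 ** V p.1 p.2.
exists (fun=> X Y); rewrite sum_unit.
have hV' : \sum_(p : F * J) (V p.1 p.2)^H ** V p.1 p.2 = id1.
  by rewrite -hV (pair_bigA _ (fun f j => (V f j)^H ** V f j)).
have key (D : op R T) (Z : F -> rop W W) : psd D -> qf D (X Z) <= \sum_f qf (\sum_j V f j ** D ** (V f j)^H) (Z f).
  move=> pD; apply: (le_trans (qf_contr (fun p => Z p.1) hV' pD)).
  rewrite -(pair_bigA _ (fun f j => qf (V f j ** D ** (V f j)^H) (Z f))) /=.
  by under [X in _ <= X]eq_bigr do rewrite qf_sum.
rewrite /Qt big_split /= -mulr_sumr; apply: lerD.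
  have -> : id1 - X Y = X (fun f => id1 - Y f).
    rewrite -hV' /X -sumrB; apply: eq_bigr => p _.
    by rewrite mulBr mulBl mulI.
  exact: key.
rewrite ler_pM2l //; have -> : (X Y)^H = X (fun f => (Y f)^H).
  by rewrite /X ct_sum; apply: eq_bigr => p _; rewrite !ctM ctK mulA.
exact: key.
Qed.

Lemma supp_sum T (I : finType) (A B : I -> op R T) :
  (forall i, psd (A i)) -> (forall i, psd (B i)) -> (forall i, supp_incl (A i) (B i)) ->
  supp_incl (\sum_i (A i : rop T T)) (\sum_i (B i : rop T T)).
Proof.
move=> pA pB sAB; apply/suppP => S Z /qf0; rewrite qf_sum => h1.
rewrite mul_suml big1 // => i _; apply: ((suppP _ _).1 (sAB i)); apply: qf_eq0 => //.
have := psumr_eq0P _ h1; apply=> // k _; exact: qf_ge0.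
Qed.

(** Joint convexity in homogeneous form. [Qt] is linear in the pair of operators, so the trial
    operator for the sums serves every summand unchanged. *)
Lemma relent_convex T (I : finType) (A B : I -> op R T) :
  (forall i, psd (A i)) -> (forall i, psd (B i)) -> (forall i, supp_incl (A i) (B i)) ->
  relent (\sum_i (A i : rop T T)) (\sum_i (B i : rop T T)) <= \sum_i relent (A i) (B i).
Proof.
move=> pA pB sAB.
have := @relent_cmp R I unit T T A B (fun=> \sum_i (A i : rop T T)) (fun=> \sum_i (B i : rop T T)).
rewrite !sum_unit; apply=> //; try by move=> _; apply: psd_sum.
- by move=> _; apply: supp_sum.
- by rewrite rtr_sum.
move=> t t0 Y; exists (fun=> Y tt); rewrite sum_unit /Qt !qf_sum.
by rewrite mulr_sumr -big_split.
Qed.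

(** For a fixed trial operator [Qt] is monotone in B. This takes the place of the operator
    monotonicity of the logarithm. *)
Lemma relent_mono T (A B B' : op R T) :
  psd A -> psd B -> psd ((B' : rop T T) - B) -> supp_incl A B ->
  supp_incl A B' /\ relent A B' <= relent A B.
Proof.
move=> pA pB pBB' sAB.
have pB' : psd B' by rewrite -[B'](subrK (B : rop T T)); apply: psdD.
have sAB' : supp_incl A B'.
  apply/suppP => S Z hZ; apply: ((suppP A B).1 sAB); apply: qf_eq0 => //.
  by apply/eqP; rewrite eq_le qf_ge0 // andbT; apply: (le_trans (qf_le Z pBB')); rewrite qf0.
split=> //.
have := @relent_cmp R unit unit T T (fun=> A) (fun=> B) (fun=> A) (fun=> B').
rewrite !sum_unit; apply=> // t t0 Y; exists Y; rewrite !sum_unit /Qt lerD2l.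
by rewrite ler_pM2l // qf_le.
Qed.

Lemma log2M (x y : R) : 0 < x -> 0 < y -> log2 (x * y) = log2 x + log2 y.
Proof. by move=> x0 y0; rewrite /log2 x0 y0 mulr_gt0 // lnM ?posrE // mulrDl. Qed.
Lemma log2_1 : log2 1 = 0 :> R. Proof. by rewrite /log2 ltr01 ln1 mul0r. Qed.
Lemma log2_0 : log2 0 = 0 :> R. Proof. by rewrite /log2 ltxx. Qed.

Lemma specZ T (a : R) (A : op R T) U r : spec_decomp A U r ->
  spec_decomp (toC a *: (A : rop T T)) U (fun i => a * r i).
Proof.
move=> h; split; first by case: h.
rewrite {1}(mfun_id h) -[opmul _ _]/(U ** diagop (fun i => a * r i) ** U^H).
rewrite -mulZl -mulZr; congr (_ ** _ ** _); apply: ropP => i j.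
by rewrite ropE !diagopE rmorphM /= mulrCA.
Qed.

Lemma relentZ T (a b : R) (A B : op R T) : 0 < a -> 0 < b ->
  psd A -> psd B -> supp_incl A B ->
  relent (toC a *: (A : rop T T)) (toC b *: (B : rop T T)) =
  a * relent A B + a * (log2 a - log2 b) * rtr (A : rop T T).
Proof.
move=> a0 b0 /psd_spec[U [r [hA r0]]] /psd_spec[V [s [hB s0]]] sAB.
rewrite (relentE (specZ a hA) (specZ b hB)) (relentE hA hB) (rtr_spec hA).
rewrite !big_distrr -big_split /=; apply: eq_bigr => i _.
rewrite -[r i in X in _ + X]mul1r -(ovl_row i (proj1 hA) (proj1 hB)) big_distrl.
rewrite !big_distrr -big_split /=; apply: eq_bigr => j _.
have [e|e] := eqVneq (ovl U V i j * r i) 0.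
  have z (o x X Y Z : R) : o * x = 0 -> o * (a * x * X) = a * (o * (x * Y)) + a * Z * (o * x).
    move=> ox; have -> : o * (a * x * X) = o * x * (a * X) by ring.
    by rewrite (mulrA o x Y) ox !(mul0r, mulr0) addr0.
  exact: z.
have ri : 0 < r i by rewrite lt_def r0 andbT; apply: contra e => /eqP ->; rewrite mulr0.
have sj : 0 < s j.
  by rewrite lt_def s0 andbT; apply: contra e => /eqP h; rewrite (supp_spec sAB hA hB).
rewrite !log2M //; ring.
Qed.

(** From ln (a / b) >= 1 - b / a, since 2 a^2 - 2 a b = a^2 - b^2 + (a - b)^2. Working with square
    roots keeps the quadratic remainder that Pinsker's inequality needs. *)
Lemma klein_sqrt (a b : R) : 0 < a -> 0 < b ->
  a ^+ 2 - b ^+ 2 + (a - b) ^+ 2 <= a ^+ 2 * (ln (a ^+ 2) - ln (b ^+ 2)).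
Proof.
move=> a0 b0; rewrite !lnXn // !mulr2n.
have := ln_ge_sub1 (divr_gt0 a0 b0).
rewrite invf_div lnM ?posrE ?invr_gt0 // lnV ?posrE //.
move: (ln a) (ln b) => u v h.
have h2 : a ^+ 2 * (1 - b / a) <= a ^+ 2 * (u - v) by apply: ler_wpM2l => //; apply: sqr_ge0.
have e : a ^+ 2 * (1 - b / a) = a ^+ 2 - a * b by field; rewrite gt_eqF.
rewrite e in h2; nra.
Qed.

Lemma klein_scalar (x y : R) : 0 <= x -> 0 <= y -> (y = 0 -> x = 0) ->
  x - y + (Num.sqrt x - Num.sqrt y) ^+ 2 <= ln 2 * (x * (log2 x - log2 y)).
Proof.
move=> x0 y0 h; have [->|xn] := eqVneq x 0.
  by rewrite sqrtr0 sub0r mul0r mulr0 sub0r sqrrN sqr_sqrtr // addNr.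
have x1 : 0 < x by rewrite lt_def xn.
have y1 : 0 < y by rewrite lt_def y0 andbT; apply: contra xn => /eqP/h ->.
have -> : ln 2 * (x * (log2 x - log2 y)) = x * (ln x - ln y).
  by rewrite /log2 x1 y1; field; rewrite gt_eqF ?ln2_gt0.
have := klein_sqrt (a := Num.sqrt x) (b := Num.sqrt y).
by rewrite !sqrtr_gt0 !sqr_sqrtr //; apply.
Qed.

(** Origin of the 1/4: (x - y)^2 is (sqrt x - sqrt y)^2 times (sqrt x + sqrt y)^2, and the last
    factor is at most 4 on [0, 1]. *)
Lemma klein_sq_scalar (x y : R) : 0 <= x <= 1 -> 0 <= y <= 1 -> (y = 0 -> x = 0) ->
  x - y + (x - y) ^+ 2 / 4 <= ln 2 * (x * (log2 x - log2 y)).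
Proof.
move=> /andP[x0 x1] /andP[y0 y1] h; apply: le_trans (klein_scalar x0 y0 h).
rewrite lerD2l; set a := Num.sqrt x; set b := Num.sqrt y.
have a0 : 0 <= a by rewrite sqrtr_ge0. have b0 : 0 <= b by rewrite sqrtr_ge0.
have ex : x = a ^+ 2 by rewrite sqr_sqrtr.
have ey : y = b ^+ 2 by rewrite sqr_sqrtr.
have a1 : a <= 1 by rewrite -[1]sqrtr1 ler_wsqrtr.
have b1 : b <= 1 by rewrite -[1]sqrtr1 ler_wsqrtr.
rewrite ler_pdivrMr // ex ey subr_sqr exprMn ler_wpM2l ?sqr_ge0 //.
nra.
Qed.

Lemma klein T (A B : op R T) : psd A -> psd B -> supp_incl A B ->
  rtr (A : rop T T) - rtr (B : rop T T) <= ln 2 * relent A B.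
Proof.
move=> /psd_spec[U [r [hA r0]]] /psd_spec[V [s [hB s0]]] sAB.
rewrite (relentE hA hB) (rtr_spec hA) (rtr_spec hB).
have -> : \sum_a r a - \sum_b s b = \sum_a \sum_b ovl U V a b * (r a - s b).
  have -> : \sum_b s b = \sum_a \sum_b ovl U V a b * s b.
    rewrite exchange_big; apply: eq_bigr => b _.
    by rewrite -big_distrl /= (ovl_col b (proj1 hA) (proj1 hB)) mul1r.
  have -> : \sum_a r a = \sum_a \sum_b ovl U V a b * r a.
    by apply: eq_bigr => a _; rewrite -big_distrl /= (ovl_row a (proj1 hA) (proj1 hB)) mul1r.
  rewrite -sumrB; apply: eq_bigr => a _; rewrite -sumrB.
  by apply: eq_bigr => b _; rewrite mulrBr.
rewrite big_distrr; apply: ler_sum => a _; rewrite big_distrr; apply: ler_sum => b _ /=.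
rewrite mulrCA; have [e|e] := eqVneq (ovl U V a b) 0; first by rewrite e !mul0r.
apply: ler_wpM2l; first exact: ovl_ge0.
apply: le_trans (klein_scalar (r0 a) (s0 b) _); first by rewrite lerDl sqr_ge0.
by move=> /(supp_spec sAB hA hB a)/eqP; rewrite mulf_eq0 (negbTE e) => /eqP.
Qed.

Lemma spec_le_tr T (A : op R T) U r : spec_decomp A U r -> (forall a, 0 <= r a) ->
  forall a, r a <= rtr (A : rop T T).
Proof.
by move=> hA r0 a; rewrite (rtr_spec hA) (bigD1 a) //= lerDl sumr_ge0.
Qed.

(** A Hilbert-Schmidt version. The squared norm of A - B is exactly the average of (r_a - s_b)^2
    under [ovl], so the scalar inequality with its quadratic remainder can be averaged. *)
Lemma pinsker T (A B : op R T) : psd A -> psd B -> supp_incl A B ->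
  rtr (A : rop T T) = 1 -> rtr (B : rop T T) = 1 ->
  fn ((A : rop T T) - B) / 4 <= ln 2 * relent A B.
Proof.
move=> /psd_spec[U [r [hA r0]]] /psd_spec[V [s [hB s0]]] sAB tA tB.
have r1 a := spec_le_tr hA r0 a; have s1 a := spec_le_tr hB s0 a.
rewrite tA in r1; rewrite tB in s1.
rewrite (relentE hA hB).
have pA : psd A by have [uU eA] := hA; rewrite eA; apply: psd_conj; apply: psd_diag.
have pB : psd B by have [uU eB] := hB; rewrite eB; apply: psd_conj; apply: psd_diag.
have -> : fn ((A : rop T T) - B) / 4 = \sum_a \sum_b ovl U V a b * (r a - s b + (r a - s b) ^+ 2 / 4).
  have e1 : \sum_a \sum_b ovl U V a b * (r a - s b) = 0.
    under eq_bigr do under eq_bigr do rewrite mulrBr.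
    under eq_bigr do rewrite sumrB -big_distrl /= (ovl_row _ (proj1 hA) (proj1 hB)) mul1r.
    rewrite sumrB exchange_big /=.
    under [X in _ - X]eq_bigr do rewrite -big_distrl /= (ovl_col _ (proj1 hA) (proj1 hB)) mul1r.
    by rewrite -(rtr_spec hA) -(rtr_spec hB) tA tB subrr.
  have sq (D : op R T) X x : psd D -> spec_decomp D X x -> fn (D : rop T T) = \sum_a x a ^+ 2.
    move=> pD hD; rewrite fn_rtr (psd_herm pD) -{2}(mfun_idE hD) (rtr_mfun_self _ hD).
    by apply: eq_bigr => a _; rewrite expr2.
  rewrite fnB (sq A U r) // (sq B V s) // /ip (psd_herm pA) -{1}(mfun_idE hA) -{1}(mfun_idE hB).
  rewrite (rtr_mfun _ _ hA hB).
  under [RHS]eq_bigr do under eq_bigr do rewrite mulrDr.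
  under [RHS]eq_bigr do rewrite big_split.
  rewrite big_split /= e1 add0r.
  have -> : \sum_a r a ^+ 2 = \sum_a \sum_b ovl U V a b * r a ^+ 2.
    by apply: eq_bigr => a _; rewrite -big_distrl /= (ovl_row _ (proj1 hA) (proj1 hB)) mul1r.
  have -> : \sum_b s b ^+ 2 = \sum_a \sum_b ovl U V a b * s b ^+ 2.
    rewrite exchange_big; apply: eq_bigr => b _.
    by rewrite -big_distrl /= (ovl_col _ (proj1 hA) (proj1 hB)) mul1r.
  rewrite mulr_sumr -big_split -sumrB big_distrl /=; apply: eq_bigr => a _.
  by rewrite mulr_sumr -big_split -sumrB big_distrl /=; apply: eq_bigr => b _; field.
rewrite big_distrr; apply: ler_sum => a _; rewrite big_distrr; apply: ler_sum => b _ /=.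
rewrite mulrCA; have [e|e] := eqVneq (ovl U V a b) 0; first by rewrite e !mul0r.
apply: ler_wpM2l; first exact: ovl_ge0.
apply: klein_sq_scalar; rewrite ?r0 ?r1 ?s0 ?s1 //.
by move=> /(supp_spec sAB hA hB a)/eqP; rewrite mulf_eq0 (negbTE e) => /eqP.
Qed.
End RelEnt.

(** * The measurement frame *)

Section Khinchine.
Variable R : realType.
Local Notation C := R[i].
Local Notation toC := (real_complex R).
Local Notation rop := (rop R).
Variables (A E : finType).
Local Notation V := (rop A A).
Local Notation sgs := {ffun E -> bool}.

Definition sg (s : sgs) c : R := if s c then -1 else 1.
Definition flip x (s : sgs) : sgs := [ffun c => if c == x then ~~ s c else s c].
Lemma flipK x : involutive (flip x).
Proof. by move=> s; apply/ffunP => c; rewrite !ffunE; case: eqP => // _; rewrite negbK. Qed.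
Lemma sg_flip x s c : c != x -> sg (flip x s) c = sg s c.
Proof. by rewrite /sg ffunE => /negbTE ->. Qed.
Lemma sg_flipN x s : sg (flip x s) x = - sg s x.
Proof. by rewrite /sg ffunE eqxx; case: (s x) => //=; rewrite opprK. Qed.
Lemma sg2 s c : sg s c ^+ 2 = 1.
Proof. by rewrite /sg; case: (s c); rewrite ?sqrrN expr1n. Qed.

(* Unnormalised moments over all sign vectors. *)
Definition mom2 (f : sgs -> V) : R := \sum_s fn (f s).
Definition mom4 (f : sgs -> V) : R := \sum_s fn (f s) ^+ 2.
Local Notation N := (#|{: sgs}|%:R : R).

Lemma mom2_ge0 f : 0 <= mom2 f. Proof. by apply: sumr_ge0 => s _; apply: fn_ge0. Qed.
Lemma mom4_ge0 f : 0 <= mom4 f. Proof. by apply: sumr_ge0 => s _; apply: sqr_ge0. Qed.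
Lemma signs_gt0 : 0 < N.
Proof. by rewrite ltr0n; apply/card_gt0P; exists [ffun=> true]. Qed.

Lemma sum_CS (I : finType) (x y : I -> R) : (forall i, 0 <= x i) -> (forall i, 0 <= y i) ->
  (\sum_i x i * y i) ^+ 2 <= (\sum_i x i ^+ 2) * (\sum_i y i ^+ 2).
Proof.
move=> x0 y0; set a := \sum_i x i ^+ 2; set b := \sum_i y i ^+ 2; set c := \sum_i _.
have b0 : 0 <= b by apply: sumr_ge0 => i _; apply: sqr_ge0.
have key z : 0 <= a - 2 * z * c + z ^+ 2 * b.
  have -> : a - 2 * z * c + z ^+ 2 * b = \sum_i (x i - z * y i) ^+ 2.
    rewrite /a /b /c !mulr_sumr -sumrB -big_split /=.
    by apply: eq_bigr => i _; ring.
  by apply: sumr_ge0 => i _; apply: sqr_ge0.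
have [h|h] := eqVneq b 0.
  have -> : c = 0.
    rewrite /c big1 // => i _; have := psumr_eq0P _ h; rewrite /= => /(_ (fun i _ => sqr_ge0 (y i)) i isT) /eqP.
    by rewrite sqrf_eq0 => /eqP ->; rewrite mulr0.
  by rewrite h mulr0 expr0n.
have b1 : 0 < b by rewrite lt_def h.
have := key (c / b); have e : c / b * b = c by rewrite divfK.
move: e; set z := c / b => e; rewrite -e; nra.
Qed.

(** Pairing each s with [flip x s] cancels the terms odd in the sign at x. In the fourth moment the
    surviving cross term is bounded by Cauchy-Schwarz, which turns 2 + 4 into the 6. *)
Lemma mom_step x (f0 g : sgs -> V) :
  (forall s, f0 (flip x s) = f0 s) -> (forall s, g (flip x s) = g s) ->
  let f s := f0 s + toC (sg s x) *: g s in
  mom2 f = mom2 f0 + mom2 g /\ mom4 f <= mom4 f0 + 6 * (\sum_s fn (f0 s) * fn (g s)) + mom4 g.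
Proof.
move=> hf hg f.
have ef s : fn (f s) = fn (f0 s) + fn (g s) + 2 * sg s x * ip (f0 s) (g s).
  by rewrite /f fnD fnZ sqn_toC sg2 mul1r ipZr; ring.
have ef' s : fn (f (flip x s)) = fn (f0 s) + fn (g s) - 2 * sg s x * ip (f0 s) (g s).
  by rewrite ef hf hg sg_flipN; ring.
have dbl (F : sgs -> R) : \sum_s F s = 2^-1 * \sum_s (F s + F (flip x s)).
  have e : \sum_s F s = \sum_s F (flip x s) by rewrite (reindex_inj (inv_inj (flipK x))).
  by rewrite big_split /= -e; field.
split.
  rewrite /mom2 dbl mulr_sumr -big_split; apply: eq_bigr => s _ /=.
  by rewrite ef ef'; field.
rewrite /mom4 dbl !mulr_sumr -!big_split; apply: ler_sum => s _ /=.
rewrite ef ef'; have := ip_CS (f0 s) (g s); have := sg2 s x.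
move: (sg s x) (ip _ _) (fn _) (fn (g s)) => a b c d ha hb.
have -> : 2^-1 * ((c + d + 2 * a * b) ^+ 2 + (c + d - 2 * a * b) ^+ 2)
  = (c + d) ^+ 2 + 4 * (a ^+ 2 * b ^+ 2) by field.
rewrite ha mul1r; lra.
Qed.

(** Inductive step of the (2,4) hypercontractive inequality. The coefficient [g] of the new sign has
    degree one less, hence the smaller constant k; Cauchy-Schwarz bounds the mixed term by the
    geometric mean of the two fourth moments. The constant gains a factor 3 per degree. *)
Lemma hyp_step x k (f0 g : sgs -> V) : 0 <= k ->
  (forall s, f0 (flip x s) = f0 s) -> (forall s, g (flip x s) = g s) ->
  N * mom4 f0 <= (3 * k * mom2 f0) ^+ 2 -> N * mom4 g <= (k * mom2 g) ^+ 2 ->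
  N * mom4 (fun s => f0 s + toC (sg s x) *: g s)
    <= (3 * k * mom2 (fun s => f0 s + toC (sg s x) *: g s)) ^+ 2.
Proof.
move=> k0 hf hg h1 h2; have [-> h4] := mom_step hf hg.
set c := \sum_s _ in h4.
have c0 : 0 <= c by apply: sumr_ge0 => s _; rewrite mulr_ge0 ?fn_ge0.
have hc : c ^+ 2 <= mom4 f0 * mom4 g by apply: sum_CS => s; apply: fn_ge0.
have N0 := signs_gt0; have a0 := mom2_ge0 f0; have b0 := mom2_ge0 g.
have p0 := mom4_ge0 f0; have q0 := mom4_ge0 g.
have hNc : N * c <= 3 * k ^+ 2 * (mom2 f0 * mom2 g).
  rewrite -ler_sqr ?nnegrE; last 2 first.
  - by rewrite mulr_ge0 // ltW.
  - by rewrite !mulr_ge0 // exprn_ge0.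
  have -> : (3 * k ^+ 2 * (mom2 f0 * mom2 g)) ^+ 2 = (3 * k * mom2 f0) ^+ 2 * (k * mom2 g) ^+ 2 by ring.
  apply: (@le_trans _ _ ((N * mom4 f0) * (N * mom4 g))).
    have -> : N * mom4 f0 * (N * mom4 g) = N ^+ 2 * (mom4 f0 * mom4 g) by ring.
    by rewrite exprMn ler_pM2l // exprn_gt0.
  by apply: ler_pM; rewrite ?mulr_ge0 // ltW.
apply: (@le_trans _ _ (N * (mom4 f0 + 6 * c + mom4 g))); first by rewrite ler_pM2l.
have -> : N * (mom4 f0 + 6 * c + mom4 g) = N * mom4 f0 + 6 * (N * c) + N * mom4 g by ring.
have h9 : (k * mom2 g) ^+ 2 <= (3 * k * mom2 g) ^+ 2.
  have h0 := mulr_ge0 k0 b0; rewrite -mulrA; nra.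
have -> : (3 * k * (mom2 f0 + mom2 g)) ^+ 2 = (3 * k * mom2 f0) ^+ 2 + 6 * (3 * k ^+ 2 * (mom2 f0 * mom2 g)) + (3 * k * mom2 g) ^+ 2 by ring.
lra.
Qed.

Definition lin l (v : V) (L : E -> V) (s : sgs) : V := v + \sum_(c <- l) toC (sg s c) *: L c.
(** A chaos of degree at most 2: constant term D, and for each pair of list positions one
    coefficient [Q c c'] with c the earlier entry. The recursion isolates the head sign, on which
    the rest does not depend when the list is duplicate-free. *)
Fixpoint pol2 l (D : V) (Q : E -> E -> V) (s : sgs) : V :=
  if l is c :: l' then pol2 l' D Q s + toC (sg s c) *: lin l' 0 (Q c) s else D.

Lemma lin_flip x l v L s : x \notin l -> lin l v L (flip x s) = lin l v L s.
Proof.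
move=> xl; congr (_ + _); rewrite !big_seq; apply: eq_bigr => c cl.
by rewrite sg_flip //; apply: contraNneq xl => <-.
Qed.
Lemma pol2_flip x l D Q s : x \notin l -> pol2 l D Q (flip x s) = pol2 l D Q s.
Proof.
elim: l => //= c l IH; rewrite inE negb_or => /andP[xc xl].
by rewrite IH // lin_flip // sg_flip // eq_sym.
Qed.

Lemma mom2_cst (v : V) : mom2 (fun=> v) = N * fn v.
Proof. by rewrite /mom2 sumr_const mulr_natl. Qed.
Lemma mom4_cst (v : V) : mom4 (fun=> v) = N * fn v ^+ 2.
Proof. by rewrite /mom4 sumr_const mulr_natl. Qed.

Lemma lin_cons c l v L : lin (c :: l) v L = (fun s => lin l v L s + toC (sg s c) *: L c).
Proof. by apply/funext => s; rewrite /lin big_cons addrCA addrC. Qed.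
Lemma lin_nil v L : lin [::] v L = (fun=> v).
Proof. by apply/funext => s; rewrite /lin big_nil addr0. Qed.

Lemma lin_hyp l v L : uniq l ->
  mom2 (lin l v L) = N * (fn v + \sum_(c <- l) fn (L c)) /\
  N * mom4 (lin l v L) <= (3 * mom2 (lin l v L)) ^+ 2.
Proof.
elim: l => [_|c l IH /andP[cl ul]].
  rewrite lin_nil mom2_cst mom4_cst big_nil addr0; split=> //.
  by rewrite mulrA -expr2 -exprMn; have := sqr_ge0 (N * fn v); nra.
have [h1 h2] := IH ul; rewrite lin_cons.
have inv0 s : lin l v L (flip c s) = lin l v L s by apply: lin_flip.
have [-> _] := mom_step inv0 (fun=> erefl (L c)).
split; first by rewrite h1 mom2_cst big_cons; ring.
have := @hyp_step c 1 (lin l v L) (fun=> L c) ler01 inv0 (fun=> erefl).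
have [-> _] := mom_step inv0 (fun=> erefl (L c)).
rewrite mulr1; apply=> //.
by rewrite mom4_cst mom2_cst mul1r mulrA -expr2 -exprMn.
Qed.

Fixpoint pairsum l (h : E -> E -> R) : R :=
  if l is c :: l' then pairsum l' h + \sum_(c' <- l') h c c' else 0.

(** The constants are 3 for the linear coefficients, by [lin_hyp], and 3 * 3 = 9 after one more
    inductive step. *)
Lemma pol2_hyp l D Q : uniq l ->
  mom2 (pol2 l D Q) = N * (fn D + pairsum l (fun c c' => fn (Q c c'))) /\
  N * mom4 (pol2 l D Q) <= (9 * mom2 (pol2 l D Q)) ^+ 2.
Proof.
elim: l => [_|c l IH /andP[cl ul]].
  have -> : pol2 [::] D Q = (fun=> D) by [].
  rewrite mom2_cst mom4_cst /= addr0; split=> //.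
  by rewrite mulrA -expr2 -exprMn; have := sqr_ge0 (N * fn D); nra.
have [h1 h2] := IH ul.
have -> : pol2 (c :: l) D Q = (fun s => pol2 l D Q s + toC (sg s c) *: lin l 0 (Q c) s) by [].
have inv0 s : pol2 l D Q (flip c s) = pol2 l D Q s by apply: pol2_flip.
have inv1 s : lin l 0 (Q c) (flip c s) = lin l 0 (Q c) s by apply: lin_flip.
have [l1 l2] := lin_hyp 0 (Q c) ul.
have [e _] := mom_step inv0 inv1.
split; first by rewrite e h1 l1 /= fn0; ring.
have h30 : 0 <= 3 :> R by [].
have := hyp_step h30 inv0 inv1.
have -> : 3 * 3 = 9 :> R by ring.
exact.
Qed.
End Khinchine.

(** * The measurement frame and its lower bound *)

Section Povm.
Variable R : realType.
Local Notation C := R[i].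
Local Notation toC := (real_complex R).
Local Notation rop := (rop R).
Variables (A E : finType).
Local Notation V := (rop A A).
Local Notation sgs := {ffun E -> bool}.
Local Notation N := (#|{: sgs}|%:R : R).
Local Notation sg := (@sg R E).

Lemma sum_pair (W : nmodType) (I J : finType) (F : I * J -> W) :
  \sum_p F p = \sum_i \sum_j F (i, j).
Proof. by rewrite pair_bigA; apply: eq_bigr => -[]. Qed.

(** With signs alone a pair c, c' contributes only Y + Y^H, where Y is the block at (c, c'), and an
    anti-Hermitian Y would go unseen. Independent phases 1 and 'i also bring in Y - Y^H. *)
Definition ph (t : sgs) c : C := if t c then 'i else 1.
Lemma ph_sqn t c : (ph t c)^* * ph t c = 1.
Proof.
by rewrite /ph; case: (t c); rewrite ?rmorph1 ?mulr1 // conjCi mulNr -expr2 sqrCi opprK.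
Qed.

Lemma pol2D l D D' Q s : pol2 l (D + D') Q s = D' + @pol2 R A E l D Q s.
Proof. by elim: l => [|c l IH] /=; rewrite ?IH ?addrA // addrC. Qed.

(** Squared signs are 1, so the diagonal becomes the constant term and the two orders of each pair
    merge into one coefficient. *)
Lemma quad_pol2 l (M : E -> E -> V) s :
  \sum_(c <- l) \sum_(c' <- l) toC (sg s c * sg s c') *: M c c'
  = pol2 l (\sum_(c <- l) M c c) (fun c c' => M c c' + M c' c) s.
Proof.
elim: l => [|x l IH]; first by rewrite !big_nil.
rewrite /= [in RHS]big_cons [M x x + _]addrC pol2D -IH big_cons big_cons.
have -> : \sum_(c <- l) \sum_(c' <- x :: l) toC (sg s c * sg s c') *: M c c' =
  \sum_(c <- l) toC (sg s c * sg s x) *: M c x +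
  \sum_(c <- l) \sum_(c' <- l) toC (sg s c * sg s c') *: M c c'.
  by rewrite -big_split; apply: eq_bigr => c _; rewrite big_cons.
rewrite -expr2 sg2 rmorph1 scale1r -!addrA; congr (_ + _).
rewrite /lin add0r scaler_sumr addrCA addrA addrC; congr (_ + _).
rewrite -big_split; apply: eq_bigr => c _ /=.
by rewrite scalerA -rmorphM scalerDr addrC (mulrC (sg s c)).
Qed.

Lemma pairsumM l (h : E -> E -> R) k : pairsum l (fun c c' => k * h c c') = k * pairsum l h.
Proof. by elim: l => [|c l IH] /=; rewrite ?mulr0 // IH mulrDr mulr_sumr. Qed.
Lemma pairsum_le l (h h' : E -> E -> R) : uniq l -> (forall c c', c != c' -> h c c' <= h' c c') ->
  pairsum l h <= pairsum l h'.
Proof.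
move=> ul hh; elim: l ul => //= c l IH /andP[cl ul]; apply: lerD; first exact: IH.
rewrite !big_seq; apply: ler_sum => c' c'l; apply: hh.
by apply: contraNneq cl => ->.
Qed.
Lemma pairsum_eq l (h h' : E -> E -> R) : uniq l -> (forall c c', c != c' -> h c c' = h' c c') ->
  pairsum l h = pairsum l h'.
Proof.
by move=> ul hh; apply/eqP; rewrite eq_le !pairsum_le // => c c' cc'; rewrite hh.
Qed.
Lemma pairsum_sum (I : finType) l (h : I -> E -> E -> R) :
  \sum_i pairsum l (h i) = pairsum l (fun c c' => \sum_i h i c c').
Proof.
elim: l => [|c l IH] /=; first by rewrite big1.
by rewrite big_split IH exchange_big.
Qed.
Lemma pairsum_sym l (h : E -> E -> R) : (forall c c', h c c' = h c' c) ->
  \sum_(c <- l) \sum_(c' <- l) h c c' = \sum_(c <- l) h c c + 2 * pairsum l h.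
Proof.
move=> hs; elim: l => [|x l IH]; first by rewrite !big_nil mulr0 addr0.
rewrite /= !big_cons.
have -> : \sum_(c <- l) \sum_(c' <- x :: l) h c c' =
  \sum_(c <- l) h x c + \sum_(c <- l) \sum_(c' <- l) h c c'.
  by rewrite -big_split; apply: eq_bigr => c _; rewrite big_cons (hs c x).
rewrite IH; ring.
Qed.

Lemma sum_sg2 c c' : c != c' -> \sum_t sg t c * sg t c' = 0.
Proof.
move=> cc'; set x := \sum_t _.
have : x = - x.
  rewrite {1}/x (reindex_inj (inv_inj (@flipK E c))) -sumrN; apply: eq_bigr => t _.
  by rewrite sg_flipN sg_flip 1?eq_sym // mulNr.
lra.
Qed.

Variable X : rop (A * E)%type (A * E)%type.
Hypothesis hX : X^H = X.
Definition cblock c c' : V := fun a a' => X (a, c) (a', c').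
Lemma cblock_ct c c' : cblock c' c = (cblock c c')^H.
Proof. by apply: ropP => a a'; rewrite /cblock /ct -{1}hX. Qed.

Definition phase_block t c c' : V := ((ph t c)^* * ph t c') *: cblock c c'.

(** Equal phases give Y + Y^H, different phases a unimodular multiple of Y - Y^H. The product
    [sg t c * sg t c'] tells the two cases apart and averages to zero over t. *)
Lemma fn_phase_block t c c' : c != c' ->
  fn (phase_block t c c' + phase_block t c' c) = 2 * fn (cblock c c') + 2 * (sg t c * sg t c') * ip (cblock c c') (cblock c c')^H.
Proof.
move=> cc'; rewrite /phase_block (cblock_ct c c'); move: (cblock c c') => Y.
have f1 : fn (Y + Y^H) = 2 * fn Y + 2 * ip Y Y^H by rewrite fnD fn_ct; ring.
have f2 : fn (Y - Y^H) = 2 * fn Y - 2 * ip Y Y^H by rewrite fnB fn_ct; ring.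
have si : sqn ('i : C) = 1.
  by apply: (@toC_inj R); rewrite sqnE conjCi mulrN -expr2 sqrCi opprK rmorph1.
rewrite /ph /sg; case: (t c); case: (t c'); rewrite ?rmorph1 ?mul1r ?mulr1.
- rewrite conjCi mulNr -expr2 sqrCi opprK !scale1r f1; ring.
- rewrite conjCi scaleNr addrC -scalerBr fnZ si -[Y^H - Y]opprB -scaleN1r fnZ.
  rewrite sqnN sqn1 f2; ring.
- rewrite conjCi scaleNr -scalerBr fnZ si f2; ring.
- rewrite !scale1r f1; ring.
Qed.

Definition sign_block_sum (p : sgs * sgs) : V :=
  \sum_c \sum_c' toC (sg p.1 c * sg p.1 c') *: phase_block p.2 c c'.
Let D : V := \sum_c cblock c c.
(** P is the squared norm of the off-diagonal blocks; q turns out to be the mean of the squared norm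
    of [sign_block_sum] over all signs and phases. *)
Let P : R := \sum_c \sum_c' fn (cblock c c') - \sum_c fn (cblock c c).
Let q := fn D + P.

Lemma sign_block_sumE s t : sign_block_sum (s, t) = pol2 (index_enum E) D (fun c c' => phase_block t c c' + phase_block t c' c) s.
Proof.
rewrite /sign_block_sum /=; have := quad_pol2 (index_enum E) (phase_block t) s.
move=> ->; congr pol2; apply: eq_bigr => c _.
by rewrite /phase_block ph_sqn scale1r.
Qed.

Let hh c c' := fn (cblock c c').
Lemma offdiagE : P = pairsum (index_enum E) (fun c c' => 2 * hh c c').
Proof.
rewrite pairsumM /P (@pairsum_sym (index_enum E) hh); first by rewrite addrC addKr.
by move=> c c'; rewrite /hh cblock_ct fn_ct.
Qed.
Lemma offdiag_ge0 : 0 <= P.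
Proof.
rewrite offdiagE; elim: (index_enum E) => //= c l IH; rewrite addr_ge0 // sumr_ge0 // => c' _.
by rewrite mulr_ge0 ?fn_ge0.
Qed.

Let ps t := pairsum (index_enum E) (fun c c' => fn (phase_block t c c' + phase_block t c' c)).
Lemma pairsum_phase_sum : \sum_t ps t = N * P.
Proof.
rewrite /ps pairsum_sum offdiagE -pairsumM; apply: pairsum_eq; first exact: index_enum_uniq.
move=> c c' cc'; under eq_bigr do rewrite fn_phase_block //.
rewrite big_split /= sumr_const -mulr_suml -mulr_sumr sum_sg2 // mulr0 mul0r addr0.
by rewrite [RHS]mulr_natl.
Qed.
(** Parallelogram law: adding the squared norm of the difference gives a phase-independent total. No
    choice of phases exceeds twice the average. *)
Lemma pairsum_phase_le t : ps t <= 2 * P.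
Proof.
rewrite offdiagE -pairsumM; apply: pairsum_le; first exact: index_enum_uniq.
move=> c c' cc'; apply: (@le_trans _ _ (fn (phase_block t c c' + phase_block t c' c) + fn (phase_block t c c' - phase_block t c' c))).
  by rewrite lerDl fn_ge0.
rewrite fnB fnD.
have fM d d' : fn (phase_block t d d') = hh d d'.
  rewrite /phase_block fnZ sqnM sqn_conj -sqnM; have : sqn (ph t d * ph t d') = 1.
    rewrite sqnM; have s1 e : sqn (ph t e) = 1.
      by apply: (@toC_inj R); rewrite sqnE mulrC ph_sqn rmorph1.
    by rewrite !s1 mulr1.
  by move=> ->; rewrite mul1r.
rewrite !fM; have -> : hh c' c = hh c c' by rewrite /hh cblock_ct fn_ct.
lra.
Qed.

Lemma sign_block_mom2 : \sum_p fn (sign_block_sum p) = N ^+ 2 * q.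
Proof.
rewrite -(pair_bigA _ (fun s t => fn (sign_block_sum (s, t)))) exchange_big /=.
have h t : \sum_s fn (sign_block_sum (s, t)) = N * (fn D + ps t).
  rewrite -[N * _](proj1 (pol2_hyp D (fun c c' => phase_block t c c' + phase_block t c' c) (index_enum_uniq E))).
  by apply: eq_bigr => s _; rewrite sign_block_sumE.
under eq_bigr do rewrite h; rewrite -mulr_sumr big_split /= pairsum_phase_sum sumr_const -[_ *+ #|_|]mulr_natl /q.
ring.
Qed.
(** Here 162 = 2 * 9^2: the square of the degree-2 constant at fixed phases, times 2 for the
    fluctuation of the second moment with the phases. *)
Lemma sign_block_mom4 : \sum_p fn (sign_block_sum p) ^+ 2 <= 162 * N ^+ 2 * q ^+ 2.
Proof.
rewrite -(pair_bigA _ (fun s t => fn (sign_block_sum (s, t)) ^+ 2)) exchange_big /=.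
have N0 := @signs_gt0 R E; have fD := fn_ge0 D; have P0 := offdiag_ge0.
have h t : \sum_s fn (sign_block_sum (s, t)) ^+ 2 <= 162 * N * q * (fn D + ps t).
  have [e] := pol2_hyp D (fun c c' => phase_block t c c' + phase_block t c' c) (index_enum_uniq E).
  rewrite e -/(ps t); set y := mom4 _ => hy.
  have -> : \sum_s fn (sign_block_sum (s, t)) ^+ 2 = y by apply: eq_bigr => s _; rewrite sign_block_sumE.
  rewrite -(ler_pM2l N0); apply: (le_trans hy).
  have p0 : 0 <= ps t.
    rewrite /ps; elim: (index_enum E) => //= c l IH; rewrite addr_ge0 // sumr_ge0 // => c' _.
    exact: fn_ge0.
  have hq : fn D + ps t <= 2 * q by rewrite /q; have := pairsum_phase_le t; lra.
  have -> : (9 * (N * (fn D + ps t))) ^+ 2 = (81 * N ^+ 2 * (fn D + ps t)) * (fn D + ps t) by ring.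
  have -> : N * (162 * N * q * (fn D + ps t)) = (81 * N ^+ 2 * (fn D + ps t)) * (2 * q) by ring.
  by apply: ler_wpM2l => //; rewrite !mulr_ge0 ?addr_ge0 // exprn_ge0 // ltW.
apply: (le_trans (ler_sum _ (fun t _ => h t))).
rewrite -mulr_sumr big_split /= pairsum_phase_sum sumr_const -[_ *+ #|_|]mulr_natl -mulrDr -/q.
by rewrite le_eqVlt; apply/orP; left; apply/eqP; ring.
Qed.

(** A small fourth moment forces a large first moment: v^2 - v^4 <= v is summed at v = x / (18 sqrt
    k). Since 18^2 = 2 * 162, the fourth-moment term is half of the second-moment term, which leaves
    n / 648 and so the constant 648 / 18 = 36. *)
Lemma moment_scalar (I : finType) (x : I -> R) n k : 0 < n -> 0 <= k ->
  (forall i, 0 <= x i) -> \sum_i x i ^+ 2 = n * k -> \sum_i x i ^+ 4 <= 162 * n * k ^+ 2 ->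
  n * Num.sqrt k <= 36 * \sum_i x i.
Proof.
move=> n0; rewrite le_eqVlt => /orP[/eqP <- x0 _ _|k0 x0 h2 h4].
  by rewrite sqrtr0 mulr0 mulr_ge0 // sumr_ge0.
set w := Num.sqrt k; have w0 : 0 < w by rewrite sqrtr_gt0.
have ek : k = w ^+ 2 by rewrite sqr_sqrtr // ltW.
have pt u : 0 <= u -> u ^+ 2 / (18 * w) ^+ 2 - u ^+ 4 / (18 * w) ^+ 4 <= u / (18 * w).
  move=> u0; rewrite -!expr_div_n; set v := u / (18 * w).
  have v0 : 0 <= v by rewrite divr_ge0 // mulr_ge0 // ltW.
  have -> : v ^+ 4 = v ^+ 2 * v ^+ 2 by ring.
  suff : 0 <= v * (1 - v + v ^+ 3) by rewrite (exprD v 2 1); nra.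
  apply: mulr_ge0 => //; have [v1|v1] := leP v 1.
    by have := exprn_ge0 3 v0; lra.
  have : v <= v ^+ 3 by apply: ler_eXnr => //; apply: ltW.
  lra.
have := ler_sum (index_enum I) (fun i (_ : true) => pt (x i) (x0 i)).
rewrite sumrB -!mulr_suml h2 => hs.
have w18 : 0 < (18 * w) by rewrite mulr_gt0.
have : n * k / (18 * w) ^+ 2 - 162 * n * k ^+ 2 / (18 * w) ^+ 4 <= (\sum_i x i) / (18 * w).
  apply: le_trans hs; rewrite lerD2l lerN2 ler_pM2r // invr_gt0 exprn_gt0 //.
have -> : n * k / (18 * w) ^+ 2 - 162 * n * k ^+ 2 / (18 * w) ^+ 4 = n / 648.
  by rewrite ek; field; rewrite gt_eqF.
rewrite ler_pdivlMr //; lra.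
Qed.

Lemma sign_block_nm : N ^+ 2 * Num.sqrt P <= 36 * \sum_p nm (sign_block_sum p).
Proof.
have q0 : 0 <= q by rewrite addr_ge0 ?fn_ge0 // offdiag_ge0.
have := @moment_scalar _ (fun p => nm (sign_block_sum p)) (N ^+ 2) q.
rewrite exprn_gt0 ?signs_gt0 // => /(_ isT q0 (fun p => nm_ge0 (sign_block_sum p))).
under eq_bigr do rewrite nm2.
under [X in _ -> X <= _ -> _]eq_bigr do rewrite (exprM _ 2 2) nm2.
rewrite sign_block_mom2 => /(_ erefl sign_block_mom4); apply: le_trans.
by rewrite ler_pM2l ?exprn_gt0 ?signs_gt0 // ler_wsqrtr // lerDr fn_ge0.
Qed.

Definition blk (Y : rop (A * E)%type (A * E)%type) (v : vec R E) : V :=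
  fun a a' => \sum_c \sum_c' (v c)^* * Y (a, c) (a', c') * v c'.

(* With weight 1/2 the standard basis, with weight 1/2 the vectors of entries
   +-1 or +-'i.  The basis part sees the diagonal blocks of X; the block seen by a
   random vector is a degree-2 Rademacher chaos with values in operators on A. *)
Definition pov (k : E + sgs * sgs) : vec R E := match k with
  | inl e => fun c => toC (Num.sqrt 2^-1) * (c == e)%:R
  | inr p => fun c => toC (Num.sqrt 2^-1 / N * sg p.1 c) * ph p.2 c
  end.

Lemma fn_blocks : fn X = \sum_c \sum_c' fn (cblock c c').
Proof.
rewrite /fn sum_pair exchange_big /=; apply: eq_bigr => c _.
rewrite [RHS]exchange_big /=; apply: eq_bigr => a _.
by rewrite sum_pair exchange_big.
Qed.

Lemma blk_inl e : blk X (pov (inl e)) = toC 2^-1 *: cblock e e.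
Proof.
apply: ropP => a a'; rewrite /blk ropE (bigD1 e) //= [X in _ + X]big1 ?addr0; last first.
  by move=> c /negbTE ce; rewrite big1 // => c' _; rewrite ce mulr0 conjC0 !mul0r.
rewrite (bigD1 e) //= [X in _ + X]big1 ?addr0; last first.
  by move=> c /negbTE ce; rewrite ce !mulr0.
rewrite eqxx !mulr1 conj_toC mulrAC -rmorphM /=; congr (toC _ * _).
by rewrite -expr2 sqr_sqrtr.
Qed.
Lemma blk_inr p : blk X (pov (inr p)) = toC (2^-1 / N ^+ 2) *: sign_block_sum p.
Proof.
apply: ropP => a a'; rewrite /blk /sign_block_sum !ropE mulr_sumr; apply: eq_bigr => c _.
rewrite ropE mulr_sumr; apply: eq_bigr => c' _; rewrite /phase_block !ropE /cblock rmorphM /= conj_toC.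
have -> : 2^-1 / N ^+ 2 = (Num.sqrt 2^-1 / N) * (Num.sqrt 2^-1 / N).
  by rewrite mulrACA -!expr2 sqr_sqrtr // exprVn.
rewrite !rmorphM /=.  ring.
Qed.

(* The fourth moment of a degree-2 chaos is at most 81 times its squared second
   moment, so its first moment is comparable with its L2 norm. *)
Lemma pov_nm : nm X <= 72 * \sum_k nm (blk X (pov k)).
Proof.
rewrite big_sumType /=; have N0 := @signs_gt0 R E.
have -> : \sum_e nm (blk X (pov (inl e))) = 2^-1 * \sum_e nm (cblock e e).
  by rewrite mulr_sumr; apply: eq_bigr => e _; rewrite blk_inl nmZ.
have -> : \sum_p nm (blk X (pov (inr p))) = 2^-1 / N ^+ 2 * \sum_p nm (sign_block_sum p).
  by rewrite mulr_sumr; apply: eq_bigr => p _; rewrite blk_inr nmZ // mulr_ge0 ?invr_ge0 // exprn_ge0 // ltW.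
set a := \sum_e _; set b := \sum_p _.
have a0 : 0 <= a by apply: sumr_ge0 => e _; apply: nm_ge0.
(* The factor 36 for the random vectors is doubled by their weight 1/2. The basis vectors, which
   control the diagonal blocks, lose only the factor 2. *)
have hb : Num.sqrt P / 72 <= 2^-1 / N ^+ 2 * b.
  have := sign_block_nm; rewrite -/b => h.
  have -> : 2^-1 / N ^+ 2 * b = 36 * b / (72 * N ^+ 2) by field; rewrite gt_eqF.
  rewrite ler_pdivlMr ?mulr_gt0 ?exprn_gt0 //.
  by have -> : Num.sqrt P / 72 * (72 * N ^+ 2) = N ^+ 2 * Num.sqrt P by field.
have ha : Num.sqrt (\sum_e fn (cblock e e)) <= a.
  rewrite -[a]ger0_norm // -sqrtr_sqr ler_wsqrtr // /a.
  elim: (index_enum E) => [|e l IH]; first by rewrite !big_nil expr0n.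
  rewrite !big_cons sqrrD -nm2.
  have : 0 <= nm (cblock e e) * \sum_(j <- l) nm (cblock j j).
    by rewrite mulr_ge0 ?nm_ge0 // sumr_ge0 // => j _; apply: nm_ge0.
  by move: IH; lra.
have hX' : nm X <= Num.sqrt P + Num.sqrt (\sum_e fn (cblock e e)).
  have p0 := offdiag_ge0; have d0 : 0 <= \sum_e fn (cblock e e) by apply: sumr_ge0 => e _; apply: fn_ge0.
  rewrite -ler_sqr ?nnegrE ?addr_ge0 ?nm_ge0 ?sqrtr_ge0 // nm2 fn_blocks sqrrD !sqr_sqrtr //.
  have -> : \sum_c \sum_c' fn (cblock c c') = P + \sum_e fn (cblock e e) by rewrite /P subrK.
  have := mulr_ge0 (sqrtr_ge0 P) (sqrtr_ge0 (\sum_e fn (cblock e e))); lra.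
lra.
Qed.
End Povm.

Lemma conjM_toC (R : realType) (a : R) (z : R[i]) :
  (real_complex R a * z)^* = real_complex R a * z^*.
Proof. by rewrite rmorphM /= conj_toC. Qed.

(** The basis vectors give half of the identity. For the others the signs cancel the off-diagonal
    entries and the phases have modulus 1, which gives the other half. *)
Lemma pov_complete (R : realType) (E : finType) (c c' : E) :
  \sum_k @pov R E k c * (pov R k c')^* = (c == c')%:R.
Proof.
have N0 := @signs_gt0 R E; set N := #|_|%:R in N0.
rewrite big_sumType /=.
have -> : \sum_e real_complex R (Num.sqrt 2^-1) * (c == e)%:R * (real_complex R (Num.sqrt 2^-1) * (c' == e)%:R)^* = real_complex R 2^-1 * (c == c')%:R.
  rewrite (bigD1 c) //= [X in _ + X]big1 ?addr0; last first.
    by move=> e /negbTE ce; rewrite (eq_sym c) ce mulr0 mul0r.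
  rewrite eqxx mulr1 rmorphM /= conj_toC rmorph_nat mulrA -rmorphM /= -expr2 sqr_sqrtr //.
  by rewrite (eq_sym c').
pose w : R := 2^-1 / N ^+ 2.
have -> : \sum_p real_complex R (Num.sqrt 2^-1 / N * sg R p.1 c) * ph R p.2 c *
    (real_complex R (Num.sqrt 2^-1 / N * sg R p.1 c') * ph R p.2 c')^* =
   \sum_(s : {ffun E -> bool}) \sum_(t : {ffun E -> bool})
     real_complex R (w * (sg R s c * sg R s c')) * (ph R t c * (ph R t c')^*).
  rewrite sum_pair; apply: eq_bigr => s _; apply: eq_bigr => t _.
  have -> : w = (Num.sqrt 2^-1 / N) * (Num.sqrt 2^-1 / N).
    by rewrite mulrACA -!expr2 sqr_sqrtr // exprVn.
  rewrite conjM_toC !rmorphM /=; ring.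
have [<-|cc'] := eqVneq c c'.
  under eq_bigr do under eq_bigr do rewrite [ph _ _ _ * _]mulrC ph_sqn mulr1 -expr2 sg2 mulr1.
  rewrite !sumr_const -!rmorphMn /=.
  have -> : w *+ #|{: {ffun E -> bool}}| *+ #|{: {ffun E -> bool}}| = 2^-1.
    by rewrite -mulrnA -[LHS]mulr_natl natrM /w; field; rewrite gt_eqF.
  have h : 2^-1 + 2^-1 = 1 :> R by field.
  by rewrite mulr1 -rmorphD /= h.
under eq_bigr do rewrite -mulr_sumr.
rewrite -mulr_suml -rmorph_sum -mulr_sumr sum_sg2 //.
by rewrite !(mulr0, rmorph0, mul0r, addr0).
Qed.

(** * Continuity of the entanglement of formation at separable states *)

Section EntropyBound.
Variable R : realType.
Implicit Types x y g : R.

(** Tangent at 1 to the concave function x^g, obtained from Young's inequality with exponents 1 / g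
    and 1 / (1 - g). *)
Lemma powR_tangent x g : 0 < g -> g < 1 -> 0 <= x -> x `^ g <= g * x + (1 - g).
Proof.
move=> g0 g1 x0; have h1 : 0 < 1 - g by lra.
have := @conjugate_powR R (x `^ g) 1 g^-1 (1 - g)^-1 (powR_ge0 _ _) ler01.
rewrite !invr_gt0 !invrK => /(_ g0 h1); rewrite addrC subrK => /(_ erefl).
by rewrite mulr1 powR1 mul1r -powRrM mulfV ?gt_eqF // powRr1 // mulrC.
Qed.

(** Apply ln u <= u - 1 to u = x^(g - 1). The logarithm is traded for a power, at the price 1 / (1 -
    g). *)
Lemma xlnx_le x g : 0 < x -> 0 < g -> g < 1 -> - (x * ln x) <= x `^ g / (1 - g).
Proof.
move=> x0 g0 g1; have h1 : 0 < 1 - g by lra.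
have y0 : 0 < x `^ (g - 1) by apply: powR_gt0.
have := ln_le_sub1 y0; rewrite ln_powR => h.
have e : x `^ g = x * x `^ (g - 1) by rewrite mulr_powRB1 // ltW.
rewrite e ler_pdivlMr //.
have : x * ((g - 1) * ln x) <= x * x `^ (g - 1) by apply: ler_wpM2l; lra.
lra.
Qed.

Lemma le_powR_1 x g : 0 <= x -> x <= 1 -> 0 < g -> g < 1 -> x <= x `^ g.
Proof.
rewrite le_eqVlt => /orP[/eqP <- _ _ _|x0 x1 g0 g1]; first exact: powR_ge0.
by apply: ger1_powR; rewrite ?x0 ?x1 // ltW.
Qed.

(* Constant in the bound  S <= Cent g * log2 d * (1 - lmax)^g  for the entropy of a
   spectrum of size d; it blows up as g tends to 1, which costs the eta of the theorem. *)
Definition Cent g : R := 1 + (1 + (1 - g)^-1) / ln 2.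

Lemma Cent_ge0 g : g < 1 -> 0 < Cent g.
Proof.
move=> g1; have l2 := @ln2_gt0 R.
have g1' : 0 < (1 - g)^-1 by rewrite invr_gt0; lra.
have : 0 <= (1 + (1 - g)^-1) / ln 2 by apply: divr_ge0; lra.
rewrite /Cent; lra.
Qed.

(** A Fano-type inequality. The mass y = 1 - l m outside m is compared with the value y / d on at
    most d nonzero entries; the entry m itself costs at most y, because - x ln x <= 1 - x. *)
Lemma sum_xlnx (T : finType) (l : T -> R) m (d : nat) :
  (forall a, 0 <= l a) -> \sum_a l a = 1 -> (#|[pred a | l a != 0%R]| <= d)%N -> (0 < d)%N ->
  l m < 1 ->
  - \sum_a l a * (if 0 < l a then ln (l a) else 0) <=
  (1 - l m) + (1 - l m) * ln d%:R - (1 - l m) * ln (1 - l m).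
Proof.
move=> l0 l1 hd d0 lm; set y := 1 - l m.
have y0 : 0 < y by rewrite subr_gt0.
have dR : 0 < d%:R :> R by rewrite ltr0n.
have ys : \sum_(a | a != m) l a = y by move: l1; rewrite (bigD1 m) //= /y; lra.
have pt a : - (l a * (if 0 < l a then ln (l a) else 0)) <=
   l a * ln (d%:R / y) + (l a != 0)%:R * (y / d%:R) - l a.
  have := l0 a; rewrite le_eqVlt => /orP[/eqP <-|la].
    by rewrite eqxx !mul0r oppr0 !addr0.
  rewrite la gt_eqF //= mul1r.
  have z0 : 0 < y / (d%:R * l a) by rewrite divr_gt0 // mulr_gt0.
  have := ln_le_sub1 z0; rewrite !lnM ?posrE ?invr_gt0 ?mulr_gt0 // !lnV ?posrE ?mulr_gt0 //.
  rewrite lnM ?posrE // => h.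
  have h2 := ler_wpM2l (l0 a) h.
  have e : l a * (y / (d%:R * l a) - 1) = y / d%:R - l a by field; rewrite !gt_eqF.
  rewrite e in h2; lra.
rewrite (bigD1 m) //= opprD.
have hm : - (l m * (if 0 < l m then ln (l m) else 0)) <= y.
  case: ltP => h; last by rewrite mulr0 oppr0 ltW.
  have := ler_wpM2l (l0 m) (ln_ge_sub1 h); rewrite mulrBr mulfV ?gt_eqF // /y; lra.
have hs : - \sum_(a | a != m) l a * (if 0 < l a then ln (l a) else 0) <= y * ln (d%:R / y).
  rewrite -sumrN; apply: (le_trans (ler_sum _ (fun a _ => pt a))).
  rewrite !big_split /= sumrN -!mulr_suml ys.
  have : (\sum_(a | a != m) (l a != 0)%:R) * (y / d%:R) <= y.
    rewrite mulrCA -[X in _ <= X]mulr1 ler_pM2l // ler_pdivrMr // mul1r.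
    apply: (@le_trans _ _ (\sum_a (l a != 0)%:R)).
      rewrite [X in _ <= X](bigD1 m) //= lerDr; exact: ler0n.
    rewrite -natr_sum ler_nat; apply: leq_trans hd.
    by rewrite -sum1_card [X in (_ <= X)%N]big_mkcond /=; apply: leq_sum => a _; rewrite inE; case: (l a != 0).
  lra.
have : ln (d%:R / y) = ln d%:R - ln y by rewrite lnM ?posrE ?invr_gt0 // lnV ?posrE.
move=> e; rewrite e in hs; lra.
Qed.

(** With d >= 2 all constants are absorbed into a multiple of log d, and y <= 1 allows y <= y^g. *)
Lemma sum_xlog_bound (T : finType) (l : T -> R) m (d : nat) g :
  (forall a, 0 <= l a) -> \sum_a l a = 1 -> (#|[pred a | l a != 0%R]| <= d)%N -> (1 < d)%N ->
  0 < g -> g < 1 ->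
  - \sum_a l a * log2 (l a) <= Cent g * log2 d%:R * (1 - l m) `^ g.
Proof.
move=> l0 l1 hd d1 g0 g1; have l2 := @ln2_gt0 R.
have lm1 : l m <= 1 by rewrite -l1 (bigD1 m) //= lerDl sumr_ge0.
have dR : 2 <= d%:R :> R by rewrite (ler_nat R 2).
have lnd : ln 2 <= ln d%:R :> R by rewrite ler_ln ?posrE //; lra.
have ed : log2 d%:R = ln d%:R / ln 2 :> R by rewrite /log2 ifT //; lra.
have [lm|lm] := ltP (l m) 1; last first.
  have e1 : l m = 1 by apply/eqP; rewrite eq_le lm1 lm.
  have e0 a : a != m -> l a = 0.
    move: l1; rewrite (bigD1 m) //= e1 => /(canRL (addKr _)); rewrite addNr.
    by move=> /psumr_eq0P h am; apply: h.
  rewrite (bigD1 m) //= big1 ?addr0; last by move=> a /e0 ->; rewrite mul0r.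
  rewrite e1 log2_1 mulr0 oppr0 mulr_ge0 ?powR_ge0 // mulr_ge0 //.
    by rewrite ltW // Cent_ge0.
  by rewrite ed divr_ge0 //; lra.
have := @sum_xlnx T l m d l0 l1 hd (ltnW d1) lm; set y := 1 - l m.
have y0 : 0 < y by rewrite subr_gt0.
have y1 : y <= 1 by have := l0 m; rewrite /y; lra.
have e : \sum_a l a * log2 (l a) = (\sum_a l a * (if 0 < l a then ln (l a) else 0)) / ln 2.
  rewrite mulr_suml; apply: eq_bigr => a _; rewrite /log2; case: ifP => _; rewrite ?mulrA //.
  by rewrite !mulr0 mul0r.
rewrite e; set s := \sum_a _ => hs.
have h1 := xlnx_le y0 g0 g1.
have h2 := le_powR_1 (ltW y0) y1 g0 g1.
have p0 : 0 < y `^ g by apply: powR_gt0.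
have g1' : 0 < (1 - g)^-1 by rewrite invr_gt0; lra.
rewrite -mulNr ler_pdivrMr // ed.
have -> : Cent g * (ln d%:R / ln 2) * y `^ g * ln 2 = Cent g * ln d%:R * y `^ g.
  by field; rewrite gt_eqF.
have hC : ln d%:R + (1 + (1 - g)^-1) <= Cent g * ln d%:R.
  rewrite /Cent mulrDl mul1r lerD2l mulrAC -mulrA ler_peMr //; first lra.
  by rewrite ler_pdivlMr // mul1r.
have hy : y * ln d%:R <= y `^ g * ln d%:R by apply: ler_wpM2r => //; lra.
have := ler_wpM2r (ltW p0) hC.
have -> : (ln d%:R + (1 + (1 - g)^-1)) * y `^ g = y `^ g * ln d%:R + y `^ g + y `^ g / (1 - g) by ring.
lra.
Qed.
End EntropyBound.

(** * Pure states: Schmidt rank, overlap with product vectors, decompositions *)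

Section Vectors.
Variable R : realType.
Local Notation C := R[i].
Local Notation toC := (real_complex R).
Local Notation rop := (rop R).
Local Notation "'id1'" := (@idop R _).
Implicit Types S T W X Y : finType.

Definition col T (v : vec R T) : rop T unit := fun i _ => v i.
Definition vn T (v : vec R T) : R := \sum_i sqn (v i).
Definition vmx X Y (v : vec R (X * Y)%type) : rop X Y := fun x y => v (x, y).
Definition prodv X Y (a : vec R X) (b : vec R Y) : vec R (X * Y)%type := fun p => a p.1 * b p.2.
Definition vscale T (a : R) (v : vec R T) : vec R T := fun i => toC a * v i.
Definition vsub T (v w : vec R T) : vec R T := fun i => v i - w i.
Definition nrm T (v : vec R T) : vec R T := vscale (Num.sqrt (vn v))^-1 v.
Definition Sent X Y (v : vec R (X * Y)%type) : R := vN_entropy (ptrace2 (outer v)).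

Lemma vn_ge0 T (v : vec R T) : 0 <= vn v.
Proof. by apply: sumr_ge0 => i _; apply: sqn_ge0. Qed.
Lemma vnorm2E T (v : vec R T) : vnorm2 v = toC (vn v).
Proof. by rewrite /vnorm2 /vn toC_sum; apply: eq_bigr => i _; rewrite sqnE mulrC. Qed.
Lemma fn_col T (v : vec R T) : fn (col v) = vn v.
Proof. by rewrite /fn; apply: eq_bigr => i _; rewrite sum_unit. Qed.
Lemma outerE T (v : vec R T) : outer v = col v ** (col v)^H.
Proof. by apply: ropP => i j; rewrite /mul sum_unit. Qed.
Lemma psd_outer T (v : vec R T) : psd (outer v).
Proof. by rewrite outerE; apply: psd_factor. Qed.
Lemma rtr_outer T (v : vec R T) : rtr (outer v : rop T T) = vn v.
Proof. by rewrite outerE -fn_rtr fn_col. Qed.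
Lemma fn_vmx X Y (v : vec R (X * Y)%type) : fn (vmx v) = vn v.
Proof. by rewrite /fn /vn sum_pair. Qed.
Lemma ptrace2_outer X Y (v : vec R (X * Y)%type) : ptrace2 (outer v) = vmx v ** (vmx v)^H.
Proof. by apply: ropP. Qed.
Lemma psd_ptrace2_outer X Y (v : vec R (X * Y)%type) : psd (ptrace2 (outer v)).
Proof. by rewrite ptrace2_outer; apply: psd_factor. Qed.
Lemma rtr_ptrace2_outer X Y (v : vec R (X * Y)%type) : rtr (ptrace2 (outer v) : rop X X) = vn v.
Proof. by rewrite ptrace2_outer -fn_rtr fn_vmx. Qed.
Lemma vn_scale T a (v : vec R T) : vn (vscale a v) = a ^+ 2 * vn v.
Proof. by rewrite /vn mulr_sumr; apply: eq_bigr => i _; rewrite sqnM sqn_toC. Qed.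
Lemma vn_nrm T (v : vec R T) : vn v != 0 -> vn (nrm v) = 1.
Proof. by move=> h; rewrite vn_scale exprVn sqr_sqrtr ?vn_ge0 // mulVf. Qed.
Lemma outer_scale T a (v : vec R T) : outer (vscale a v) = toC (a ^+ 2) *: (outer v : rop T T).
Proof.
apply: ropP => i j; rewrite ropE /outer /vscale conjM_toC expr2 rmorphM /=; ring.
Qed.

(** The number of nonzero eigenvalues is the trace of a projection on the space of Y, each of whose
    diagonal entries is at most 1. It allows the smaller of the two dimensions inside the
    logarithm. *)
Lemma count_rank X Y (M : rop X Y) U l : spec_decomp (M ** M^H) U l -> (forall a, 0 <= l a) ->
  (#|[pred a | l a != 0%R]| <= #|Y|)%N.
Proof.
move=> h l0; have [uU _] := h; have uU' : U^H ** U = id1 by exact: uU.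
pose k a : R := if l a == 0 then 0 else (Num.sqrt (l a))^-1.
(* The nonzero columns of G are the normalised right singular vectors of M, so G G^H is the
   projection in question. *)
pose G : rop Y X := M^H ** U ** diagop k.
pose pp a : R := (l a != 0)%:R.
have GG : G^H ** G = diagop pp.
  rewrite /G !ctM !ctK diag_ct.
  have -> : diagop k ** (U^H ** M) ** (M^H ** U ** diagop k) =
    diagop k ** (U^H ** (M ** M^H) ** U) ** diagop k by rewrite !mulA.
  rewrite (mfun_id h) !mulA -(mulA _ U^H) uU' mulI -(mulA _ U^H) uU' mulI !diagM; congr diagop; apply/funext => a.
  rewrite /k /pp; case: eqP => e; first by rewrite e !mulr0.
  have s0 : 0 < Num.sqrt (l a) by rewrite sqrtr_gt0 lt_def l0 andbT; apply/eqP.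
  have es : l a = Num.sqrt (l a) ^+ 2 by rewrite sqr_sqrtr.
  by rewrite [X in _ * X * _]es /=; field; rewrite gt_eqF.
have Gp : G ** diagop pp = G.
  apply: ropP => y a; rewrite mul_diag /G mul_diag -mulrA -rmorphM /= /pp /k.
  by case: eqP; rewrite ?mul0r ?mulr1.
pose Q := G ** G^H.
have QQ : Q ** Q = Q by rewrite /Q mulA -(mulA G) GG Gp.
have QH : Q^H = Q by rewrite /Q ctM ctK.
have rows y : \sum_y' sqn (Q y y') = complex.Re (Q y y).
  by rewrite -{2}QQ -{3}QH /mul Re_sum.
have Qle y : complex.Re (Q y y) <= 1.
  have h1 : complex.Re (Q y y) ^+ 2 <= complex.Re (Q y y).
    have -> : complex.Re (Q y y) ^+ 2 = sqn (Q y y).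
      have -> : Q y y = toC (\sum_a sqn (G y a)).
        by rewrite toC_sum /Q /mul; apply: eq_bigr => a _; rewrite sqnE.
      by rewrite sqn_toC.
    by rewrite -rows (bigD1 y) //= lerDl sumr_ge0 // => i _; apply: sqn_ge0.
  nra.
have : (#|[pred a | l a != 0%R]|%:R : R) <= #|Y|%:R.
  have -> : (#|[pred a | l a != 0%R]|%:R : R) = rtr (G^H ** G).
    rewrite GG /rtr /tr Re_sum -sum1_card natr_sum big_mkcond /=; apply: eq_bigr => a _.
    by rewrite diagopE eqxx mul1r /= /pp inE; case: (l a != 0).
  rewrite rtrC /rtr /tr Re_sum -sum1_card natr_sum; apply: ler_sum => y _.
  exact: Qle.
by rewrite ler_nat.
Qed.

Lemma exists_max T (l : T -> R) (t0 : T) : exists m, forall a, l a <= l m.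
Proof.
have [m _ hm] := @Order.TotalTheory.arg_maxP _ _ T t0 xpredT l isT.
by exists m => a; apply: hm.
Qed.

Lemma fn_rank1 X Y (a : rop X unit) (b : rop unit Y) : fn (a ** b) = fn a * fn b.
Proof.
rewrite /fn sum_unit mulr_suml; apply: eq_bigr => x _; rewrite sum_unit mulr_sumr.
by apply: eq_bigr => y _; rewrite /mul sum_unit sqnM.
Qed.

(** Distance from M to operators of rank one. Cauchy-Schwarz bounds the squared overlap by l m |a|^2
    |b|^2, and the arithmetic-geometric inequality then covers factors a and b of any norm. *)
Lemma overlap X Y (M : rop X Y) (a : rop X unit) (b : rop unit Y) U l m :
  spec_decomp (M ** M^H) U l -> (forall i, l i <= l m) -> 0 <= l m ->
  fn M - l m <= fn (M - a ** b).
Proof.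
move=> h lm l0; have [uU _] := h.
have q1 : fn (a^H ** M) <= l m * fn a.
  have -> : fn (a^H ** M) = qf (M ** M^H) a by rewrite qf_fn -fn_ct ctM ctK.
  have -> : l m * fn a = qf (toC (l m) *: (id1 : rop X X)) a.
    by rewrite qfZ /qf mulI fn_ip.
  apply: qf_le; rewrite [X in _ - X](mfun_id h).
  have -> : toC (l m) *: (id1 : rop X X) - U ** diagop l ** U^H = U ** diagop (fun i => l m - l i) ** U^H.
    have -> : diagop (fun i => l m - l i) = toC (l m) *: (id1 : rop X X) - diagop l.
      apply: ropP => i j; rewrite !ropE !diagopE /idop rmorphB /= mulrBr.
      by rewrite [_ * toC (l m)]mulrC.
    by rewrite mulBr mulBl mulZr mulZl mulI (unitary_r uU).
  by apply: psd_conj; apply: psd_diag => i; rewrite subr_ge0.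
rewrite fnB fn_rank1 ipC.
have -> : ip (a ** b) M = ip b (a^H ** M) by rewrite /ip ctM -mulA.
have := ip_CS b (a^H ** M); set i := ip _ _ => hi.
have a0 := fn_ge0 a; have b0 := fn_ge0 b; have c0 := fn_ge0 (a^H ** M).
have h2 : i ^+ 2 <= fn b * (l m * fn a) by apply: (le_trans hi); apply: ler_wpM2l.
move: h2 a0 b0 l0; move: (fn a) (fn b) (l m) => al be la h2 a0 b0 l0.
have : 2 * i <= al * be + la.
  rewrite leNgt; apply/negP => hlt.
  have p0 : 0 <= al * be + la by rewrite addr_ge0 // mulr_ge0.
  have : (al * be + la) ^+ 2 < (2 * i) ^+ 2 by rewrite ltr_sqr ?nnegrE //; lra.
  have := sqr_ge0 (al * be - la); nra.
lra.
Qed.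

Lemma Sent_bound X Y (v : vec R (X * Y)%type) a b g : vn v = 1 ->
  (1 < minn #|X| #|Y|)%N -> 0 < g -> g < 1 ->
  Sent v <= Cent g * log2 (minn #|X| #|Y|)%:R * (vn (vsub v (prodv a b))) `^ g.
Proof.
move=> v1 hd g0 g1; have [U [l [h l0]]] := psd_spec (psd_ptrace2_outer v).
rewrite /Sent (vN_entropyE h); have l1 : \sum_i l i = 1 by rewrite -(rtr_spec h) rtr_ptrace2_outer.
have [x0 _] : exists x0 : X, true.
  case: (pickP (fun _ : X => true)) => [x _|hx]; first by exists x.
  by move/eqP: l1; rewrite big1 ?(eq_sym 0) ?oner_eq0 // => i; have := hx i.
have [m hm] := exists_max l x0.
have h' : spec_decomp (vmx v ** (vmx v)^H) U l by rewrite -ptrace2_outer.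
have hc : (#|[pred a | l a != 0%R]| <= minn #|X| #|Y|)%N.
  by rewrite leq_min max_card (count_rank h').
apply: (le_trans (sum_xlog_bound m l0 l1 hc hd g0 g1)).
apply: ler_wpM2l.
  rewrite mulr_ge0 // ?(ltW (Cent_ge0 g1)) // /log2; case: ifP => // _.
  rewrite divr_ge0 ?(ltW (@ln2_gt0 R)) // ln_ge0 // ler1n; exact: ltnW.
have lm1 : l m <= 1 by rewrite -l1 (bigD1 m) //= lerDl sumr_ge0.
have hz : 1 - l m <= vn (vsub v (prodv a b)).
  have := @overlap X Y (vmx v) (col a) (fun _ y => b y) U l m h' hm (l0 m).
  suff -> : vmx v - col a ** (fun _ y => b y) = vmx (vsub v (prodv a b)) by rewrite !fn_vmx v1.
  apply: ropP => x y; by rewrite ropB /mul sum_unit.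
by apply: ge0_ler_powR; rewrite ?nnegrE ?vn_ge0 ?subr_ge0 // ltW.
Qed.

Lemma xlogx_le0 (x : R) : 0 <= x -> x <= 1 -> x * log2 x <= 0.
Proof.
move=> x0 x1; rewrite /log2; case: ltP => h; last by rewrite mulr0.
by rewrite mulr_ge0_le0 // mulr_le0_ge0 // ?ln_le0 // invr_ge0 ltW // ln2_gt0.
Qed.
Lemma vN_entropy_ge0 T (A : op R T) : psd A -> rtr (A : rop T T) <= 1 -> 0 <= vN_entropy A.
Proof.
move=> /psd_spec[U [l [h l0]]] h1; rewrite (vN_entropyE h) oppr_ge0.
apply: sumr_le0 => a _; apply: xlogx_le0 => //.
by apply: (le_trans (spec_le_tr h l0 a)).
Qed.
Lemma Sent_ge0 X Y (v : vec R (X * Y)%type) : vn v = 1 -> 0 <= Sent v.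
Proof.
move=> h; apply: vN_entropy_ge0; first exact: psd_ptrace2_outer.
by rewrite rtr_ptrace2_outer h.
Qed.

Definition EFset X Y (rho : op R (X * Y)%type) : set R :=
  [set r : R | exists n (p : 'I_n -> R) (psi : 'I_n -> vec R (X * Y)%type),
        pure_decomp rho p psi /\
        r = \sum_i p i * vN_entropy (ptrace2 (outer (psi i)))]%classic.

Lemma EFset_ge0 X Y (rho : op R (X * Y)%type) r : EFset rho r -> 0 <= r.
Proof.
move=> [n [p [psi [[p0 p1 psi1 _] ->]]]]; apply: sumr_ge0 => i _; apply: mulr_ge0 => //.
by apply: Sent_ge0; apply: (@toC_inj R); rewrite -vnorm2E psi1 rmorph1.
Qed.
Lemma EF_le X Y (rho : op R (X * Y)%type) r : EFset rho r -> EF rho <= r.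
Proof. by move=> h; apply: ge_inf => //; exists 0 => x; apply: EFset_ge0. Qed.

Lemma state_ex T (rho : op R T) : state rho -> exists t : T, true.
Proof.
move=> [_ h]; case: (pickP (fun _ : T => true)) => [x _|hx]; first by exists x.
by move/eqP: h; rewrite /tr big1 ?(eq_sym 0) ?oner_eq0 // => i; have := hx i.
Qed.
Lemma state_rtr T (rho : op R T) : state rho -> rtr (rho : rop T T) = 1.
Proof. by move=> [_ h]; rewrite /rtr h. Qed.

(** Decompositions are handled below as families of unnormalised vectors, the weights being the
    squared norms. A zero vector is replaced by a basis vector of weight 0, because [pure_decomp]
    demands unit vectors. *)
Lemma EFset_vecs X Y (rho : op R (X * Y)%type) (K : finType) (x : K -> vec R (X * Y)%type) :
  state rho -> rho = \sum_k (outer (x k) : rop _ _) ->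
  EFset rho (\sum_k vn (x k) * Sent (nrm (x k))).
Proof.
move=> hs e; have [t0 _] := state_ex hs.
pose dv : vec R (X * Y)%type := fun t => (t == t0)%:R.
have dv1 : vn dv = 1.
  rewrite /vn (bigD1 t0) //= big1 ?addr0 /dv ?eqxx ?sqn1 // => t /negbTE ->.
  exact: sqn0.
pose ps k := if vn (x k) == 0 then dv else nrm (x k).
exists #|K|, (fun i => vn (x (enum_val i))), (fun i => ps (enum_val i)); split; last first.
  rewrite (reindex_onto (@enum_val K K) enum_rank) /=; last by move=> k _; rewrite enum_rankK.
  apply: eq_big => [i|i _]; first by rewrite enum_valK eqxx.
  by rewrite /ps; case: eqP => // ->; rewrite !mul0r.
have reK (V : nmodType) (F : K -> V) : \sum_(i < #|K|) F (enum_val i) = \sum_k F k.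
  rewrite [RHS](reindex_onto (@enum_val K K) enum_rank) /=; last by move=> k _; rewrite enum_rankK.
  by apply: eq_bigl => i; rewrite enum_valK eqxx.
split.
- by move=> i; apply: vn_ge0.
- rewrite (reK _ (fun k => vn (x k))) -(state_rtr hs) e rtr_sum.
  by apply: eq_bigr => k _; rewrite rtr_outer.
- move=> i; rewrite vnorm2E /ps; case: eqP => h; first by rewrite dv1 rmorph1.
  by rewrite vn_nrm ?rmorph1 //; apply/eqP.
rewrite e; apply: ropP => i j; rewrite ropE.
rewrite (reK _ (fun k => toC (vn (x k)) * outer (ps k) i j)); apply: eq_bigr => k _.
rewrite /ps; case: eqP => h.
  rewrite h rmorph0 mul0r; have : col (x k) = 0 by apply: fn_eq0; rewrite fn_col.
  by rewrite outerE => ->; rewrite mul0l.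
rewrite /nrm outer_scale ropE mulrA -rmorphM /= exprVn sqr_sqrtr ?vn_ge0 // mulfV ?mul1r //.
exact/eqP.
Qed.
End Vectors.

(** * From pure states to mixed states *)

Section EFcont.
Variable R : realType.
Local Notation C := R[i].
Local Notation toC := (real_complex R).
Local Notation rop := (rop R).
Local Notation "'id1'" := (@idop R _).
Implicit Types S T W X Y : finType.

Lemma psd_diag_ge0 T (A : op R T) a : psd A -> 0 <= complex.Re (A a a).
Proof.
move=> /psdP[G ->]; rewrite /mul Re_sum; apply: sumr_ge0 => k _.
by rewrite /ct -/(sqn (G a k)) sqn_ge0.
Qed.

(** In the eigenbasis of A - B, a diagonal entry of A^2 - B^2 is the eigenvalue times A_bb + B_bb,
    which is at least the eigenvalue in modulus. Cauchy-Schwarz on the diagonal then gives the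
    square root of the dimension, the only dimension factor of the whole argument outside
    logarithms. *)
Lemma powers_stormer T (A B : op R T) : psd A -> psd B ->
  fn ((A : rop T T) - B) <= Num.sqrt #|T|%:R * nm ((A : rop T T) ** A - (B : rop T T) ** B).
Proof.
move=> pA pB; set D := (A : rop T T) - B; set E := _ ** _ - _.
have hD : Defs.hermitian D by rewrite /Defs.hermitian -[adj _]/(D^H) ctB !psd_herm.
have [V [mu hV]] := spectral hD; have [uV eD] := hV.
have uV' : V^H ** V = id1 by exact: uV.
have VV := unitary_r uV.
pose A1 := V^H ** A ** V; pose B1 := V^H ** B ** V.
have pA1 : psd A1 by apply: psd_conj'.
have pB1 : psd B1 by apply: psd_conj'.
have D1 : A1 - B1 = diagop mu.
  by rewrite -mulBl -mulBr -/D (mfun_id hV) !mulA uV' mul1 -mulA uV' mulI.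
have sand (X Z : rop T T) : (V^H ** X ** V) ** (V^H ** Z ** V) = V^H ** (X ** Z) ** V.
  by rewrite !mulA -(mulA _ V) VV mulI.
have E1 : V^H ** E ** V = A1 ** A1 - B1 ** B1.
  by rewrite /A1 /B1 !sand -mulBl -mulBr.
have dg b : complex.Re ((A1 ** A1 - B1 ** B1) b b) = mu b * complex.Re (A1 b b + B1 b b).
  have -> : A1 ** A1 - B1 ** B1 = toC 2^-1 *: ((A1 - B1) ** (A1 + B1) + (A1 + B1) ** (A1 - B1)).
    have -> : (A1 - B1) ** (A1 + B1) + (A1 + B1) ** (A1 - B1) =
        (A1 ** A1 - B1 ** B1) + (A1 ** A1 - B1 ** B1).
      rewrite !(mulBl, mulBr, mulDl, mulDr).
      by apply: ropP => i j; rewrite !ropE; ring.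
    rewrite scalerDr -scalerDl -rmorphD /=; have -> : 2^-1 + 2^-1 = 1 :> R by field.
    by rewrite rmorph1 scale1r.
  rewrite D1 ropE ReM_real ropD diag_mul mul_diag ropD !ReD [_ * toC (mu b)]mulrC !ReM_real !ReD.
  by field.
have pt b : mu b ^+ 2 <= `|complex.Re ((V^H ** E ** V) b b)|.
  rewrite E1 dg.
  have hm : mu b = complex.Re (A1 b b) - complex.Re (B1 b b).
    by rewrite -ReB -[A1 b b - _]/((A1 - B1) b b) D1 diagopE eqxx mul1r.
  have a0 := psd_diag_ge0 b pA1; have b0 := psd_diag_ge0 b pB1.
  rewrite ReD; move: hm a0 b0; move: (complex.Re _) (complex.Re (B1 b b)) => x y -> x0 y0.
  rewrite normrM [X in _ <= _ * X]ger0_norm ?addr_ge0 //.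
  case: (ger0P (x - y)) => h; nra.
have -> : fn D = \sum_b mu b ^+ 2.
  rewrite fn_rtr -[X in rtr (_ ** X)]/(adj D) hD -{2}(mfun_idE hV) (rtr_mfun_self _ hV).
  by apply: eq_bigr => b _; rewrite expr2.
apply: (le_trans (ler_sum _ (fun b _ => pt b))).
have -> : nm E = nm (V^H ** E ** V).
  by rewrite /nm -(fn_isol (U := V^H) E) ?ctK // (fn_isor (U := V)).
set F := V^H ** E ** V.
have cs := sum_CS (x := fun b => `|complex.Re (F b b)|) (y := fun=> 1) (fun b => normr_ge0 _) (fun=> ler01).
rewrite -ler_sqr ?nnegrE ?mulr_ge0 ?sqrtr_ge0 ?nm_ge0 ?sumr_ge0 //.
rewrite exprMn sqr_sqrtr ?ler0n // nm2 mulrC.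
under eq_bigr do rewrite -[`|_|]mulr1.
apply: (le_trans cs); rewrite expr1n sumr_const; apply: ler_wpM2r; first exact: ler0n.
apply: ler_sum => b _; rewrite (bigD1 b) //=.
apply: (@le_trans _ _ (sqn (F b b))).
  rewrite real_normK ?num_real // /sqn.
  case: (F b b) => u v /=; rewrite -expr2; nra.
by rewrite lerDl sumr_ge0 // => i _; apply: sqn_ge0.
Qed.

Lemma psd_vecs T (A : op R T) : psd A -> exists x : T -> vec R T, A = \sum_k (outer (x k) : rop T T).
Proof.
move=> /psdP[G ->]; exists (fun k t => G t k); apply: ropP => i j.
by rewrite ropE.
Qed.

Lemma tensor_outer X Y (a : vec R X) (b : vec R Y) : tensor (outer a) (outer b) = outer (prodv a b).
Proof.
apply: ropP => p q; rewrite /tensor /outer /prodv rmorphM /= mulrACA; congr (_ * _).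
Qed.

Lemma sep_vecs X Y (s : op R (X * Y)%type) : separable s ->
  exists (K : finType) (a : K -> vec R X) (b : K -> vec R Y), s = \sum_k (outer (prodv (a k) (b k)) : rop _ _).
Proof.
move=> [n [p [al [be [p0 _ hal hbe ->]]]]].
have [x hx] := choice (fun i => psd_vecs (proj1 (hal i))).
have [y hy] := choice (fun i => psd_vecs (proj1 (hbe i))).
exists ('I_n * (X * Y))%type, (fun k => vscale (Num.sqrt (p k.1)) (x k.1 k.2.1)), (fun k => y k.1 k.2.2).
apply: ropP => u v; rewrite ropE sum_pair; apply: eq_bigr => i _.
rewrite sum_pair /tensor (hx i) (hy i) !rop_sum big_distrl big_distrr /=; apply: eq_bigr => j _.
rewrite !big_distrr /=; apply: eq_bigr => k _.
rewrite -{1}(sqr_sqrtr (p0 i)) expr2 rmorphM /= /outer /prodv /vscale !rmorphM /= conj_toC; ring.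
Qed.

(* By Powers-Stormer sqrt rho and sqrt s are close; transporting a product-vector
   decomposition of s through sqrt s yields a decomposition of rho into vectors that
   are on average close to product vectors. *)
Lemma EF_frame X Y (rho s : op R (X * Y)%type) : state rho -> separable s -> psd s ->
  exists (K : finType) (x : K -> vec R (X * Y)%type) (a : K -> vec R X) (b : K -> vec R Y),
    rho = \sum_k (outer (x k) : rop _ _) /\
    \sum_k vn (vsub (x k) (prodv (a k) (b k))) <= Num.sqrt #|{: X * Y}|%:R * nm ((rho : rop _ _) - s).
Proof.
move=> [prho _] hsep ps; have [J [a [b es]]] := sep_vecs hsep.
have [A pA eA] := psd_sqrt prho.
have [V [l [hV l0]]] := psd_spec ps; have [uV _] := hV.
have uV' : V^H ** V = id1 by exact: uV. have VV := unitary_r uV.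
pose T := (X * Y)%type.
pose be i := Num.sqrt (l i).
pose B : rop T T := V ** diagop be ** V^H.
have pB : psd B by apply: psd_conj; apply: psd_diag => i; apply: sqrtr_ge0.
have mm (f g : T -> R) : (V ** diagop f ** V^H) ** (V ** diagop g ** V^H) = V ** diagop (fun i => f i * g i) ** V^H.
  by rewrite !mulA -(mulA _ V^H) uV' mulI -(mulA V (diagop f)) diagM.
have eB : B ** B = s.
  rewrite mm [RHS](mfun_id hV); congr (_ ** diagop _ ** _); apply/funext => i.
  by rewrite -expr2 sqr_sqrtr.
pose bi i : R := if l i == 0 then 0 else (be i)^-1.
pose k0 i : R := (l i == 0)%:R.
pose k1 i : R := (l i != 0)%:R.
have bebi i : be i * bi i = k1 i.
  rewrite /bi /k1; case: eqP => h /=; first by rewrite mulr0.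
  by rewrite mulfV // gt_eqF // sqrtr_gt0 lt_def l0 andbT; apply/eqP.
pose Um : rop T J := fun t j => prodv (a j) (b j) t.
have eU : Um ** Um^H = s by rewrite es; apply: ropP => i j; rewrite ropE.
(* W1 is the pseudo-inverse of sqrt s applied to the product vectors, W2 the projection on the
   kernel of s; side by side they form a coisometry W. So sqrt rho W decomposes rho, while sqrt s W
   consists of the product vectors and zeros. *)
pose W1 : rop T J := (V ** diagop bi ** V^H) ** Um.
pose W2 : rop T T := V ** diagop k0 ** V^H.
have WW : W1 ** W1^H + W2 ** W2^H = id1.
  have h1 : W1 ** W1^H = V ** diagop k1 ** V^H.
    pose Bi := V ** diagop bi ** V^H.
    have BiH : Bi^H = Bi by rewrite !ctM ctK diag_ct mulA.
    have -> : W1 ** W1^H = (Bi ** B) ** (B ** Bi).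
      have -> : (Bi ** B) ** (B ** Bi) = Bi ** (B ** B) ** Bi by rewrite !mulA.
      by rewrite eB -eU /W1 -/Bi ctM BiH !mulA.
    rewrite /B /Bi !mm; congr (_ ** diagop _ ** _); apply/funext => i.
    by rewrite bebi mulrC [bi i * be i]mulrC bebi /k1; case: (l i != 0); rewrite ?mulr1 ?mulr0.
  have h2 : W2 ** W2^H = V ** diagop k0 ** V^H.
    rewrite /W2 !ctM ctK diag_ct (mulA V) mm; congr (_ ** diagop _ ** _); apply/funext => i.
    by rewrite /k0; case: (l i == 0); rewrite ?mulr1 ?mulr0.
  rewrite h1 h2 -mulDl -mulDr -[RHS]VV -{3}(mulI V); congr (_ ** _ ** _); apply: ropP => i j.
  rewrite ropE !diagopE -mulrDr -rmorphD /= /k0 /k1 /idop.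
  by case: (l i == 0); rewrite /= ?addr0 ?add0r rmorph1 mulr1.
have BW2 : B ** W2 = 0.
  rewrite /B /W2 mm; have -> : diagop (fun i => be i * k0 i) = 0 :> rop T T.
    apply: ropP => i j; rewrite diagopE; have -> : be i * k0 i = 0.
      by rewrite /be /k0; case: eqP => [->|_]; rewrite ?mulr0 // sqrtr0 mul0r.
    by rewrite rmorph0 mulr0.
  by rewrite mulop0 mul0l.
have W2U : W2 ** Um = 0.
  apply: fn_eq0; rewrite fn_rtr ctM mulA -(mulA _ Um) eU -eB.
  have -> : W2 ** (B ** B) = 0.
    have W2H : W2^H = W2 by rewrite /W2 !ctM ctK diag_ct mulA.
    by rewrite mulA -(ctK (W2 ** B)) ctM (psd_herm pB) W2H BW2 ct0 mul0l.
  by rewrite mul0l rtr0.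
have BW1 : B ** W1 = Um.
  rewrite /W1 mulA /B mm; have -> : Um = (V ** diagop k1 ** V^H) ** Um + W2 ** Um.
    rewrite -mulDl /W2 -mulDl -mulDr; have -> : (diagop k1 + diagop k0 : rop T T) = id1.
      apply: ropP => i j; rewrite ropE !diagopE -mulrDr -rmorphD /= /k0 /k1 /idop.
      by case: (l i == 0); rewrite /= ?addr0 ?add0r rmorph1 mulr1.
    by rewrite mulI VV mul1.
  rewrite W2U addr0 mulA !mm; congr (_ ** diagop _ ** _ ** _); apply/funext => i.
  by rewrite bebi /k1; case: (l i != 0); rewrite ?mulr1 ?mulr0.
clearbody W1 W2 B.
exists (J + T)%type, (fun k => match k with inl j => fun t => (A ** W1) t j | inr j => fun t => (A ** W2) t j end),
  (fun k => match k with inl j => a j | inr _ => fun=> 0 end), (fun k => match k with inl j => b j | inr _ => fun=> 0 end).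
split.
  have -> : rho = (A ** W1) ** (A ** W1)^H + (A ** W2) ** (A ** W2)^H.
    rewrite (ctM A W1) (ctM A W2) (psd_herm pA) !mulA -(mulA A W1) -(mulA A W2) -mulDl -mulDr WW mulI.
    by rewrite eA.
  by rewrite big_sumType /=; congr (_ + _); apply: ropP => i j; rewrite ropE.
have -> : (rho : rop T T) - s = A ** A - B ** B by rewrite eA eB.
apply: le_trans (powers_stormer pA pB).
rewrite big_sumType /=.
have e1 : \sum_j vn (vsub (fun t => (A ** W1) t j) (prodv (a j) (b j))) = fn ((A - B) ** W1).
  by rewrite mulBl BW1 /fn exchange_big.
have e2 : \sum_(j : T) vn (vsub (fun t => (A ** W2) t j) (prodv (fun=> 0) (fun=> 0))) = fn ((A - B) ** W2).
  rewrite mulBl BW2 subr0 /fn exchange_big; apply: eq_bigr => j _; apply: eq_bigr => t _.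
  by rewrite /vsub /prodv mul0r subr0.
rewrite e1 e2 !fn_rtr -rtrD; have -> : forall M : rop T T, (M ** W1) ** (M ** W1)^H + (M ** W2) ** (M ** W2)^H = M ** M^H.
  by move=> M; rewrite (ctM M W1) (ctM M W2) !mulA -(mulA M W1) -(mulA M W2) -mulDl -mulDr WW mulI.
by [].
Qed.

(** The bound for pure states is averaged over the decomposition of [EF_frame], and concavity of x^g
    moves the average inside the power. *)
Lemma EF_cont X Y (rho s : op R (X * Y)%type) g : state rho -> separable s -> psd s ->
  (1 < minn #|X| #|Y|)%N -> 0 < g -> g < 1 ->
  EF rho <= Cent g * log2 (minn #|X| #|Y|)%:R * (Num.sqrt #|{: X * Y}|%:R * nm ((rho : rop _ _) - s)) `^ g.
Proof.
move=> hrho hs ps hd g0 g1; have [K [x [a [b [e he]]]]] := EF_frame hrho hs ps.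
apply: (le_trans (EF_le (EFset_vecs hrho e))).
set ep := Num.sqrt _ * _ in he *; set cc := Cent g * _.
have cc0 : 0 <= cc.
  rewrite /cc mulr_ge0 // ?(ltW (Cent_ge0 g1)) // /log2; case: ifP => // _.
  by rewrite divr_ge0 ?(ltW (@ln2_gt0 R)) // ln_ge0 // ler1n ltnW.
have sx : \sum_k vn (x k) = 1.
  by rewrite -(state_rtr hrho) e rtr_sum; apply: eq_bigr => k _; rewrite rtr_outer.
pose z k := vn (vsub (x k) (prodv (a k) (b k))).
have z0 k : 0 <= z k by apply: vn_ge0.
have ep0 : 0 <= ep by apply: le_trans he; apply: sumr_ge0 => k _; apply: z0.
have pt k : vn (x k) * Sent (nrm (x k)) <= cc * (vn (x k) * (z k / vn (x k)) `^ g).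
  have [h|h] := eqVneq (vn (x k)) 0; first by rewrite h !mul0r mulr0.
  rewrite mulrCA; apply: ler_wpM2l; first exact: vn_ge0.
  have := @Sent_bound R X Y (nrm (x k)) (vscale (Num.sqrt (vn (x k)))^-1 (a k)) (b k) g (vn_nrm h) hd g0 g1.
  have -> : vsub (nrm (x k)) (prodv (vscale (Num.sqrt (vn (x k)))^-1 (a k)) (b k))
    = vscale (Num.sqrt (vn (x k)))^-1 (vsub (x k) (prodv (a k) (b k))).
    by apply/funext => t; rewrite /vsub /nrm /prodv /vscale mulrBr mulrA.
  by rewrite vn_scale exprVn sqr_sqrtr ?vn_ge0 // [_^-1 * _]mulrC.
apply: (le_trans (ler_sum _ (fun k _ => pt k))); rewrite -mulr_sumr; apply: ler_wpM2l => //.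
have [h|h] := eqVneq ep 0.
  rewrite h powR0 ?gt_eqF // big1 // => k _.
  have zk : z k = 0.
    apply/eqP; rewrite eq_le z0 andbT -h; apply: le_trans he.
    by rewrite (bigD1 k) //= lerDl sumr_ge0 // => i _; apply: z0.
  by rewrite zk mul0r powR0 ?gt_eqF // mulr0.
have ep1 : 0 < ep by rewrite lt_def h.
(* Tangent of x^g taken at the scale [ep] of the mean error: after summation its value is at most g
   + (1 - g) = 1 times ep^g. *)
have pt2 k : vn (x k) * (z k / vn (x k)) `^ g <= (g * (z k / ep) + (1 - g) * vn (x k)) * ep `^ g.
  have [h'|h'] := eqVneq (vn (x k)) 0.
    rewrite h' mul0r mulr0 addr0 mulr_ge0 ?powR_ge0 // mulr_ge0 ?divr_ge0 //; exact: ltW.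
  have v0 : 0 < vn (x k) by rewrite lt_def h' vn_ge0.
  have -> : z k / vn (x k) = (z k / vn (x k) / ep) * ep by rewrite divfK.
  rewrite powRM ?divr_ge0 ?(ltW v0) ?(ltW ep1) // mulrA; apply: ler_wpM2r; first exact: powR_ge0.
  have := powR_tangent g0 g1 (divr_ge0 (divr_ge0 (z0 k) (ltW v0)) (ltW ep1)).
  move=> /(ler_wpM2l (ltW v0)) /le_trans; apply.
  rewrite le_eqVlt; apply/orP; left; apply/eqP; field.
  by rewrite !gt_eqF.
apply: (le_trans (ler_sum _ (fun k _ => pt2 k))).
rewrite -mulr_suml big_split /= -!mulr_sumr sx -mulr_suml mulr1 ler_piMl ?powR_ge0 //.
have : (\sum_k z k) / ep <= 1 by rewrite ler_pdivrMr // mul1r.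
nra.
Qed.
End EFcont.

(** * Entanglement of formation *)

Section EFmain.
Variable R : realType.
Local Notation C := R[i].
Local Notation toC := (real_complex R).
Local Notation rop := (rop R).
Local Notation "'id1'" := (@idop R _).

Lemma jensen_sq (I : finType) (w x : I -> R) : (forall i, 0 <= w i) -> \sum_i w i = 1 ->
  (\sum_i w i * x i) ^+ 2 <= \sum_i w i * x i ^+ 2.
Proof.
move=> w0 w1; set m := \sum_i _; rewrite -subr_ge0.
have -> : \sum_i w i * x i ^+ 2 - m ^+ 2 = \sum_i w i * (x i - m) ^+ 2.
  have -> : \sum_i w i * (x i - m) ^+ 2 = \sum_i (w i * x i ^+ 2 - 2 * m * (w i * x i) + m ^+ 2 * w i).
    by apply: eq_bigr => i _; ring.
  rewrite big_split sumrB -!mulr_sumr w1 -/m /=; ring.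
by apply: sumr_ge0 => i _; rewrite mulr_ge0 // sqr_ge0.
Qed.

Lemma psd_tensor (X Y : finType) (a : op R X) (b : op R Y) : psd a -> psd b -> psd (tensor a b).
Proof.
move=> /psdP[G ->] /psdP[H ->].
have -> : tensor (G ** G^H) (H ** H^H) = (tensor G H : rop _ _) ** (tensor G H : rop _ _)^H.
  apply: ropP => p q; rewrite /tensor /mul sum_pair big_distrl /=; apply: eq_bigr => i _.
  rewrite big_distrr; apply: eq_bigr => j _ /=; rewrite /ct rmorphM /=; ring.
exact: psd_factor.
Qed.
Lemma tr_tensor (X Y : finType) (a : op R X) (b : op R Y) : tr (tensor a b) = tr a * tr b.
Proof.
rewrite /tr sum_pair big_distrl; apply: eq_bigr => i _; rewrite big_distrr.
by apply: eq_bigr.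
Qed.
Lemma sep_state (X Y : finType) (s : op R (X * Y)%type) : separable s -> state s.
Proof.
move=> [n [p [al [be [p0 p1 hal hbe ->]]]]].
have -> : (fun a b => \sum_i toC (p i) * tensor (al i) (be i) a b) = \sum_i toC (p i) *: (tensor (al i) (be i) : rop _ _).
  by apply: ropP => a b; rewrite ropE.
split.
  by apply: psd_sum => i _; apply: psdZ => //; apply: psd_tensor; [case: (hal i)|case: (hbe i)].
have -> : forall F : 'I_n -> rop (X * Y)%type (X * Y)%type, tr (\sum_i F i) = \sum_i tr (F i).
  by move=> F; rewrite /tr; under eq_bigr do rewrite rop_sum; rewrite exchange_big.
rewrite -(rmorph1 toC) -p1 rmorph_sum; apply: eq_bigr => i _.
by rewrite trZ tr_tensor (proj2 (hal i)) (proj2 (hbe i)) !mulr1.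
Qed.

(** The drop of entropy is the mean relative entropy of the members to their average, and Pinsker's
    inequality applies to each term. The factor ln 2 converts to base 2. *)
Lemma holevo (X : finType) (K : finType) (om : K -> op R X) (q : K -> R) (rho : op R X) :
  (forall k, 0 <= q k) -> (forall k, q k != 0 -> psd (om k) /\ rtr (om k : rop _ _) = 1) ->
  psd rho -> rtr (rho : rop X X) = 1 ->
  rho = \sum_k toC (q k) *: (om k : rop X X) ->
  \sum_k q k * vN_entropy (om k) + \sum_k q k * fn ((om k : rop X X) - rho) / (4 * ln 2)
   <= vN_entropy rho.
Proof.
move=> q0 hom prho trho e; have l2 := @ln2_gt0 R.
have e2 : vN_entropy rho = - \sum_k q k * rtr ((om k : rop X X) ** mlog2 rho).
  rewrite /vN_entropy -[complex.Re _]/(rtr ((rho : rop X X) ** mlog2 rho)) {1}e mul_suml rtr_sum.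
  by congr (- _); apply: eq_bigr => k _; rewrite mulZl rtrZ.
rewrite e2 -big_split -sumrN /=; apply: ler_sum => k _.
have [h|h] := eqVneq (q k) 0; first by rewrite h !mul0r oppr0 addr0.
have [pk tk] := hom k h.
have qk : 0 < q k by rewrite lt_def h q0.
have hs : supp_incl (om k) rho.
  apply: (supp_le (M := (q k)^-1)) => //.
  rewrite [X in _ *: X]e (bigD1 k) //= scalerDr scalerA -rmorphM /= mulVf // rmorph1 scale1r addrAC subrr add0r.
  apply: psdZ; first by rewrite invr_ge0.
  apply: psd_sum => j _; have [hj|hj] := eqVneq (q j) 0; first by rewrite hj rmorph0 scale0r; apply: psd0.
  by apply: psdZ => //; case: (hom j hj).
have := pinsker pk prho hs tk trho.
have -> : relent (om k) rho = - vN_entropy (om k) - rtr ((om k : rop X X) ** mlog2 rho).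
  by rewrite /relent /vN_entropy opprK.
set f := fn _; set S := vN_entropy _; set z := rtr _ => hp.
have : q k * (f / (4 * ln 2)) <= q k * (- S - z).
  rewrite ler_pM2l // invfM mulrA ler_pdivrMr //; lra.
rewrite -[q k * f / _]mulrA; lra.
Qed.

Variables (A B E : finType).

(** The separable state is the mixture of the products of the marginals on A and C of the vectors in
    the decomposition. It depends on that decomposition, which is why the bound concerns each value
    r and not the infimum directly. The constants are 4 ln 2 from Pinsker and 72^2 from the
    frame. *)
Lemma EF_main (rho : op R (A * (B * E))%type) r : state rho -> EFset rho r ->
  exists2 s : op R (A * E)%type, separable s &
   EF (red_AB rho) + fn ((red_AC rho : rop _ _) - s) / (4 * ln 2 * 72 ^+ 2) <= r.
Proof.
move=> hrho [n [p [psi [[p0 p1 psi1 erho] ->]]]].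
have psi1' i : vn (psi i) = 1 by apply: (@toC_inj R); rewrite -vnorm2E psi1 rmorph1.
have l2 := @ln2_gt0 R.
pose Kt := (E + {ffun E -> bool} * {ffun E -> bool})%type.
pose v i (k : Kt) : vec R (A * B)%type := fun x => \sum_c (pov R k c)^* * psi i (x.1, (x.2, c)).
pose q i k := vn (v i k).
pose rA i := ptrace2 (outer (psi i)).
pose MC i : rop E (A * B)%type := fun c x => psi i (x.1, (x.2, c)).
pose rC i := MC i ** (MC i)^H.
pose s : rop (A * E)%type (A * E)%type := \sum_i toC (p i) *: tensor (rA i) (rC i).
have povc (F : E -> E -> C) : \sum_k \sum_c \sum_c' (pov R k c)^* * pov R k c' * F c c' = \sum_c F c c.
  rewrite exchange_big; apply: eq_bigr => c _; rewrite exchange_big (bigD1 c) //=.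
  rewrite -mulr_suml [X in X * _](_ : _ = 1); last first.
    by under eq_bigr do rewrite mulrC; rewrite pov_complete eqxx.
  rewrite mul1r big1 ?addr0 // => c' cc'; rewrite -mulr_suml.
  under eq_bigr do rewrite mulrC; rewrite pov_complete (negbTE cc') mul0r //.
have vv i k x y : v i k x * (v i k y)^* =
   \sum_c \sum_c' (pov R k c)^* * pov R k c' * (psi i (x.1, (x.2, c)) * (psi i (y.1, (y.2, c')))^*).
  rewrite /v rmorph_sum big_distrl; apply: eq_bigr => c _; rewrite big_distrr; apply: eq_bigr => c' _ /=.
  by rewrite rmorphM /= conjCK; ring.
have rAE i : rA i = \sum_k (ptrace2 (outer (v i k)) : rop A A).
  apply: ropP => a a'; rewrite ropE /rA /ptrace2 sum_pair [RHS]exchange_big; apply: eq_bigr => b _ /=.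
  rewrite /outer; under [RHS]eq_bigr do rewrite vv.
  by rewrite (povc (fun c c' => psi i (a, (b, c)) * (psi i (a', (b, c')))^*)).
have rAs i : state (rA i).
  split; first exact: psd_ptrace2_outer.
  by rewrite tr_psd ?rtr_ptrace2_outer ?psi1' ?rmorph1 //; apply: psd_ptrace2_outer.
have rCs i : state (rC i).
  split; first exact: psd_factor.
  rewrite -fnE; congr (toC _); rewrite -(psi1' i) /fn /vn sum_pair exchange_big sum_pair.
  by apply: eq_bigr => a _; rewrite [RHS]sum_pair.
have hs : separable s.
  exists n, p, rA, rC; split=> //.
  by apply: ropP => x y; rewrite /s rop_sum.
exists s => //.
have qs i : \sum_k q i k = 1.
  by rewrite -(state_rtr (rAs i)) rAE rtr_sum; apply: eq_bigr => k _; rewrite rtr_ptrace2_outer.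
pose om i k : op R A := ptrace2 (outer (nrm (v i k))).
have omE i k : toC (q i k) *: (om i k : rop A A) = ptrace2 (outer (v i k)).
  have [h|h] := eqVneq (q i k) 0.
    rewrite h rmorph0 scale0r; apply/esym/rtr_psd_eq0; first exact: psd_ptrace2_outer.
    by rewrite rtr_ptrace2_outer.
  apply: ropP => a a'; rewrite ropE /om /ptrace2 mulr_sumr; apply: eq_bigr => b _.
  rewrite /nrm outer_scale ropE mulrA -rmorphM /= exprVn sqr_sqrtr ?vn_ge0 // mulfV ?rmorph1 ?mul1r //.
have hol i : \sum_k q i k * vN_entropy (om i k) + \sum_k q i k * fn ((om i k : rop A A) - rA i) / (4 * ln 2) <= vN_entropy (rA i).
  apply: holevo.
  - by move=> k; apply: vn_ge0.
  - move=> k h; split; first exact: psd_ptrace2_outer.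
    by rewrite rtr_ptrace2_outer vn_nrm.
  - by case: (rAs i).
  - exact: state_rtr.
  by rewrite rAE; apply: eq_bigr => k _; rewrite omE.
have hAB : EF (red_AB rho) <= \sum_i p i * \sum_k q i k * vN_entropy (om i k).
  pose x (j : 'I_n * Kt) := vscale (Num.sqrt (p j.1)) (v j.1 j.2).
  have eAB : red_AB rho = \sum_j (outer (x j) : rop _ _).
    apply: ropP => u w; rewrite ropE sum_pair /red_AB erho exchange_big /=; apply: eq_bigr => i _.
    rewrite -mulr_sumr.
    have -> : \sum_k outer (x (i, k)) u w = toC (p i) * \sum_k v i k u * (v i k w)^*.
      rewrite mulr_sumr; apply: eq_bigr => k _; rewrite /x outer_scale ropE sqr_sqrtr //.
    congr (_ * _); under [RHS]eq_bigr do rewrite vv.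
    by rewrite (povc (fun c c' => psi i (u.1, (u.2, c)) * (psi i (w.1, (w.2, c')))^*)).
  have sAB : state (red_AB rho).
    split; first by rewrite eAB; apply: psd_sum => j _; apply: psd_outer.
    case: hrho => _ <-; rewrite /tr !sum_pair; apply: eq_bigr => a _.
    by rewrite sum_pair.
  apply: (le_trans (EF_le (EFset_vecs sAB eAB))).
  rewrite sum_pair le_eqVlt; apply/orP; left; apply/eqP; apply: eq_bigr => i _.
  rewrite mulr_sumr; apply: eq_bigr => k _; rewrite /x /= vn_scale sqr_sqrtr // -mulrA.
  have [->|pi0] := eqVneq (p i) 0; first by rewrite !mul0r.
  congr (_ * (_ * _)); rewrite /Sent /om; congr (vN_entropy (ptrace2 (outer _))).
  have sp : 0 < Num.sqrt (p i) by rewrite sqrtr_gt0 lt_def pi0 p0.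
  rewrite /nrm vn_scale sqrtrM ?sqr_ge0 // sqrtr_sqr ger0_norm ?(ltW sp) //.
  apply/funext => t; rewrite /vscale mulrA -rmorphM /= invfM mulrAC mulVf ?mul1r // gt_eqF //.
pose X := (red_AC rho : rop (A * E)%type (A * E)%type) - s.
(* The key identity: a frame block of rho_AC - s is the average, with weights p_i q_ik, of the
   change on A caused by the outcome k. These changes are the quantities whose squares [holevo]
   gains. *)
have blkX k : blk X (pov R k) = \sum_i toC (p i * q i k) *: ((om i k : rop A A) - rA i).
  apply: ropP => a a'; rewrite ropE /blk.
  have -> : \sum_c \sum_c' (pov R k c)^* * X (a, c) (a', c') * pov R k c' =
    \sum_i toC (p i) * \sum_c \sum_c' (pov R k c)^* * pov R k c' *
      (\sum_b psi i (a, (b, c)) * (psi i (a', (b, c')))^* - rA i a a' * rC i c c').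
    under [RHS]eq_bigr do rewrite mulr_sumr.
    rewrite [RHS]exchange_big; apply: eq_bigr => c _.
    under [RHS]eq_bigr do rewrite mulr_sumr.
    rewrite [RHS]exchange_big; apply: eq_bigr => c' _ /=.
    rewrite /X ropB /red_AC erho exchange_big /s rop_sum -sumrB mulr_sumr mulr_suml; apply: eq_bigr => i _ /=.
    rewrite ropE -mulr_sumr /tensor /outer /=; ring.
  apply: eq_bigr => i _; rewrite ropE rmorphM /= -mulrA; congr (_ * _).
  rewrite ropB mulrBr -[toC _ * om i k a a']/((toC (q i k) *: (om i k : rop A A)) a a') omE.
  under eq_bigr do under eq_bigr do rewrite mulrBr.
  under eq_bigr do rewrite sumrB.
  rewrite sumrB; congr (_ - _).
    rewrite /ptrace2 /outer; under [RHS]eq_bigr do rewrite vv /=.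
    rewrite [RHS]exchange_big; apply: eq_bigr => c _; rewrite [RHS]exchange_big; apply: eq_bigr => c' _.
    by rewrite mulr_sumr.
  have -> : toC (q i k) = \sum_c \sum_c' (pov R k c)^* * pov R k c' * rC i c c'.
    rewrite /q /vn toC_sum; under eq_bigr do rewrite sqnE vv.
    rewrite exchange_big; apply: eq_bigr => c _; rewrite exchange_big; apply: eq_bigr => c' _.
    by rewrite -mulr_sumr; congr (_ * _).
  rewrite mulr_suml; apply: eq_bigr => c _; rewrite mulr_suml; apply: eq_bigr => c' _; ring.
have hX : X^H = X.
  rewrite ctB; congr (_ - _); last by apply: psd_herm; case: (sep_state hs).
  have [[hh _] _] := hrho; apply: ropP => x y; rewrite /ct /red_AC rmorph_sum; apply: eq_bigr => b _ /=.
  by rewrite -[in RHS]hh.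
have hnm := pov_nm hX.
pose w (j : 'I_n * Kt) := p j.1 * q j.1 j.2.
pose y (j : 'I_n * Kt) := nm ((om j.1 j.2 : rop A A) - rA j.1).
have w0 j : 0 <= w j by rewrite mulr_ge0 // vn_ge0.
have w1 : \sum_j w j = 1.
  rewrite sum_pair -p1; apply: eq_bigr => i _; rewrite /w /= -mulr_sumr qs mulr1 //.
have hj := jensen_sq y w0 w1.
have h72 : nm X <= 72 * \sum_j w j * y j.
  apply: (le_trans hnm); rewrite ler_pM2l // sum_pair exchange_big; apply: ler_sum => k _ /=.
  rewrite blkX; apply: (le_trans (nm_sum _ _ _)); apply: ler_sum => i _.
  by rewrite nmZ // mulr_ge0 // vn_ge0.
have hX2 : fn X <= 72 ^+ 2 * \sum_j w j * y j ^+ 2.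
  rewrite -nm2; apply: (@le_trans _ _ ((72 * \sum_j w j * y j) ^+ 2)).
    by rewrite ler_sqr ?nnegrE ?nm_ge0 // mulr_ge0 // sumr_ge0 // => j _; rewrite mulr_ge0 // nm_ge0.
  by rewrite exprMn ler_pM2l // exprn_gt0.
apply: (@le_trans _ _ (\sum_i p i * (\sum_k q i k * vN_entropy (om i k) + \sum_k q i k * fn ((om i k : rop A A) - rA i) / (4 * ln 2)))); last first.
  by apply: ler_sum => i _; apply: ler_wpM2l.
under [X in _ <= X]eq_bigr do rewrite mulrDr.
rewrite big_split /=; apply: lerD => //.
rewrite -[fn _]/(fn X) ler_pdivrMr ?mulr_gt0 // ?exprn_gt0 //.
apply: (le_trans hX2); rewrite mulrC le_eqVlt; apply/orP; left; apply/eqP.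
have -> : \sum_i p i * \sum_k q i k * fn ((om i k : rop A A) - rA i) / (4 * ln 2)
  = (\sum_j w j * y j ^+ 2) / (4 * ln 2).
  rewrite sum_pair mulr_suml; apply: eq_bigr => i _.
  rewrite -mulr_suml mulrA; congr (_ / _); rewrite mulr_sumr; apply: eq_bigr => k _.
  by rewrite /w /y nm2 mulrA.
by field; rewrite gt_eqF.
Qed.
End EFmain.

(** * Relative entropy of entanglement *)

Section ERbasics.
Variable R : realType.
Local Notation C := R[i].
Local Notation toC := (real_complex R).
Local Notation rop := (rop R).
Local Notation "'id1'" := (@idop R _).
Implicit Types S T W X Y : finType.

Definition kron X' X Y' Y (P : rop X' X) (L : rop Y' Y) : rop (X' * Y')%type (X * Y)%type :=
  fun p q => P p.1 q.1 * L p.2 q.2.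
Lemma kronM X'' X' X Y'' Y' Y (P' : rop X'' X') (P : rop X' X) (L' : rop Y'' Y') (L : rop Y' Y) :
  kron P' L' ** kron P L = kron (P' ** P) (L' ** L).
Proof.
apply: ropP => p q; rewrite /kron /mul sum_pair big_distrl /=; apply: eq_bigr => i _.
rewrite big_distrr; apply: eq_bigr => j _ /=; ring.
Qed.
Lemma kron_ct X' X Y' Y (P : rop X' X) (L : rop Y' Y) : (kron P L)^H = kron P^H L^H.
Proof. by apply: ropP => p q; rewrite /kron /ct rmorphM. Qed.
Lemma kron1 X Y : kron (id1 : rop X X) (id1 : rop Y Y) = id1.
Proof.
apply: ropP => -[a b] [a' b']; rewrite /kron /idop xpair_eqE /=.
by case: eqP; case: eqP; rewrite /= ?mulr0 ?mul0r ?mulr1.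
Qed.
Lemma kron_sumr X' X Y' Y (I : Type) (r : seq I) (P : rop X' X) (L : I -> rop Y' Y) :
  kron P (\sum_(i <- r) L i) = \sum_(i <- r) kron P (L i).
Proof. by apply: ropP => p q; rewrite ropE /kron rop_sum mulr_sumr. Qed.
Lemma rtr_tensor X Y (a : op R X) (b : op R Y) : psd a -> psd b ->
  rtr (tensor a b : rop _ _) = rtr (a : rop X X) * rtr (b : rop Y Y).
Proof.
move=> pa pb; apply: (@toC_inj R); rewrite rmorphM /= -!tr_psd //; last exact: psd_tensor.
exact: tr_tensor.
Qed.

(** The cone over the separable states. Without normalisation and with any finite index type,
    closure under sums and local maps is immediate; [sepcone_sep] returns to states. *)
Definition sepcone X Y (s : op R (X * Y)%type) :=
  exists (K : finType) (a : K -> op R X) (b : K -> op R Y),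
    [/\ forall k, psd (a k), forall k, psd (b k) & s = \sum_k (tensor (a k) (b k) : rop _ _)].

Lemma sepcone_psd X Y (s : op R (X * Y)%type) : sepcone s -> psd s.
Proof. by move=> [K [a [b [pa pb ->]]]]; apply: psd_sum => k _; apply: psd_tensor. Qed.

Lemma tensorZl X Y c (a : op R X) (b : op R Y) : tensor (c *: (a : rop X X)) b = c *: (tensor a b : rop _ _).
Proof. by apply: ropP => p q; rewrite !ropE /tensor ropE mulrA. Qed.

Lemma sep_sepcone X Y (s : op R (X * Y)%type) : separable s -> sepcone s.
Proof.
move=> [n [p [al [be [p0 _ hal hbe ->]]]]].
exists 'I_n, (fun i => toC (p i) *: (al i : rop X X)), be; split.
- by move=> i; apply: psdZ => //; case: (hal i).
- by move=> i; case: (hbe i).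
by apply: ropP => x y; rewrite ropE; apply: eq_bigr => i _; rewrite tensorZl.
Qed.
Lemma sepconeZ X Y (c : R) (s : op R (X * Y)%type) : 0 <= c -> sepcone s -> sepcone (toC c *: (s : rop _ _)).
Proof.
move=> c0 [K [a [b [pa pb ->]]]]; exists K, (fun k => toC c *: (a k : rop X X)), b; split=> //.
  by move=> k; apply: psdZ.
by rewrite scaler_sumr; apply: eq_bigr => k _; rewrite tensorZl.
Qed.
Lemma sepconeD X Y (s t : op R (X * Y)%type) : sepcone s -> sepcone t -> sepcone ((s : rop _ _) + t).
Proof.
move=> [K [a [b [pa pb ->]]]] [K' [a' [b' [pa' pb' ->]]]].
exists (K + K')%type, (fun k => match k with inl k => a k | inr k => a' k end),
  (fun k => match k with inl k => b k | inr k => b' k end); split; try by case.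
by rewrite big_sumType.
Qed.
Lemma sepcone0 X Y : sepcone (0 : rop (X * Y)%type (X * Y)%type).
Proof.
exists void, (fun=> 0), (fun=> 0); split; try by case.
by rewrite big1 // => -[].
Qed.
Lemma sepcone_sum X Y (I : Type) (r : seq I) (P : pred I) (s : I -> op R (X * Y)%type) :
  (forall i, P i -> sepcone (s i)) -> sepcone (\sum_(i <- r | P i) (s i : rop _ _)).
Proof. by move=> h; elim/big_ind: _ => //; [exact: sepcone0|move=> *; exact: sepconeD]. Qed.
Lemma sepcone_conj X X' Y Y' (P : rop X' X) (L : rop Y' Y) (s : op R (X * Y)%type) :
  sepcone s -> sepcone (kron P L ** s ** (kron P L)^H).
Proof.
move=> [K [a [b [pa pb ->]]]].
exists K, (fun k => P ** a k ** P^H), (fun k => L ** b k ** L^H); split.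
- by move=> k; apply: psd_conj.
- by move=> k; apply: psd_conj.
rewrite mul_sumr mul_suml; apply: eq_bigr => k _.
by rewrite -[tensor (a k) (b k)]/(kron (a k : rop X X) (b k : rop Y Y)) kron_ct !kronM.
Qed.

Lemma unit_state T (t : T) : state (outer (fun i => (i == t)%:R : C)).
Proof.
split; first exact: psd_outer.
rewrite /tr (bigD1 t) //= big1 ?addr0 /outer ?eqxx ?rmorph1 ?mulr1 // => i /negbTE ->.
by rewrite mul0r.
Qed.
Lemma sepcone_sep X Y (s : op R (X * Y)%type) : sepcone s -> rtr (s : rop _ _) = 1 -> separable s.
Proof.
move=> hs; have ps := sepcone_psd hs; move: hs => [K [a [b [pa pb es]]]] ts.
have [[x0 y0] _] : exists x : X * Y, true by apply: (@state_ex R _ s); split=> //; rewrite tr_psd // ts rmorph1.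
pose p k := rtr (a k : rop X X) * rtr (b k : rop Y Y).
(* Normalisation of a factor. A factor of trace 0 is zero and carries weight 0, so an arbitrary
   basis state may stand for it. *)
pose nz T (A : op R T) (t : T) : op R T :=
  if rtr (A : rop T T) == 0 then outer (fun i => (i == t)%:R : C) else toC (rtr (A : rop T T))^-1 *: (A : rop T T).
have nzs T (A : op R T) t : psd A -> state (nz T A t).
  move=> pA; rewrite /nz; case: eqP => h; first exact: unit_state.
  split; first by apply: psdZ => //; rewrite invr_ge0 rtr_ge0.
  by rewrite trZ tr_psd // -rmorphM /= mulVf ?rmorph1 //; apply/eqP.
have nzE T (A : op R T) t : psd A -> toC (rtr (A : rop T T)) *: (nz T A t : rop T T) = A.
  move=> pA; rewrite /nz; case: eqP => h; last first.
    by rewrite scalerA -rmorphM /= mulfV ?rmorph1 ?scale1r //; apply/eqP.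
  by rewrite h rmorph0 scale0r (rtr_psd_eq0 pA h).
exists #|K|, (fun i => p (enum_val i)), (fun i => nz X (a (enum_val i)) x0), (fun i => nz Y (b (enum_val i)) y0).
have reK (V : nmodType) (F : K -> V) : \sum_(i < #|K|) F (enum_val i) = \sum_k F k.
  rewrite [RHS](reindex_onto (@enum_val K K) enum_rank) /=; last by move=> k _; rewrite enum_rankK.
  by apply: eq_bigl => i; rewrite enum_valK eqxx.
split.
- by move=> i; rewrite mulr_ge0 // rtr_ge0.
- rewrite (reK _ p) -ts es rtr_sum; apply: eq_bigr => k _; by rewrite rtr_tensor.
- by move=> i; apply: nzs.
- by move=> i; apply: nzs.
rewrite es; apply: ropP => u v; rewrite ropE.
rewrite (reK _ (fun k => toC (p k) * tensor (nz X (a k) x0) (nz Y (b k) y0) u v)); apply: eq_bigr => k _.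
rewrite -{1}(nzE X (a k) x0) // -{1}(nzE Y (b k) y0) // /tensor !ropE /p rmorphM /=; ring.
Qed.

Definition ERset X Y (rho : op R (X * Y)%type) : set R :=
  [set r : R | exists sigma, separable sigma /\ supp_incl rho sigma /\ r = relent rho sigma]%classic.

Lemma relent_ge0 T (A B : op R T) : state A -> state B -> supp_incl A B -> 0 <= relent A B.
Proof.
move=> hA hB hs; have := klein (proj1 hA) (proj1 hB) hs; rewrite !state_rtr // subrr.
by rewrite pmulr_rge0 // ln2_gt0.
Qed.
Lemma ERset_ge0 X Y (rho : op R (X * Y)%type) r : state rho -> ERset rho r -> 0 <= r.
Proof. by move=> h [s [hs [hsup ->]]]; apply: relent_ge0 => //; apply: sep_state. Qed.
Lemma ER_le X Y (rho : op R (X * Y)%type) r : state rho -> ERset rho r -> ER rho <= r.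
Proof. by move=> hr h; apply: ge_inf => //; exists 0 => x; apply: ERset_ge0. Qed.

Lemma id_spec T (c : R) : spec_decomp (toC c *: (id1 : rop T T)) id1 (fun=> c).
Proof.
split; first by rewrite /unitary -[opmul _ _]/((id1 : rop T T)^H ** id1) ct1 mul1.
rewrite -[opmul _ _]/(id1 ** diagop (fun=> c) ** (id1 : rop T T)^H) ct1 mul1 mulI.
by apply: ropP => i j; rewrite ropE diagopE mulrC.
Qed.

(** The maximally mixed state is separable and of full support. It makes the infimum defining [ER]
    one over a nonempty set and bounds it by the logarithm of the dimension. *)
Lemma ERset_mixed X Y (rho : op R (X * Y)%type) : state rho ->
  exists2 r, ERset rho r & r <= log2 #|{: X * Y}|%:R.
Proof.
move=> hr; have [t0 _] := state_ex hr.
have D0 : 0 < #|{: X * Y}|%:R :> R by rewrite ltr0n; apply/card_gt0P; exists t0.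
set D := #|_|%:R in D0 *.
pose s : rop (X * Y)%type (X * Y)%type := toC D^-1 *: id1.
have ts : rtr s = 1.
  rewrite /s rtrZ; have -> : rtr (id1 : rop (X * Y)%type (X * Y)%type) = D.
    rewrite /rtr /tr Re_sum (eq_bigr (fun=> 1)); last by move=> i _; rewrite /idop eqxx.
    by rewrite sumr_const.
  by rewrite mulVf // gt_eqF.
have hs : separable s.
  apply: sepcone_sep ts; apply: sepconeZ; first by rewrite invr_ge0 ltW.
  exists unit, (fun=> id1), (fun=> id1); split; try by move=> _; apply: psd1.
  by rewrite sum_unit -kron1.
have hsup : supp_incl rho s.
  apply/suppP => S Z; rewrite /s mulZl mul1 => h.
  suff -> : Z = 0 by rewrite mulop0.
  rewrite -[Z]scale1r -(rmorph1 toC) -(@mulfV _ D) ?gt_eqF // rmorphM /= -scalerA h.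
  exact: scaler0.
exists (relent rho s); first by exists s.
have [U [l [hl l0]]] := psd_spec (proj1 hr).
rewrite (relentE hl (id_spec _ D^-1)).
have l1 : \sum_a l a = 1 by rewrite -(rtr_spec hl) state_rtr.
rewrite -[log2 D]mul1r -l1 mulr_suml; apply: ler_sum => a _.
have -> : \sum_b ovl U id1 a b * (l a * (log2 (l a) - log2 D^-1)) = l a * (log2 (l a) - log2 D^-1).
  rewrite -mulr_suml (ovl_row a (proj1 hl)) ?mul1r //.
  by case: (id_spec (X * Y)%type D^-1).
have -> : log2 D^-1 = - log2 D.
  by rewrite /log2 invr_gt0 D0 lnV ?posrE // mulNr.
rewrite opprK mulrDr; have := xlogx_le0 (l0 a); rewrite -(state_rtr hr) => /(_ (spec_le_tr hl l0 a)).
lra.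
Qed.
Lemma ER_nonempty X Y (rho : op R (X * Y)%type) : state rho -> (ERset rho !=set0)%classic.
Proof. by move=> /ERset_mixed[r hr _]; exists r. Qed.
Lemma ER_ge0 X Y (rho : op R (X * Y)%type) : state rho -> 0 <= ER rho.
Proof.
by move=> h; apply: lb_le_inf; [exact: ER_nonempty|move=> r; apply: ERset_ge0].
Qed.
Lemma ER_le_log X Y (rho : op R (X * Y)%type) : state rho -> ER rho <= log2 #|{: X * Y}|%:R.
Proof. by move=> h; have [r hr] := ERset_mixed h; apply: le_trans; apply: ER_le. Qed.
Lemma ER_approx X Y (rho : op R (X * Y)%type) e : state rho -> 0 < e ->
  exists2 r, ERset rho r & r < ER rho + e.
Proof.
move=> h e0; apply: inf_adherent => //; split; first exact: ER_nonempty.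
by exists 0 => x; apply: ERset_ge0.
Qed.

Lemma xlog2x_ge (x : R) : 0 <= x -> x - 1 <= ln 2 * (x * log2 x).
Proof.
rewrite le_eqVlt => /orP[/eqP <-|x0]; first by rewrite mul0r mulr0; lra.
have -> : ln 2 * (x * log2 x) = x * ln x by rewrite /log2 x0; field; rewrite gt_eqF // ln2_gt0.
have := ler_wpM2l (ltW x0) (ln_ge_sub1 x0); rewrite mulrBr mulfV ?gt_eqF //; lra.
Qed.

Lemma relent_self T (A : op R T) : psd A -> relent A A = 0.
Proof. by move=> pA; rewrite /relent subrr. Qed.
Lemma supp_refl T (A : op R T) : supp_incl A A. Proof. by []. Qed.
Lemma supp_trans T (A B D : op R T) : supp_incl A B -> supp_incl B D -> supp_incl A D.
Proof. by move=> h1 h2 v /h2 /h1. Qed.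
Lemma supp_sub T (A B : op R T) : psd A -> psd ((B : rop T T) - A) -> supp_incl A B.
Proof. by move=> pA h; apply: (supp_le (M := 1)) => //; rewrite rmorph1 scale1r. Qed.

(** Joint convexity of relative entropy, applied to nearly optimal separable states of the
    components. *)
Lemma ER_convex X Y (I : finType) (t : I -> R) (om : I -> op R (X * Y)%type) (w : op R (X * Y)%type) (L : I -> R) :
  (forall i, 0 <= t i) -> state w -> w = \sum_i toC (t i) *: (om i : rop _ _) ->
  (forall i, t i != 0 -> state (om i) /\ ER (om i) <= L i) ->
  ER w <= \sum_i t i * L i.
Proof.
move=> t0 hw ew tensn_complete; apply/ler_addgt0Pr => e e0.
have h i : exists s, separable s /\ (t i != 0 -> supp_incl (om i) s /\ relent (om i) s <= L i + e).
  have [h|h] := eqVneq (t i) 0.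
    by have [r [s [hs _]] _] := ERset_mixed hw; exists s; split=> //; rewrite eqxx.
  have [ho hl] := tensn_complete i h; have [r [s [hs [hsup ->]]] hlt] := ER_approx ho e0.
  by exists s; split=> // _; split=> //; apply: (le_trans (ltW hlt)); rewrite lerD2r.
have [s hs] := choice h.
have tr1 : \sum_i t i = 1.
  rewrite -(state_rtr hw) ew rtr_sum; apply: eq_bigr => i _; rewrite rtrZ.
  have [->|hi] := eqVneq (t i) 0; first by rewrite mul0r.
  by rewrite state_rtr ?mulr1 //; case: (tensn_complete i hi).
pose A i : rop (X * Y)%type (X * Y)%type := toC (t i) *: (om i : rop _ _).
pose B i : rop (X * Y)%type (X * Y)%type := toC (t i) *: (s i : rop _ _).
have pA i : psd (A i).
  rewrite /A; have [->|hi] := eqVneq (t i) 0; first by rewrite rmorph0 scale0r; apply: psd0.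
  by apply: psdZ => //; case: (tensn_complete i hi) => [[]].
have pB i : psd (B i) by apply: psdZ => //; case: (sep_state (proj1 (hs i))).
have sAB i : supp_incl (A i) (B i).
  rewrite /A /B; have [->|hi] := eqVneq (t i) 0; first by rewrite !rmorph0 !scale0r.
  have [_ /(_ hi)[h1 _]] := hs i; apply/suppP => S Z.
  rewrite !mulZl => /eqP; rewrite scaler_eq0 -(rmorph0 toC) (inj_eq (@toC_inj R)) (negbTE hi) /=.
  by move=> /eqP /((suppP _ _).1 h1) ->; rewrite scaler0.
have := relent_convex pA pB sAB; rewrite -ew => hconv.
have hB : separable (\sum_i B i).
  apply: sepcone_sep; first by apply: sepcone_sum => i _; apply: sepconeZ => //; apply: sep_sepcone; case: (hs i).
  rewrite rtr_sum -tr1; apply: eq_bigr => i _; rewrite rtrZ state_rtr ?mulr1 //.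
  by apply: sep_state; case: (hs i).
apply: (le_trans (ER_le hw (r := relent w (\sum_i B i)) _)).
  by exists (\sum_i B i); split=> //; split=> //; rewrite {1}ew; apply: supp_sum.
apply: (le_trans hconv).
rewrite -[e]mul1r -tr1 mulr_suml -big_split /=; apply: ler_sum => i _.
rewrite /A /B; have [hi|hi] := eqVneq (t i) 0.
  rewrite hi rmorph0 !scale0r relent_self ?mul0r ?addr0 //; exact: psd0.
have ti : 0 < t i by rewrite lt_def hi t0.
have [_ /(_ hi)[h1 h2]] := hs i.
rewrite relentZ //; last 2 first.
- by case: (tensn_complete i hi) => [[]].
- by case: (sep_state (proj1 (hs i))).
by rewrite subrr mulr0 mul0r addr0 -mulrDr ler_pM2l.
Qed.

(** A converse to convexity up to a constant. Exactly, D(w|s) = t D(rho|s) + D(Z|s) - t D(rho|w) -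
    D(Z|w); Klein's inequality, monotonicity in the second argument and - t log t <= 1 / ln 2 bound
    the corrections independently of the dimension. *)
Lemma ER_near_concave X Y (t : R) (rho Z w : op R (X * Y)%type) :
  0 < t -> t <= 1 -> state rho -> psd Z -> state w -> w = toC t *: (rho : rop _ _) + Z ->
  t * ER rho <= ER w + 2 / ln 2.
Proof.
move=> t0 t1 hr pZ hw ew; have l2 := @ln2_gt0 R.
rewrite -lerBlDr; apply: lb_le_inf; first exact: ER_nonempty.
move=> r [s [hs [hsup ->]]].
have ss := sep_state hs.
have ptr : psd (toC t *: (rho : rop _ _)) by apply: psdZ; [exact: ltW|case: hr].
have prho := proj1 hr.
have h1 : supp_incl rho w.
  apply: (supp_le (M := t^-1)) => //; rewrite ew scalerDr scalerA -rmorphM /= mulVf ?gt_eqF //.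
  by rewrite rmorph1 scale1r addrAC subrr add0r; apply: psdZ => //; rewrite invr_ge0 ltW.
have h2 : supp_incl Z w by apply: supp_sub => //; rewrite ew addrK.
have id : relent w s = t * relent rho s + relent Z s - t * relent rho w - relent Z w.
  rewrite /relent -![complex.Re (tr (opmul rho _))]/(rtr ((rho : rop _ _) ** _)).
  rewrite -![complex.Re (tr (opmul Z _))]/(rtr ((Z : rop _ _) ** _)).
  rewrite -![complex.Re (tr (opmul w _))]/(rtr ((w : rop _ _) ** _)).
  have e M : rtr ((w : rop _ _) ** M) = t * rtr ((rho : rop _ _) ** M) + rtr ((Z : rop _ _) ** M).
    by rewrite ew mulDl mulZl rtrD rtrZ.
  rewrite !e; ring.
have ez : rtr (Z : rop _ _) = 1 - t.
  have := state_rtr hw; rewrite ew rtrD rtrZ (state_rtr hr); lra.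
have a1 : - (ln 2)^-1 <= relent Z s.
  have := klein pZ (proj1 ss) (supp_trans h2 hsup); rewrite ez (state_rtr ss) => h.
  have : -1 <= ln 2 * relent Z s by lra.
  by rewrite -ler_pdivrMl // mulrN1.
have a2 : relent rho w <= - log2 t.
  have h3 : supp_incl rho (toC t *: (rho : rop _ _)).
    apply: (supp_le (M := t^-1)) => //; rewrite scalerA -rmorphM /= mulVf ?gt_eqF // rmorph1 scale1r subrr.
    exact: psd0.
  have hp : psd ((w : rop _ _) - toC t *: (rho : rop _ _)) by rewrite ew addrAC subrr add0r.
  have [_ h4] := relent_mono prho ptr hp h3.
  apply: (le_trans h4); rewrite -{1}[rho](scale1r (rho : rop _ _)) -(rmorph1 toC).
  rewrite relentZ // ?relent_self // log2_1 (state_rtr hr); lra.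
have a3 : relent Z w <= 0.
  have hp : psd ((w : rop _ _) - Z) by rewrite ew addrK.
  by have [_] := relent_mono pZ pZ hp (@supp_refl _ Z); rewrite relent_self.
have a4 : ER rho <= relent rho s.
  by apply: ER_le => //; exists s; split=> //; split=> //; apply: supp_trans hsup.
have a5 : - (ln 2)^-1 <= t * log2 t.
  have := xlog2x_ge (ltW t0) => h; have : -1 <= ln 2 * (t * log2 t) by lra.
  by rewrite -ler_pdivrMl // mulrN1.
rewrite id.
have b2 : t * relent rho w <= t * - log2 t by rewrite ler_pM2l.
have b4 : t * ER rho <= t * relent rho s by rewrite ler_pM2l.
lra.
Qed.
End ERbasics.

(** * E_R is at most E_F; relabelling of bases *)

Section EREF.
Variable R : realType.
Local Notation C := R[i].
Local Notation toC := (real_complex R).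
Local Notation rop := (rop R).
Local Notation "'id1'" := (@idop R _).
Implicit Types S T W X Y : finType.

(** Functional calculus on a rectangular family of eigenvectors, for use where no full
    diagonalisation is at hand. *)
Lemma mfun_eigen S T f (A : op R T) (G : rop T S) (l : S -> R) : Defs.hermitian A ->
  (A : rop T T) ** G = G ** diagop l -> (Defs.mfun f A : rop T T) ** G = G ** diagop (f \o l).
Proof.
move=> hA; have [V [s hV]] := spectral hA; have [uV _] := hV.
have uV' : V^H ** V = id1 by exact: uV.
have VV := unitary_r uV.
rewrite (mfunE f hV) {1}(mfun_id hV) => h.
have h1 : (diagop s : rop T T) ** (V^H ** G) = (V^H ** G) ** diagop l.
  by rewrite -mulA -h !mulA uV' mul1.
have h2 : (diagop (f \o s) : rop T T) ** (V^H ** G) = (V^H ** G) ** diagop (f \o l).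
  apply: ropP => i j; move/(congr1 (fun x : rop T S => x i j)): h1.
  rewrite !diag_mul !mul_diag /=; have [->|nz] := eqVneq ((V^H ** G) i j) 0.
    by rewrite !mulr0 !mul0r.
  by rewrite mulrC => /(mulfI nz)/toC_inj ->; rewrite mulrC.
by rewrite -!mulA h2 !mulA VV mul1.
Qed.

(** The separable state is psi dephased in its Schmidt basis. The columns of G are the unnormalised
    Schmidt vectors: orthogonal, of squared norms l a, with sum psi. They are eigenvectors of s, so
    log s can be evaluated on psi. *)
Lemma ER_pure X Y (psi : vec R (X * Y)%type) : vn psi = 1 -> ER (outer psi) <= Sent psi.
Proof.
move=> p1; have spsi : state (outer psi).
  by split; [exact: psd_outer|rewrite tr_psd ?rtr_outer ?p1 ?rmorph1 //; exact: psd_outer].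
have [U [l [hl l0]]] := psd_spec (psd_ptrace2_outer psi); have [uU _] := hl.
have uU' : U^H ** U = id1 by exact: uU. have UU := unitary_r uU.
pose M := vmx psi.
have eM : M ** M^H = U ** diagop l ** U^H by rewrite -ptrace2_outer -(mfun_id hl).
pose be := U^H ** M.
pose G : rop (X * Y)%type X := fun p a => U p.1 a * be a p.2.
have GG : G^H ** G = diagop l.
  have bb : be ** be^H = diagop l.
    rewrite /be ctM ctK mulA -(mulA _ M) eM -!mulA.
    by rewrite uU' mulI mulA uU' mul1.
  apply: ropP => a b; rewrite /mul sum_pair /ct /G.
  have -> : \sum_x \sum_y (U x a * be a y)^* * (U x b * be b y) =
    (U^H ** U) a b * (be ** be^H) b a.
    rewrite /mul big_distrl; apply: eq_bigr => x _; rewrite big_distrr; apply: eq_bigr => y _ /=.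
    by rewrite /ct rmorphM /=; ring.
  rewrite uU' bb !diagopE /idop eq_sym; case: eqP => [->|]; rewrite ?mul0r ?mulr0 ?mul1r //.
pose s : rop (X * Y)%type (X * Y)%type := G ** G^H.
pose o : rop X unit := fun _ _ => 1.
have eo : col psi = G ** o.
  apply: ropP => -[x y] []; rewrite /mul /o /G /=.
  under eq_bigr do rewrite mulr1.
  have -> : \sum_a U x a * be a y = (U ** be) x y by [].
  by rewrite /be mulA UU mul1.
have ps : psd s := psd_factor G.
have ts : rtr s = 1.
  by rewrite /s rtrC GG -p1 -rtr_ptrace2_outer (rtr_spec hl) /rtr /tr Re_sum; apply: eq_bigr => a _; rewrite diagopE eqxx mul1r.
have hsep : separable s.
  apply: sepcone_sep ts; exists X, (fun a => outer (fun x => U x a)), (fun a => outer (fun y => be a y)).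
  split; try by move=> a; apply: psd_outer.
  by apply: ropP => p q; rewrite ropE; apply: eq_bigr => a _; rewrite tensor_outer.
apply: ER_le => //; exists s; split=> //; split.
  apply/suppP => S Z /qf0; rewrite /s qf_fn => /fn_eq0 h.
  by rewrite outerE eo ctM -!mulA h !mulop0.
rewrite /relent -[complex.Re (tr (opmul (outer psi) (mlog2 (outer psi))))]/(rtr ((outer psi : rop _ _) ** mlog2 (outer psi))).
rewrite -[complex.Re _]/(rtr ((outer psi : rop _ _) ** mlog2 s)).
have e0 : rtr ((outer psi : rop _ _) ** mlog2 (outer psi)) = 0.
  have h : (outer psi : rop _ _) ** col psi = col psi ** diagop (fun=> 1).
    rewrite outerE -mulA; apply: ropP => p []; rewrite mul_diag {1}/mul sum_unit rmorph1.
    congr (_ * _); have := fnE (col psi)^H; rewrite ctK fn_ct fn_col p1 rmorph1 /tr sum_unit => <- //.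
  rewrite rtrC {2}outerE mulA (mfun_eigen (@log2 R) _ h); last by case: (psd_outer psi).
  have -> : diagop (@log2 R \o (fun=> 1)) = 0 :> rop unit unit.
    by apply: ropP => i j; rewrite diagopE /= log2_1 rmorph0 mulr0.
  by rewrite mulop0 mul0l rtr0.
have hG : s ** G = G ** diagop l by rewrite /s -mulA GG.
rewrite e0 sub0r outerE rtrC mulA eo mulA.
have -> : (mlog2 s : rop _ _) ** G = G ** diagop (@log2 R \o l).
  by apply: mfun_eigen => //; case: ps.
rewrite ctM rtrC !mulA -(mulA o^H) GG -(mulA o^H) diagM /Sent (vN_entropyE hl).
congr (- _); rewrite rtrC mulA.
have -> : o ** o^H ** diagop (fun i => l i * log2 (l i)) = (fun _ j => toC (l j * log2 (l j))).
  by apply: ropP => i j; rewrite mul_diag /mul sum_unit /ct /o rmorph1 !mul1r.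
by rewrite /rtr /tr Re_sum.
Qed.

Lemma state_pure T (v : vec R T) : vn v = 1 -> state (outer v).
Proof.
move=> h; split; first exact: psd_outer.
by rewrite tr_psd ?rtr_outer ?h ?rmorph1 //; exact: psd_outer.
Qed.

Lemma ER_le_EFset X Y (rho : op R (X * Y)%type) r : state rho -> EFset rho r -> ER rho <= r.
Proof.
move=> hr [n [p [psi [[p0 p1 psi1 e] ->]]]].
have psi1' i : vn (psi i) = 1 by apply: (@toC_inj R); rewrite -vnorm2E psi1 rmorph1.
apply: (ER_convex (om := fun i => outer (psi i)) (L := fun i => Sent (psi i)) p0 hr).
  by rewrite e; apply: ropP => i j; rewrite ropE.
by move=> i _; split; [exact: state_pure|exact: ER_pure].
Qed.
Lemma EFset_nonempty X Y (rho : op R (X * Y)%type) : state rho -> (EFset rho !=set0)%classic.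
Proof.
move=> hr; have [x hx] := psd_vecs (proj1 hr).
by eexists; apply: (EFset_vecs hr hx).
Qed.
Lemma ER_le_EF X Y (rho : op R (X * Y)%type) : state rho -> ER rho <= EF rho.
Proof.
by move=> hr; apply: lb_le_inf; [exact: EFset_nonempty|move=> r; apply: ER_le_EFset].
Qed.
Lemma EF_ge0 X Y (rho : op R (X * Y)%type) : state rho -> 0 <= EF rho.
Proof. by move=> hr; apply: le_trans (ER_le_EF hr); apply: ER_ge0. Qed.

(** Relabelling of the basis. Splitting the copies and exchanging B and C give index types that
    agree only up to a bijection. *)
Definition reidx T' T (h : T' -> T) (A : op R T) : op R T' := fun i j => A (h i) (h j).

Lemma bijective_id (T : Type) : bijective (fun x : T => x).
Proof. by exists id. Qed.
Lemma sum_bij (V : nmodType) T' T (h : T' -> T) (F : T -> V) : bijective h ->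
  \sum_i F (h i) = \sum_j F j.
Proof. by move=> [k hk kh]; rewrite [RHS](reindex h) //; exists k => i _. Qed.
Lemma reidxM T' T (h : T' -> T) (A B : rop T T) : bijective h ->
  reidx h (A ** B) = (reidx h A : rop _ _) ** (reidx h B : rop _ _).
Proof.
move=> bh; apply: ropP => i j; rewrite /reidx /mul.
by rewrite (sum_bij (fun k => A (h i) k * B k (h j)) bh).
Qed.
Lemma reidx_diag T' T (h : T' -> T) l : injective h -> reidx h (diagop l) = diagop (l \o h).
Proof. by move=> ih; apply: ropP => i j; rewrite /reidx !diagopE (inj_eq ih). Qed.
Lemma reidx_spec T' T (h : T' -> T) (A : op R T) U l : bijective h -> spec_decomp A U l ->
  spec_decomp (reidx h A) (reidx h U) (l \o h).
Proof.
move=> bh hA; have [uU _] := hA; have ih := bij_inj bh; split.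
  rewrite /unitary -[opmul _ _]/((reidx h (U^H) : rop _ _) ** reidx h U) -reidxM //.
  rewrite (_ : U^H ** U = id1) //; apply: ropP => i j; by rewrite /reidx /idop (inj_eq ih).
rewrite {1}(mfun_id hA) !reidxM // reidx_diag //.
Qed.
Lemma tr_reidx T' T (h : T' -> T) (A : op R T) : bijective h -> tr (reidx h A) = tr A.
Proof. by move=> bh; rewrite /tr /reidx (sum_bij (fun i => A i i) bh). Qed.
Lemma mfun_reidx T' T (h : T' -> T) f (A : op R T) : bijective h -> Defs.hermitian A ->
  Defs.mfun f (reidx h A) = reidx h (Defs.mfun f A).
Proof.
move=> bh hA; have [U [l hl]] := spectral hA.
rewrite (mfunE f hl) (mfunE f (reidx_spec bh hl)) !reidxM // reidx_diag //; exact: bij_inj.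
Qed.
Lemma relent_reidx T' T (h : T' -> T) (A B : op R T) : bijective h ->
  Defs.hermitian A -> Defs.hermitian B -> relent (reidx h A) (reidx h B) = relent A B.
Proof.
move=> bh hA hB; rewrite /relent /mlog2 (mfun_reidx _ bh hA) (mfun_reidx _ bh hB).
have e M : opmul (reidx h A) (reidx h M) = reidx h (opmul A M) by exact: esym (reidxM A M bh).
by rewrite !e !(tr_reidx _ bh).
Qed.
Lemma psd_reidx T' T (h : T' -> T) (A : op R T) : psd A -> psd (reidx h A).
Proof.
move=> /psdP[G ->]; have -> : reidx h (G ** G^H) = (fun i k => G (h i) k : C) ** ((fun i k => G (h i) k) : rop T' T)^H by [].
exact: psd_factor.
Qed.
Lemma state_reidx T' T (h : T' -> T) (A : op R T) : bijective h -> state A -> state (reidx h A).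
Proof. by move=> bh [pA tA]; split; [exact: psd_reidx|rewrite tr_reidx]. Qed.
Lemma supp_reidx T' T (h : T' -> T) (A B : op R T) : bijective h -> supp_incl A B ->
  supp_incl (reidx h A) (reidx h B).
Proof.
move=> bh hs v hv; have [k hk kh] := bh.
have e (D : op R T) i : opapply (reidx h D) v i = opapply D (v \o k) (h i).
  rewrite /opapply -(sum_bij (fun j => D (h i) j * (v \o k) j) bh).
  by apply: eq_bigr => j _; rewrite /= hk.
have hB : opapply B (v \o k) = (fun=> 0).
  by apply/funext => i; rewrite -(kh i) -(e B) hv.
by apply/funext => i; rewrite e (hs _ hB).
Qed.
Lemma bij_pair X' X Y' Y (f : X' -> X) (g : Y' -> Y) : bijective f -> bijective g ->
  bijective (fun p : X' * Y' => (f p.1, g p.2)).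
Proof.
move=> [f' h1 h2] [g' h3 h4]; exists (fun p => (f' p.1, g' p.2)) => -[x y] /=.
  by rewrite h1 h3.
by rewrite h2 h4.
Qed.
Lemma sepcone_reidx X' X Y' Y (f : X' -> X) (g : Y' -> Y) (s : op R (X * Y)%type) :
  sepcone s -> sepcone (reidx (fun p : X' * Y' => (f p.1, g p.2)) s).
Proof.
move=> [K [a [b [pa pb ->]]]]; exists K, (fun k => reidx f (a k)), (fun k => reidx g (b k)); split.
- by move=> k; apply: psd_reidx.
- by move=> k; apply: psd_reidx.
by apply: ropP => p q; rewrite /reidx !rop_sum.
Qed.
Lemma ERset_reidx X' X Y' Y (f : X' -> X) (g : Y' -> Y) (rho : op R (X * Y)%type) r :
  bijective f -> bijective g -> state rho -> ERset rho r ->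
  ERset (reidx (fun p : X' * Y' => (f p.1, g p.2)) rho) r.
Proof.
move=> bf bg hr [s [hs [hsup ->]]]; have bh := bij_pair bf bg; have ss := sep_state hs.
exists (reidx (fun p : X' * Y' => (f p.1, g p.2)) s); split.
  apply: sepcone_sep; first by apply: sepcone_reidx; apply: sep_sepcone.
  exact: state_rtr (state_reidx bh ss).
split; first exact: supp_reidx.
by rewrite relent_reidx //; [case: hr => [[]]|case: ss => [[]]].
Qed.
Lemma ER_reidx X' X Y' Y (f : X' -> X) (g : Y' -> Y) (rho : op R (X * Y)%type) :
  bijective f -> bijective g -> state rho ->
  ER (reidx (fun p : X' * Y' => (f p.1, g p.2)) rho) <= ER rho.
Proof.
move=> bf bg hr; apply: lb_le_inf; first exact: ER_nonempty.
move=> r h; apply: ER_le; first exact: state_reidx (bij_pair bf bg) hr.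
exact: ERset_reidx.
Qed.
Lemma EFset_reidx X Y' Y (g : Y' -> Y) (rho : op R (X * Y)%type) r :
  bijective g -> EFset rho r -> EFset (reidx (fun p : X * Y' => (p.1, g p.2)) rho) r.
Proof.
move=> bg [n [p [psi [[p0 p1 psi1 e] ->]]]].
have bh := bij_pair (bijective_id X) bg.
exists n, p, (fun i q => psi i (q.1, g q.2)); split.
  split=> //.
    by move=> i; rewrite -(psi1 i) /vnorm2 -(sum_bij (fun t => (psi i t)^* * psi i t) bh).
  by apply: ropP => a b; rewrite /reidx e.
apply: eq_bigr => i _; congr (_ * vN_entropy _); apply: ropP => x x'.
by rewrite /ptrace2 -(sum_bij (fun y => outer (psi i) (x, y) (x', y)) bg).
Qed.
End EREF.

(** * Measurement on one side followed by a conditional test on the other *)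

Section Instrument.
Variable R : realType.
Local Notation C := R[i].
Local Notation toC := (real_complex R).
Local Notation rop := (rop R).
Local Notation "'id1'" := (@idop R _).

(** In an eigenbasis the last clause is (1 - s)^2 <= 1 - s^2 for 0 <= s <= 1. It bounds the
    disturbance 1 - S by the probability of rejection. *)
Lemma effect_sqrt (T : finType) (A : op R T) : psd A -> psd ((id1 : rop T T) - A) ->
  exists S : op R T, [/\ psd S, (S : rop T T) ** S = A &
    psd ((id1 : rop T T) - A - ((id1 : rop T T) - S) ** ((id1 : rop T T) - S))].
Proof.
move=> pA p1A; have [U [l [hl l0]]] := psd_spec pA; have [uU _] := hl.
have uU' : U^H ** U = id1 by exact: uU. have UU := unitary_r uU.
have mm (f g : T -> R) : (U ** diagop f ** U^H) ** (U ** diagop g ** U^H) = U ** diagop (fun i => f i * g i) ** U^H.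
  by rewrite !mulA -(mulA _ U^H) uU' mulI -(mulA U (diagop f)) diagM.
have dB (f g : T -> R) : U ** diagop f ** U^H - U ** diagop g ** U^H = U ** diagop (fun i => f i - g i) ** U^H.
  rewrite -mulBl -mulBr; congr (_ ** _ ** _); apply: ropP => i j.
  by rewrite ropB !diagopE rmorphB /= mulrBr.
have e1 : (id1 : rop T T) = U ** diagop (fun=> 1) ** U^H.
  have -> : diagop (fun=> 1) = id1 :> rop T T by apply: ropP => i j; rewrite diagopE rmorph1 mulr1.
  by rewrite mulI UU.
have eA := mfun_id hl.
have l1 a : l a <= 1.
  have := psd_diag_ge0 a (psd_conj' U p1A).
  have -> : U^H ** ((id1 : rop T T) - A) ** U = diagop (fun i => 1 - l i).
    rewrite e1 eA dB.
    by rewrite !mulA uU' mul1 -(mulA _ U^H) uU' mulI.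
  by rewrite diagopE eqxx mul1r /= subr_ge0.
exists (U ** diagop (fun a => Num.sqrt (l a)) ** U^H); split.
- by apply: psd_conj; apply: psd_diag => a; apply: sqrtr_ge0.
- rewrite mm [RHS]eA; congr (_ ** diagop _ ** _); apply/funext => a.
  by rewrite -expr2 sqr_sqrtr.
rewrite e1 {1}eA !dB mm dB; apply: psd_conj; apply: psd_diag => a.
have s0 := sqrtr_ge0 (l a); have e2 : l a = Num.sqrt (l a) ^+ 2 by rewrite sqr_sqrtr.
have s1 : Num.sqrt (l a) <= 1 by rewrite -[1]sqrtr1 ler_wsqrtr.
rewrite {1}e2; move: (Num.sqrt (l a)) s0 s1 => s s0 s1; nra.
Qed.

(* With Z = 1 - S:  rho = (S + Z) rho (S + Z), and the cross terms are absorbed by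
   weighting S with d and Z with 1/d. *)
Lemma gentle (T : finType) (S rho : op R T) (d : R) : psd S -> psd rho -> 0 < d ->
  psd (toC (1 + d) *: ((S : rop T T) ** rho ** S) +
       toC (1 + d^-1) *: (((id1 : rop T T) - S) ** rho ** ((id1 : rop T T) - S)) - rho).
Proof.
move=> pS pr d0; set Z : rop T T := (id1 : rop T T) - S.
have ZH : Z^H = Z by rewrite /Z ctB ct1 (psd_herm pS).
set c := Num.sqrt d; have c0 : 0 < c by rewrite sqrtr_gt0.
have ec : d = c ^+ 2 by rewrite sqr_sqrtr // ltW.
pose M : rop T T := toC c *: (S : rop T T) - toC c^-1 *: Z.
have -> : toC (1 + d) *: ((S : rop T T) ** rho ** S) + toC (1 + d^-1) *: (Z ** rho ** Z) - rho = M ** rho ** M^H.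
  have -> : M^H = M by rewrite /M ctB !ctZ !conj_toC ZH (psd_herm pS).
  rewrite [X in _ - X = _](_ : (rho : rop T T) = (S : rop T T) ** rho ** S + (S : rop T T) ** rho ** Z + Z ** rho ** S + Z ** rho ** Z); last first.
    have e : (S : rop T T) + Z = id1 by rewrite /Z addrCA subrr addr0.
    rewrite -{1}(mul1 (rho : rop T T)) -{1}(mulI (id1 ** (rho : rop T T))) -{1 2}e.
    by rewrite !(mulDl, mulDr); apply: ropP => i j; rewrite !ropE; ring.
  clearbody Z.
  rewrite /M; move: (S : rop T T) => S' .
  have e1 : toC (1 + d) = 1 + toC c * toC c by rewrite ec expr2 rmorphD rmorphM rmorph1.
  have e2 : toC (1 + d^-1) = 1 + toC c^-1 * toC c^-1 by rewrite ec -exprVn expr2 rmorphD rmorphM rmorph1.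
  have e3 : toC c * toC c^-1 = 1 by rewrite -rmorphM mulfV ?rmorph1 // gt_eqF.
  rewrite e1 e2; move: e3; set u := toC c; set v := toC c^-1 => e3.
  rewrite !(mulBl, mulBr, mulZl, mulZr).
  set SS := S' ** _ ** S'; set SZ := S' ** _ ** Z; set ZS := Z ** _ ** S'; set ZZ := Z ** _ ** Z.
  apply: ropP => i j; rewrite !ropE.
  set a := SS i j; set b := SZ i j; set f := ZS i j; set g := ZZ i j.
  have h x : u * (v * x) = x by rewrite mulrA e3 mul1r.
  have h' x : v * (u * x) = x by rewrite mulrA [v * u]mulrC e3 mul1r.
  rewrite !mulrBr ?h ?h'.  ring.
exact: psd_conj.
Qed.

Variables (X Y Y' K : finType).
Local Notation XY := (X * Y)%type.
Local Notation XY' := (X * Y')%type.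
Variables (L : K -> rop Y' Y) (T : K -> op R X).
Hypothesis tensn_complete : \sum_k (L k)^H ** L k = id1.
Hypothesis psd_accept : forall k, psd (T k).
Hypothesis psd_reject : forall k, psd ((id1 : rop X X) - T k).

(* [acc s] is the probability that s passes the test T k on X when the instrument L
   on Y has produced outcome k; [measured s] is the state left after forgetting k. *)
Definition acc (s : op R XY) : R := \sum_k rtr ((s : rop XY XY) ** kron (T k : rop X X) ((L k)^H ** L k)).
Definition measured (s : op R XY) : op R XY' :=
  \sum_k kron (id1 : rop X X) (L k) ** s ** (kron (id1 : rop X X) (L k))^H.

Lemma state_measured s : state s -> state (measured s).
Proof.
move=> [ps ts]; have pm : psd (measured s) by apply: conj_sum_psd.
split=> //; rewrite tr_psd // /measured rtr_sum.
under eq_bigr do rewrite -mulA rtrC -mulA.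
have -> : \sum_k rtr ((s : rop XY XY) ** ((kron (id1 : rop X X) (L k))^H ** kron id1 (L k))) = rtr (s : rop XY XY).
  rewrite -rtr_sum -mul_sumr; congr rtr.
  under eq_bigr do rewrite kron_ct kronM ct1 mul1.
  by rewrite -kron_sumr tensn_complete kron1 mulI.
by rewrite -tr_psd.
Qed.

(** The additive losses of [instrument]. Neither the dimensions nor the number of copies enter, so
    they vanish in the regularization. *)
Definition gentle_cst (d : R) : R := (2 + d + d^-1) * (2 / ln 2) + (1 + d) * (2 / ln 2).

(** Separable states pass the test with probability at most q, so conditioning rho on acceptance
    lowers E_R by about - p log q. The accepted state is nearly the measured one, because a test
    that almost surely accepts disturbs little. *)
Lemma instrument (rho : op R XY) (q d : R) : state rho -> 0 < d -> 0 < q ->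
  (forall s, separable s -> acc s <= q) -> 0 < acc rho ->
  ER (measured rho) <= (1 + d) * (ER rho + acc rho * log2 q)
     + (1 + d^-1) * (1 - acc rho) * log2 #|{: X * Y'}|%:R + gentle_cst d.
Proof.
move=> hr d0 q0 hq p0; have l2 := @ln2_gt0 R; have pr := proj1 hr.
have [S hS] := choice (fun k => effect_sqrt (psd_accept k) (psd_reject k)).
have hRex k : exists B : op R X, psd B /\ (B : rop X X) ** B = id1 - T k.
  by have [B pB eB] := psd_sqrt (psd_reject k); exists B.
have [Rj hR] := choice hRex.
pose P (f : bool) k : rop X X := if f then S k else Rj k.
have PH f k : (P f k)^H = P f k.
  by rewrite /P; case: f; apply: psd_herm; [case: (hS k)|case: (hR k)].
have PP f k : P f k ** P f k = if f then (T k : rop X X) else id1 - T k.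
  by rewrite /P; case: f; [case: (hS k)|case: (hR k)].
pose V f k := kron (P f k) (L k).
pose A f (s : op R XY) : rop XY' XY' := \sum_k V f k ** s ** (V f k)^H.
have VV f k : (V f k)^H ** V f k = kron (P f k ** P f k) ((L k)^H ** L k).
  by rewrite /V kron_ct kronM PH.
have hV : \sum_f \sum_k (V f k)^H ** V f k = id1.
  rewrite big_bool /= -big_split /= -kron1 -tensn_complete kron_sumr; apply: eq_bigr => k _.
  rewrite !VV !PP; apply: ropP => u v; rewrite ropD /kron ropB -mulrDl.
  by rewrite addrCA subrr addr0.
have rtrA s : rtr (A true s) = acc s.
  rewrite /A rtr_sum; apply: eq_bigr => k _; rewrite -mulA rtrC -mulA VV PP //.
have rtrAf s : state s -> rtr (A false s) = 1 - acc s.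
  move=> hs; have : rtr (A true s) + rtr (A false s) = 1.
    rewrite -(state_rtr hs) -{3}(mulI (s : rop XY XY)) -hV big_bool /= mulDr rtrD /A !rtr_sum !mul_sumr !rtr_sum.
    by congr (_ + _); apply: eq_bigr => k _; rewrite -mulA rtrC -mulA.
  rewrite rtrA; lra.
have psdA f s : psd s -> psd (A f s) by move=> ps; apply: conj_sum_psd.
set p := acc rho in p0 *.
have p1 : p <= 1 by have := rtr_ge0 (psdA false rho pr); rewrite rtrAf // -/p; lra.
pose rt : op R XY' := toC p^-1 *: A true rho.
have srt : state rt.
  split; first by apply: psdZ; [rewrite invr_ge0 ltW|exact: psdA].
  by rewrite trZ tr_psd ?rtrA -?rmorphM /= ?mulVf ?rmorph1 ?gt_eqF //; exact: psdA.
(* Data processing through the binary outcome. On the accepted branch the traces are p for rho and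
   [acc s] <= q for s, which produces - p log q; the losses 1 / ln 2 come from the rejected branch
   and from p log p. *)
have step1 : p * ER rt + (- p * log2 q) - 2 / ln 2 <= ER rho.
  apply: lb_le_inf; first exact: ER_nonempty.
  move=> r [s [hs [hsup ->]]]; have ss := sep_state hs; have ps := proj1 ss.
  have := dpi hV pr ps hsup; rewrite big_bool /= -!/(A _ _) => hd.
  have sup f : supp_incl (A f rho) (A f s) by apply: conj_sum_supp.
  have a1 : - (ln 2)^-1 <= relent (A false rho) (A false s).
    have := klein (psdA false _ pr) (psdA false _ ps) (sup false); rewrite !rtrAf // -/p => h.
    have h2 := rtr_ge0 (psdA true s ps); rewrite rtrA in h2.
    have : -1 <= ln 2 * relent (A false rho) (A false s) by lra.
    by rewrite -ler_pdivrMl // mulrN1.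
  have q'0 : 0 < acc s.
    rewrite lt_def -rtrA (rtr_ge0 (psdA true s ps)) andbT; apply/eqP => h.
    have hz := rtr_psd_eq0 (psdA true s ps) h.
    have : rtr (A true rho) = 0.
      have -> : A true rho = 0; last exact: rtr0.
      have := (suppP _ _).1 (sup true) _ (id1 : rop XY' XY'); rewrite hz mul0l !mulI; exact.
    by rewrite rtrA -/p => h3; rewrite h3 ltxx in p0.
  pose st : op R XY' := toC (acc s)^-1 *: A true s.
  have sst : state st.
    split; first by apply: psdZ; [rewrite invr_ge0 ltW|exact: psdA].
    by rewrite trZ tr_psd ?rtrA -?rmorphM /= ?mulVf ?rmorph1 ?gt_eqF //; exact: psdA.
  have sepst : separable st.
    apply: sepcone_sep; last exact: state_rtr.
    apply: sepconeZ; first by rewrite invr_ge0 ltW.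
    by apply: sepcone_sum => k _; apply: sepcone_conj; apply: sep_sepcone.
  have e1 : A true rho = toC p *: (rt : rop XY' XY').
    by rewrite /rt scalerA -rmorphM /= mulfV ?rmorph1 ?scale1r // gt_eqF.
  have e2 : A true s = toC (acc s) *: (st : rop XY' XY').
    by rewrite /st scalerA -rmorphM /= mulfV ?rmorph1 ?scale1r // gt_eqF.
  have sups : supp_incl rt st.
    apply/suppP => W Z; rewrite /rt /st !mulZl => /eqP.
    rewrite scaler_eq0 -(rmorph0 toC) (inj_eq (@toC_inj R)) invr_eq0 (gt_eqF q'0) /= => /eqP hz.
    by rewrite ((suppP _ _).1 (sup true) _ _ hz) scaler0.
  have a2 : relent (A true rho) (A true s) = p * relent rt st + p * (log2 p - log2 (acc s)).
    by rewrite e1 e2 relentZ // ?(state_rtr srt) ?mulr1 //; [case: srt|case: sst].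
  have a3 : p * ER rt <= p * relent rt st.
    by rewrite ler_pM2l //; apply: ER_le => //; exists st.
  have a4 : - (ln 2)^-1 <= p * log2 p.
    have := xlog2x_ge (ltW p0) => h; have : -1 <= ln 2 * (p * log2 p) by lra.
    by rewrite -ler_pdivrMl // mulrN1.
  have a5 : p * log2 (acc s) <= p * log2 q.
    rewrite ler_pM2l // /log2 q'0 q0 ler_pM2r ?invr_gt0 // ler_ln ?posrE //; exact: hq.
  move: hd a1 a2 a3 a4 a5; move: (relent (A true rho) _) (relent (A false rho) _) (relent rt st) => x y z.
  lra.
(* The disturbance, with 1 - S in place of S. By [effect_sqrt] its trace is at most the probability
   1 - p of rejection. *)
pose G : rop XY' XY' := \sum_k kron ((id1 : rop X X) - S k) (L k) ** rho ** (kron ((id1 : rop X X) - S k) (L k))^H.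
have pG : psd G by apply: conj_sum_psd.
have trG : rtr G <= 1 - p.
  rewrite -(state_rtr hr) -{1}(mulI (rho : rop XY XY)) -kron1 -tensn_complete kron_sumr mul_sumr rtr_sum /p /acc -sumrB /G rtr_sum.
  apply: ler_sum => k _; rewrite -mulA rtrC -mulA kron_ct kronM.
  rewrite -rtrB -mulBr -subr_ge0 -rtrB -mulBr.
  have [pS eS hs3] := hS k.
  have SH : ((id1 : rop X X) - S k)^H = id1 - S k by rewrite ctB ct1 (psd_herm pS).
  have -> : kron (id1 : rop X X) ((L k)^H ** L k) - kron (T k : rop X X) ((L k)^H ** L k) -
     kron (((id1 : rop X X) - S k)^H ** (id1 - S k)) ((L k)^H ** L k)
    = kron ((id1 : rop X X) - T k - (id1 - S k) ** (id1 - S k)) ((L k)^H ** L k).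
    by apply: ropP => u v; rewrite SH !ropB /kron !ropB; ring.
  apply: (rtr_mul_ge0 pr); apply: (psd_tensor hs3).
  by rewrite -{2}(ctK (L k)); apply: psd_factor.
(* Dominates the measured state, by [gentle] applied to every k. *)
pose Om : rop XY' XY' := toC (1 + d) *: A true rho + toC (1 + d^-1) *: G.
have pOm : psd (Om - measured rho).
  have -> : Om - measured rho = \sum_k
     (toC (1 + d) *: (V true k ** rho ** (V true k)^H) +
      toC (1 + d^-1) *: (kron ((id1 : rop X X) - S k) (L k) ** rho ** (kron ((id1 : rop X X) - S k) (L k))^H)
      - kron (id1 : rop X X) (L k) ** rho ** (kron (id1 : rop X X) (L k))^H).
    by rewrite /Om /A /G /measured !scaler_sumr -big_split -sumrB.
  apply: psd_sum => k _; have [pS _ _] := hS k.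
  pose SS : rop XY' XY' := kron (S k : rop X X) (id1 : rop Y' Y').
  pose rk : op R XY' := kron (id1 : rop X X) (L k) ** rho ** (kron (id1 : rop X X) (L k))^H.
  have prk : psd rk by apply: psd_conj.
  have pSS : psd SS by apply: (psd_tensor pS (psd1 R Y')).
  have := gentle pSS prk d0.
  have SSH : SS^H = SS by exact: psd_herm.
  have e1 : V true k = SS ** kron (id1 : rop X X) (L k) by rewrite /V /SS kronM mulI mul1.
  have e2 : kron ((id1 : rop X X) - S k) (L k) = (id1 - SS) ** kron (id1 : rop X X) (L k).
    by rewrite mulBl mul1 /SS kronM mulI mul1; apply: ropP => u v; rewrite ropB /kron ropB mulrBl.
  have SSH' : ((id1 : rop XY' XY') - SS)^H = id1 - SS by rewrite ctB ct1 SSH.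
  rewrite e1 e2 (ctM SS) (ctM (id1 - SS)) SSH SSH' /rk; clearbody SS.
  by rewrite !mulA.
pose Nn := rtr Om.
have NE : Nn = (1 + d) * p + (1 + d^-1) * rtr G by rewrite /Nn /Om rtrD !rtrZ rtrA.
have di : 0 < d^-1 by rewrite invr_gt0.
have sm := state_measured hr.
have N1 : 1 <= Nn by have := rtr_ge0 pOm; rewrite rtrB (state_rtr sm) -/Nn; lra.
have tG0 := rtr_ge0 pG.
have N2 : Nn <= 2 + d + d^-1.
  have : (1 + d^-1) * rtr G <= (1 + d^-1) * (1 - p) by rewrite ler_pM2l //; lra.
  rewrite NE; nra.
have N0 : 0 < Nn by lra.
pose om : op R XY' := toC Nn^-1 *: Om.
have pOm' : psd Om by apply: psdD; apply: psdZ => //; [lra|exact: psdA|lra].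
have som : state om.
  split; first by apply: psdZ => //; rewrite invr_ge0 ltW.
  by rewrite trZ tr_psd // -rmorphM /= mulVf ?rmorph1 // gt_eqF.
(* The normalised [Om] contains the measured state with weight 1 / Nn, so near-concavity bounds the
   E_R of the latter; convexity then bounds that of [om], with the trivial logarithmic bound on the
   share of G. *)
have step2 : Nn^-1 * ER (measured rho) <= ER om + 2 / ln 2.
  apply: (@ER_near_concave _ _ _ _ _ (toC Nn^-1 *: (Om - measured rho)) om) => //.
  - by rewrite invr_gt0.
  - by rewrite invf_le1.
  - by apply: psdZ => //; rewrite invr_ge0 ltW.
  by rewrite -scalerDr /om; congr (_ *: _); rewrite addrCA subrr addr0.
set Lg := log2 #|_|%:R.
have [t0 _] := state_ex sm.
have Lg0 : 0 <= Lg.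
  rewrite /Lg /log2; case: ifP => // _; rewrite divr_ge0 ?(ltW l2) // ln_ge0 //. rewrite ler1n.
  by apply/card_gt0P; exists t0.
have step3 : ER om <= Nn^-1 * ((1 + d) * p * ER rt + (1 + d^-1) * rtr G * Lg).
  have := @ER_convex R X Y' bool (fun b => Nn^-1 * (if b then (1 + d) * p else (1 + d^-1) * rtr G))
    (fun b => if b then rt else toC (rtr G)^-1 *: G) om (fun b => if b then ER rt else Lg).
  rewrite !big_bool /= => h.
  have -> : Nn^-1 * ((1 + d) * p * ER rt + (1 + d^-1) * rtr G * Lg) =
    Nn^-1 * ((1 + d) * p) * ER rt + Nn^-1 * ((1 + d^-1) * rtr G) * Lg by ring.
  apply: h.
  - by case; rewrite !mulr_ge0 ?invr_ge0 ?(ltW N0) ?(ltW p0) //; lra.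
  - exact: som.
  - rewrite /om /Om scalerDr; congr (_ + _).
      rewrite /rt !scalerA -!rmorphM /=; congr (toC _ *: _); field; by rewrite !gt_eqF.
    have [h0|h0] := eqVneq (rtr G) 0.
      by rewrite (rtr_psd_eq0 pG h0) !scaler0.
    by rewrite !scalerA -!rmorphM /=; congr (toC _ *: _); field; rewrite h0 !gt_eqF.
  case; first by move=> _; split.
  move=> h0; have G0 : rtr G != 0 by apply: contra h0 => /eqP ->; rewrite !mulr0.
  have sG : state (toC (rtr G)^-1 *: G).
    split; first by apply: psdZ => //; rewrite invr_ge0.
    by rewrite trZ tr_psd // -rmorphM /= mulVf ?rmorph1.
  by split=> //; apply: ER_le_log.
have c2 : 0 < 2 / ln 2 :> R by apply: divr_gt0.
have h4 : ER (measured rho) <= (1 + d) * p * ER rt + (1 + d^-1) * rtr G * Lg + Nn * (2 / ln 2).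
  have : Nn * (Nn^-1 * ER (measured rho)) <= Nn * (Nn^-1 * ((1 + d) * p * ER rt + (1 + d^-1) * rtr G * Lg) + 2 / ln 2).
    by rewrite ler_pM2l //; apply: (le_trans step2); rewrite lerD2r.
  by rewrite mulrDr !mulVKf ?gt_eqF.
have h5 : (1 + d^-1) * rtr G * Lg <= (1 + d^-1) * (1 - p) * Lg.
  by apply: ler_wpM2r => //; apply: ler_wpM2l => //; lra.
have h6 : Nn * (2 / ln 2) <= (2 + d + d^-1) * (2 / ln 2) by rewrite ler_pM2r.
have h7 : (1 + d) * (p * ER rt + (- p * log2 q) - 2 / ln 2) <= (1 + d) * ER rho by rewrite ler_pM2l //; lra.
rewrite /gentle_cst; lra.
Qed.
End Instrument.

(** * Tests on many copies *)

Section Tensor.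
Variable R : realType.
Local Notation C := R[i].
Local Notation toC := (real_complex R).
Local Notation rop := (rop R).
Local Notation "'id1'" := (@idop R _).
Implicit Types X Y Z K : finType.

Definition tensn n X' X (P : 'I_n -> rop X' X) : rop {ffun 'I_n -> X'} {ffun 'I_n -> X} :=
  fun f g => \prod_i P i (f i) (g i).
(** Tensor product of bipartite operators with all first parties grouped against all second parties;
    [tpow] is an instance by conversion. *)
Definition tp n X' Y' X Y (P : 'I_n -> rop (X' * Y')%type (X * Y)%type) :
  rop ({ffun 'I_n -> X'} * {ffun 'I_n -> Y'})%type ({ffun 'I_n -> X} * {ffun 'I_n -> Y})%type :=
  fun p q => \prod_i P i (p.1 i, p.2 i) (q.1 i, q.2 i).

Definition fpair n X Y (p : {ffun 'I_n -> X} * {ffun 'I_n -> Y}) : {ffun 'I_n -> X * Y} :=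
  [ffun i => (p.1 i, p.2 i)].
Lemma fpair_bij n X Y : bijective (@fpair n X Y).
Proof.
exists (fun f : {ffun 'I_n -> X * Y} => ([ffun i => (f i).1] : {ffun 'I_n -> X}, [ffun i => (f i).2] : {ffun 'I_n -> Y})) => [[f g]|f].
  by congr (_, _); apply/ffunP => i; rewrite !ffunE.
by apply/ffunP => i; rewrite !ffunE /=; case: (f i).
Qed.

Lemma tensnM n X'' X' X (P : 'I_n -> rop X'' X') (Q : 'I_n -> rop X' X) :
  tensn P ** tensn Q = tensn (fun i => P i ** Q i).
Proof.
apply: ropP => f g; rewrite /tensn /mul bigA_distr_bigA /=.
by apply: eq_bigr => h _; rewrite -big_split.
Qed.
Lemma tensn_ct n X' X (P : 'I_n -> rop X' X) : (tensn P)^H = tensn (fun i => (P i)^H).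
Proof. by apply: ropP => f g; rewrite /ct /tensn rmorph_prod. Qed.
Lemma tensn1 n X : tensn (fun _ : 'I_n => (id1 : rop X X)) = id1.
Proof.
apply: ropP => f g; rewrite /tensn /idop; case: eqP => [->|h].
  by rewrite big1 // => i _; rewrite eqxx.
have [i hi] : exists i, f i != g i.
  apply/existsP; rewrite -negb_forall; apply/negP => /forallP h'; apply: h.
  by apply/ffunP => i; apply/eqP.
by rewrite (bigD1 i) //= (negbTE hi) mul0r.
Qed.
Lemma tensn_sum n X' X K (P : 'I_n -> K -> rop X' X) :
  \sum_(s : {ffun 'I_n -> K}) tensn (fun i => P i (s i)) = tensn (fun i => \sum_k P i k).
Proof.
apply: ropP => f g; rewrite rop_sum /tensn.
under [RHS]eq_bigr do rewrite rop_sum.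
by rewrite bigA_distr_bigA.
Qed.
Lemma psd_tensn n X (P : 'I_n -> op R X) : (forall i, psd (P i)) -> psd (tensn (P : 'I_n -> rop X X)).
Proof.
move=> h; have [G hG] := choice (fun i => (psdP (P i)).1 (h i)).
have -> : tensn (P : 'I_n -> rop X X) = tensn G ** (tensn G)^H.
  by rewrite tensn_ct tensnM; congr tensn; apply/funext => i; rewrite hG.
exact: psd_factor.
Qed.

Lemma tpM n X'' Y'' X' Y' X Y (P : 'I_n -> rop (X'' * Y'')%type (X' * Y')%type)
  (Q : 'I_n -> rop (X' * Y')%type (X * Y)%type) :
  tp P ** tp Q = tp (fun i => P i ** Q i).
Proof.
apply: ropP => p q; rewrite /tp /mul bigA_distr_bigA /=.
rewrite -(sum_bij (fun f : {ffun 'I_n -> X' * Y'} => \prod_i (P i (p.1 i, p.2 i) (f i) * Q i (f i) (q.1 i, q.2 i))) (@fpair_bij n X' Y')).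
apply: eq_bigr => h _; rewrite -big_split /=; apply: eq_bigr => i _; by rewrite ffunE.
Qed.
Lemma kron_tp n X' Y' X Y (P : 'I_n -> rop X' X) (Q : 'I_n -> rop Y' Y) :
  kron (tensn P) (tensn Q) = tp (fun i => kron (P i) (Q i)).
Proof. by apply: ropP => p q; rewrite /kron /tensn /tp -big_split. Qed.
Lemma tp_ct n X' Y' X Y (P : 'I_n -> rop (X' * Y')%type (X * Y)%type) :
  (tp P)^H = tp (fun i => (P i)^H).
Proof. by apply: ropP => f g; rewrite /ct /tp rmorph_prod. Qed.
Lemma tp_sum n X' Y' X Y K (P : 'I_n -> K -> rop (X' * Y')%type (X * Y)%type) :
  \sum_(s : {ffun 'I_n -> K}) tp (fun i => P i (s i)) = tp (fun i => \sum_k P i k).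
Proof.
apply: ropP => f g; rewrite rop_sum /tp.
under [RHS]eq_bigr do rewrite rop_sum.
by rewrite bigA_distr_bigA.
Qed.
Lemma tr_tp n X Y (P : 'I_n -> rop (X * Y)%type (X * Y)%type) : tr (tp P) = \prod_i tr (P i).
Proof.
rewrite /tr bigA_distr_bigA /=.
rewrite -(sum_bij (fun f : {ffun 'I_n -> X * Y} => \prod_i (P i (f i) (f i))) (@fpair_bij n X Y)).
by apply: eq_bigr => h _; apply: eq_bigr => i _; rewrite ffunE.
Qed.
Lemma psd_tp n X Y (P : 'I_n -> op R (X * Y)%type) : (forall i, psd (P i)) ->
  psd (tp (P : 'I_n -> rop (X * Y)%type (X * Y)%type)).
Proof.
move=> h; have [G hG] := choice (fun i => (psdP (P i)).1 (h i)).
have -> : tp (P : 'I_n -> rop (X * Y)%type (X * Y)%type) = tp G ** (tp G)^H.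
  by rewrite tp_ct tpM; congr tp; apply/funext => i; rewrite hG.
exact: psd_factor.
Qed.
Lemma tpowE n X Y (rho : op R (X * Y)%type) : @tpow R X Y n rho = tp (fun _ : 'I_n => (rho : rop _ _)).
Proof. by []. Qed.
Lemma state_tpow n X Y (rho : op R (X * Y)%type) : state rho -> state (@tpow R X Y n rho).
Proof.
move=> [pr tr1]; split; first by rewrite tpowE; apply: psd_tp.
by rewrite tpowE tr_tp big1.
Qed.

(* Unlike the supremum over separable states, this product form is multiplicative
   under tensor powers. *)
Definition sepbound X Y K (H : K -> op R X) (M : K -> op R Y) (c : R) :=
  forall (a : op R X) (b : op R Y), psd a -> psd b ->
  \sum_k rtr ((a : rop X X) ** H k) * rtr ((b : rop Y Y) ** M k) <= c * (rtr (a : rop X X) * rtr (b : rop Y Y)).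

(** The partial trace over Z of a multiplied by 1 tensor P, that is, the operator on X conditioned
    on the effect P. *)
Definition contr X Z (a : op R (X * Z)%type) (P : op R Z) : op R X :=
  fun x x' => \sum_z \sum_z' a (x, z) (x', z') * P z' z.
Lemma contr_rtr X Z (a : op R (X * Z)%type) (P : op R Z) (H : op R X) :
  rtr ((contr a P : rop X X) ** H) = rtr ((a : rop _ _) ** kron (H : rop X X) (P : rop Z Z)).
Proof.
congr complex.Re; rewrite /tr sum_pair; apply: eq_bigr => x _.
rewrite /mul; under eq_bigr do rewrite /contr mulr_suml.
rewrite exchange_big; apply: eq_bigr => z _ /=; rewrite sum_pair; apply: eq_bigr => x' _.
rewrite mulr_suml; apply: eq_bigr => z' _; rewrite /kron /=; ring.
Qed.
Lemma psd_contr X Z (a : op R (X * Z)%type) (P : op R Z) : psd a -> psd P -> psd (contr a P).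
Proof.
move=> pa /psdP[G ->].
pose V j : rop X (X * Z)%type := fun x p => (x == p.1)%:R * (G p.2 j)^*.
have -> : contr a (G ** G^H) = \sum_j V j ** a ** (V j)^H.
  apply: ropP => x x'; rewrite rop_sum /contr.
  have e j : (V j ** a ** (V j)^H) x x' = \sum_z' \sum_z (G z j)^* * a (x, z) (x', z') * G z' j.
    rewrite /mul sum_pair (bigD1 x') //= [X in _ + X]big1 ?addr0; last first.
      move=> y hy; rewrite big1 // => z _; rewrite /ct /V /= (eq_sym x') (negbTE hy) mul0r conjC0 mulr0 //.
    apply: eq_bigr => z' _ /=.
    rewrite sum_pair (bigD1 x) //= [X in _ + X]big1 ?addr0; last first.
      move=> y hy; rewrite big1 // => z _; rewrite /V /= (eq_sym x) (negbTE hy) !mul0r //.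
    rewrite /ct /V /= !eqxx !mul1r conjCK mulr_suml; apply: eq_bigr => z _ //.
    by rewrite mul1r.
  under [RHS]eq_bigr do rewrite e exchange_big /=.
  rewrite [RHS]exchange_big; apply: eq_bigr => z _ /=.
  rewrite [RHS]exchange_big; apply: eq_bigr => z' _ /=.
  rewrite /mul mulr_sumr; apply: eq_bigr => j _; rewrite /ct; ring.
by apply: psd_sum => j _; apply: psd_conj.
Qed.
Lemma rtr_contr X Z (a : op R (X * Z)%type) (P : op R Z) :
  rtr (contr a P : rop X X) = rtr ((a : rop _ _) ** kron (id1 : rop X X) (P : rop Z Z)).
Proof. by rewrite -contr_rtr mulI. Qed.

Definition swapc X Z (a : op R (X * Z)%type) : op R (Z * X)%type :=
  reidx (fun p => (p.2, p.1)) a.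
Lemma swap_bij X Z : bijective (fun p : X * Z => (p.2, p.1)).
Proof. by exists (fun p : Z * X => (p.2, p.1)) => -[]. Qed.
Lemma rtr_swap X Z (a : op R (X * Z)%type) (H : op R X) (P : op R Z) :
  rtr ((swapc a : rop _ _) ** kron (P : rop Z Z) (H : rop X X)) =
  rtr ((a : rop _ _) ** kron (H : rop X X) (P : rop Z Z)).
Proof.
rewrite /rtr -(tr_reidx _ (swap_bij Z X)); congr (complex.Re (tr _)).
rewrite (reidxM _ _ (swap_bij Z X)); congr (_ ** _).
by apply: ropP => p q; rewrite /reidx /kron /= mulrC.
Qed.

(** The first bound is applied to a and b conditioned on the second pair of effects, which keeps
    them positive, and the second bound to what remains. Entanglement of a or b across the two
    blocks does no harm. *)
Lemma sepbound_prod X Y K X2 Y2 K2 (H : K -> op R X) (M : K -> op R Y) (P : K2 -> op R X2) (Q : K2 -> op R Y2) c c2 :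
  0 <= c -> (forall k, psd (P k)) -> (forall k, psd (Q k)) ->
  sepbound H M c -> sepbound P Q c2 ->
  sepbound (fun k : K * K2 => (kron (H k.1 : rop _ _) (P k.2 : rop _ _) : op R (X * X2)%type))
    (fun k : K * K2 => (kron (M k.1 : rop _ _) (Q k.2 : rop _ _) : op R (Y * Y2)%type)) (c * c2).
Proof.
move=> c0 pP pQ h1 h2 a b pa pb; rewrite sum_pair exchange_big /=.
apply: (@le_trans _ _ (\sum_k2 c * (rtr (contr a (P k2) : rop X X) * rtr (contr b (Q k2) : rop Y Y)))).
  apply: ler_sum => k2 _; under eq_bigr do rewrite -!contr_rtr.
  by apply: h1; apply: psd_contr.
rewrite -mulr_sumr -mulrA; apply: ler_wpM2l => //.
have := h2 (contr (swapc a) (id1 : rop X X)) (contr (swapc b) (id1 : rop Y Y)).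
move=> /(_ (psd_contr (psd_reidx _ pa) (psd1 R X)) (psd_contr (psd_reidx _ pb) (psd1 R Y))).
rewrite !rtr_contr !kron1 !mulI [rtr (swapc a : rop _ _)]/rtr [rtr (swapc b : rop _ _)]/rtr.
rewrite (tr_reidx a (swap_bij X2 X)) (tr_reidx b (swap_bij Y2 Y)).
by under eq_bigr do rewrite !contr_rtr !rtr_swap -!rtr_contr.
Qed.

Lemma sepbound_reidx X X' Y Y' K K' (f : X' -> X) (g : Y' -> Y) (h : K' -> K) (H : K -> op R X) (M : K -> op R Y) c :
  bijective f -> bijective g -> bijective h ->
  sepbound (fun k => reidx f (H (h k))) (fun k => reidx g (M (h k))) c -> sepbound H M c.
Proof.
move=> bf bg bh hs a b pa pb; have := hs _ _ (psd_reidx f pa) (psd_reidx g pb).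
rewrite /rtr (tr_reidx a bf) (tr_reidx b bg).
rewrite -(sum_bij (fun k => complex.Re (tr ((a : rop X X) ** H k)) * complex.Re (tr ((b : rop Y Y) ** M k))) bh).
apply: le_trans; rewrite le_eqVlt; apply/orP; left; apply/eqP; apply: eq_bigr => k _.
by rewrite -(reidxM a (H (h k)) bf) -(reidxM b (M (h k)) bg) (tr_reidx _ bf) (tr_reidx _ bg).
Qed.

Definition fcat m n X (p : {ffun 'I_m -> X} * {ffun 'I_n -> X}) : {ffun 'I_(m + n) -> X} :=
  [ffun i : 'I_(m + n) => match fintype.split i with inl j => p.1 j | inr j => p.2 j end].
Lemma fcat_l m n X (p : {ffun 'I_m -> X} * {ffun 'I_n -> X}) j : fcat p (lshift n j) = p.1 j.
Proof. by rewrite ffunE (fintype.unsplitK (inl j)). Qed.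
Lemma fcat_r m n X (p : {ffun 'I_m -> X} * {ffun 'I_n -> X}) j : fcat p (rshift m j) = p.2 j.
Proof. by rewrite ffunE (fintype.unsplitK (inr j)). Qed.
Lemma fcat_bij m n X : bijective (@fcat m n X).
Proof.
exists (fun f : {ffun 'I_(m + n) -> X} => ([ffun j => f (lshift n j)] : {ffun 'I_m -> X},
   [ffun j => f (rshift m j)] : {ffun 'I_n -> X})) => [[f g]|f].
  by congr (_, _); apply/ffunP => i; rewrite ffunE ?fcat_l ?fcat_r.
apply/ffunP => i; rewrite ffunE; case: fintype.splitP => j e; rewrite ffunE; congr (f _); exact/val_inj.
Qed.
Lemma tensn_fcat m n X K (H : K -> op R X) (k : {ffun 'I_m -> K} * {ffun 'I_n -> K}) :
  reidx (@fcat m n X) (tensn (fun i => (H (fcat k i) : rop X X))) =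
  kron (tensn (fun i => (H (k.1 i) : rop X X))) (tensn (fun i => (H (k.2 i) : rop X X))).
Proof.
apply: ropP => p q; rewrite /reidx /tensn /kron big_split_ord /=; congr (_ * _); apply: eq_bigr => i _.
  by rewrite !fcat_l.
by rewrite !fcat_r.
Qed.

Lemma sepbound_tensn n X Y K (H : K -> op R X) (M : K -> op R Y) c :
  0 <= c -> (forall k, psd (H k)) -> (forall k, psd (M k)) -> sepbound H M c ->
  sepbound (fun k : {ffun 'I_n -> K} => tensn (fun i => (H (k i) : rop X X)))
     (fun k : {ffun 'I_n -> K} => tensn (fun i => (M (k i) : rop Y Y))) (c ^+ n).
Proof.
move=> c0 psd_mgf psd_kraus_sq hb; elim: n => [|n IH].
  move=> a b pa pb; rewrite expr0 mul1r.
  have e (Z : finType) (F : 'I_0 -> rop Z Z) : tensn F = id1.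
    by rewrite -(tensn1 0 Z); congr tensn; apply/funext => -[].
  under eq_bigr do rewrite !e !mulI.
  by rewrite sumr_const card_ffun card_ord expn0 mulr1n lexx.
have h1 : sepbound (fun k : {ffun 'I_1 -> K} => tensn (fun i => (H (k i) : rop X X)))
     (fun k : {ffun 'I_1 -> K} => tensn (fun i => (M (k i) : rop Y Y))) c.
  have cb (Z : finType) : bijective (fun z : Z => [ffun _ : 'I_1 => z]).
    exists (fun f : {ffun 'I_1 -> Z} => f ord0) => [z|f]; first by rewrite ffunE.
    by apply/ffunP => i; rewrite ffunE (ord1 i).
  apply: (sepbound_reidx (cb X) (cb Y) (cb K)).
  have e (Z : finType) (F : K -> op R Z) k : reidx (fun z : Z => [ffun _ : 'I_1 => z])
     (tensn (fun i => (F ([ffun _ : 'I_1 => k] i) : rop Z Z))) = F k.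
    by apply: ropP => z z'; rewrite /reidx /tensn big_ord1 !ffunE.
  by move=> a b pa pb; under eq_bigr do rewrite !e; apply: hb.
rewrite exprS -add1n.
apply: (sepbound_reidx (@fcat_bij 1 n X) (@fcat_bij 1 n Y) (@fcat_bij 1 n K)).
move=> a b pa pb; under eq_bigr do rewrite !tensn_fcat.
apply: (sepbound_prod c0 _ _ h1 IH pa pb) => k; apply: psd_tensn => i; [exact: psd_mgf|exact: psd_kraus_sq].
Qed.
End Tensor.

(** * The threshold test on n copies *)

Section Ncopy.
Variable R : realType.
Local Notation C := R[i].
Local Notation toC := (real_complex R).
Local Notation rop := (rop R).
Local Notation "'id1'" := (@idop R _).

Lemma expRN_le (x : R) : 0 <= x -> expR (- x) <= 1 - x + x ^+ 2.
Proof.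
move=> x0; have h := expR_ge1Dx x; have e0 := expR_gt0 x.
rewrite expRN -[X in X <= _]mul1r ler_pdivrMr //.
apply: (@le_trans _ _ ((1 - x + x ^+ 2) * (1 + x))); last by apply: ler_wpM2l => //; nra.
have : 0 <= x ^+ 3 by apply: exprn_ge0.
have -> : (1 - x + x ^+ 2) * (1 + x) = 1 + x ^+ 3 by ring.
lra.
Qed.
Lemma expR_le_quad (x : R) : 0 <= x -> x <= 1 / 2 -> expR x <= 1 + x + 2 * x ^+ 2.
Proof.
move=> x0 x1; have h := expR_ge1Dx (- x); have e0 := expR_gt0 x.
have e : expR x * expR (- x) = 1 by rewrite expRN mulfV // gt_eqF.
have h2 : expR x * (1 - x) <= 1 by rewrite -[X in _ <= X]e ler_pM2l.
have h3 : 1 <= (1 + x + 2 * x ^+ 2) * (1 - x).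
  have -> : (1 + x + 2 * x ^+ 2) * (1 - x) = 1 + x ^+ 2 * (1 - 2 * x) by ring.
  by rewrite lerDl mulr_ge0 ?sqr_ge0 //; lra.
have h4 := le_trans h2 h3.
by rewrite -(@ler_pM2r _ (1 - x)) //; lra.
Qed.

(** Exponential moment with parameter d / 8 about the midpoint mu - d / 2. The exponent gains d^2 /
    16 and the second-order error is at most (d / 8)^2, so d^2 / 32 survives. *)
Lemma chernoff_lower (mu d : R) : 0 <= mu <= 1 -> 0 < d <= 1 ->
  mu * expR (d / 8 * (mu - d / 2 - 1)) + (1 - mu) * expR (d / 8 * (mu - d / 2)) <= expR (- (d ^+ 2 / 32)).
Proof.
move=> /andP[m0 m1] /andP[d0 d1].
have -> : d / 8 * (mu - d / 2 - 1) = d / 8 * (mu - d / 2) + - (d / 8) by ring.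
rewrite expRD; set u := expR (d / 8 * _); set w := expR (- (d / 8)).
have hw : w <= 1 - d / 8 + (d / 8) ^+ 2 by apply: expRN_le; lra.
have h1 : 1 - mu * (1 - w) <= expR (- (mu * (1 - w))) by have := expR_ge1Dx (- (mu * (1 - w))); lra.
have -> : mu * (u * w) + (1 - mu) * u = u * (1 - mu * (1 - w)) by ring.
apply: (le_trans (ler_wpM2l (expR_ge0 _) h1)); rewrite -expRD ler_expR.
have h2 : mu * (d / 8 - (d / 8) ^+ 2) <= mu * (1 - w) by apply: ler_wpM2l => //; lra.
have h3 : mu * (d / 8) ^+ 2 <= (d / 8) ^+ 2 by rewrite -[X in _ <= X]mul1r; apply: ler_wpM2r => //; apply: sqr_ge0.
nra.
Qed.
(** The same parameter for a success probability below mu - d: again a gain of d^2 / 16, now against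
    an error of at most 2 (d / 8)^2, which leaves exactly d^2 / 32. *)
Lemma chernoff_upper (mu d x : R) : 0 <= x -> x <= mu - d -> mu <= 1 -> 0 < d <= 1 ->
  x * expR (d / 8 * (1 - (mu - d / 2))) + (1 - x) * expR (d / 8 * (0 - (mu - d / 2))) <= expR (- (d ^+ 2 / 32)).
Proof.
move=> x0 x1 m1 /andP[d0 d1].
have -> : d / 8 * (1 - (mu - d / 2)) = d / 8 * (0 - (mu - d / 2)) + d / 8 by ring.
rewrite expRD; set u := expR (d / 8 * _); set w := expR (d / 8).
have hw : w <= 1 + d / 8 + 2 * (d / 8) ^+ 2 by apply: expR_le_quad; lra.
have h1 : 1 + x * (w - 1) <= expR (x * (w - 1)) by apply: expR_ge1Dx.
have -> : x * (u * w) + (1 - x) * u = u * (1 + x * (w - 1)) by ring.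
apply: (le_trans (ler_wpM2l (expR_ge0 _) h1)); rewrite -expRD ler_expR.
have h2 : x * (w - 1) <= x * (d / 8 + 2 * (d / 8) ^+ 2) by apply: ler_wpM2l => //; lra.
have p0 : 0 <= d / 8 + 2 * (d / 8) ^+ 2 by have := sqr_ge0 (d / 8); lra.
have h3 : x * (d / 8 + 2 * (d / 8) ^+ 2) <= (mu - d) * (d / 8 + 2 * (d / 8) ^+ 2) by apply: ler_wpM2r.
have h4 : (mu - d) * (d / 8) ^+ 2 <= (d / 8) ^+ 2.
  by rewrite -[X in _ <= X]mul1r; apply: ler_wpM2r; [apply: sqr_ge0|lra].
nra.
Qed.

Lemma tr_mul_psd (T : finType) (a b : op R T) : psd a -> psd b ->
  tr ((a : rop T T) ** b) = toC (rtr ((a : rop T T) ** b)).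
Proof.
move=> /psdP[G ->] pb; rewrite -mulA rtrC trC.
by have := tr_psd (psd_conj' G pb); rewrite -mulA.
Qed.

Lemma rtr_tensor_kron (X Y : finType) (a P : op R X) (b Q : op R Y) :
  psd a -> psd b -> psd P -> psd Q ->
  rtr ((tensor a b : rop _ _) ** kron (P : rop X X) (Q : rop Y Y)) =
  rtr ((a : rop X X) ** P) * rtr ((b : rop Y Y) ** Q).
Proof.
move=> pa pb pP pQ; apply: (@toC_inj R); rewrite rmorphM /= -!tr_mul_psd //.
  rewrite -[tensor a b]/(kron (a : rop X X) (b : rop Y Y)) kronM.
  exact: tr_tensor.
- exact: psd_tensor.
exact: (psd_tensor pP pQ).
Qed.

Variables (A Y B K : finType) (l : K -> rop B Y) (W : K -> op R A) (rho : op R (A * Y)%type).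
Hypothesis hl : \sum_k (l k)^H ** l k = id1.
Hypothesis pW : forall k, psd (W k).
Hypothesis pW1 : forall k, psd ((id1 : rop A A) - W k).
Hypothesis hrho : state rho.
Let M k : op R Y := (l k)^H ** l k.
Let mu := acc l W rho.
Variable d : R.
Hypothesis hd : 0 < d <= 1.
Hypothesis hsep : forall s, separable s -> acc l W s <= mu - d.
Variable n : nat.
Local Notation An := {ffun 'I_n -> A}.
Local Notation Yn := {ffun 'I_n -> Y}.
Local Notation Bn := {ffun 'I_n -> B}.
Local Notation Kn := {ffun 'I_n -> K}.
(** Threshold halfway between the acceptance probability mu of rho and the bound mu - d for
    separable states; [kap] is the error exponent per copy. *)
Let th := mu - d / 2.
Let kap := d ^+ 2 / 32.

Let Wb (b : bool) k : op R A := if b then W k else (id1 : rop A A) - W k.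
Lemma psd_kraus_sq k : psd (M k). Proof. by rewrite /M -{2}(ctK (l k)); apply: psd_factor. Qed.
Lemma psd_test b k : psd (Wb b k). Proof. by case: b; [apply: pW|apply: pW1]. Qed.
(** A pattern of single-copy outcomes is accepted when its frequency of successes reaches the
    threshold. *)
Let accs (s : {ffun 'I_n -> bool}) : bool := n%:R * th <= \sum_i (s i)%:R.
Let WT (k : Kn) (s : {ffun 'I_n -> bool}) : rop An An := tensn (fun i => (Wb (s i) (k i) : rop A A)).
Let T (k : Kn) : op R An := \sum_(s | accs s) WT k s.
Let L (k : Kn) : rop Bn Yn := tensn (fun i => l (k i)).

Lemma psd_test_tensn k s : psd (WT k s). Proof. by apply: psd_tensn => i; apply: psd_test. Qed.
Lemma test_tensn_sum k : \sum_s WT k s = id1.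
Proof.
rewrite /WT (tensn_sum (fun i b => (Wb b (k i) : rop A A))) -(tensn1 R n A); congr tensn.
by apply/funext => i; rewrite big_bool /= addrCA subrr addr0.
Qed.
Lemma psd_accept k : psd (T k). Proof. by apply: psd_sum => s _; apply: psd_test_tensn. Qed.
Lemma accept_compl k : (id1 : rop An An) - T k = \sum_(s | ~~ accs s) WT k s.
Proof. by rewrite -(test_tensn_sum k) (bigID accs) /T /= addrAC subrr add0r. Qed.
Lemma psd_reject k : psd ((id1 : rop An An) - T k).
Proof. by rewrite accept_compl; apply: psd_sum => s _; apply: psd_test_tensn. Qed.
Lemma tensn_kraus_sq k : (L k)^H ** L k = tensn (fun i => (M (k i) : rop Y Y)).
Proof. by rewrite /L tensn_ct tensnM. Qed.
Lemma tensn_complete : \sum_k (L k)^H ** L k = id1.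
Proof.
under eq_bigr do rewrite tensn_kraus_sq.
rewrite (tensn_sum (fun i k => (M k : rop Y Y))) -(tensn1 R n Y); congr tensn.
by apply/funext => i; apply: hl.
Qed.

(** For a state S, the probability of the outcome pattern s, with the frame outcomes on Y summed
    out. *)
Let F (S : op R (An * Yn)%type) (s : {ffun 'I_n -> bool}) : R :=
  \sum_k rtr ((S : rop _ _) ** kron (WT k s) ((L k)^H ** L k)).
Lemma accE S : acc L T S = \sum_(s | accs s) F S s.
Proof.
rewrite /acc /F exchange_big; apply: eq_bigr => k _ /=.
rewrite -rtr_sum -mul_sumr; congr (rtr (_ ** _)).
by apply: ropP => p q; rewrite rop_sum /kron /T rop_sum mulr_suml.
Qed.
Lemma outcome_ge0 S s : psd S -> 0 <= F S s.
Proof.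
move=> pS; apply: sumr_ge0 => k _; apply: rtr_mul_ge0 => //.
apply: (psd_tensor (psd_test_tensn k s)); rewrite -{2}(ctK (L k)); exact: psd_factor.
Qed.
Lemma outcome_sum S : \sum_s F S s = rtr (S : rop _ _).
Proof.
rewrite /F exchange_big /=.
transitivity (\sum_k rtr ((S : rop _ _) ** kron id1 ((L k)^H ** L k))).
  apply: eq_bigr => k _; rewrite -rtr_sum -mul_sumr; congr (rtr (_ ** _)).
  apply: ropP => p q; rewrite rop_sum /kron -mulr_suml -(test_tensn_sum k) rop_sum //.
by rewrite -rtr_sum -mul_sumr -kron_sumr tensn_complete kron1 mulI.
Qed.

Let m (b : bool) : R := \sum_k rtr ((rho : rop _ _) ** kron (Wb b k : rop A A) (M k)).
Lemma test_true : m true = mu. Proof. by []. Qed.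
Lemma test_sum : m true + m false = 1.
Proof.
rewrite /m -big_split -(state_rtr hrho) -[RHS](congr1 _ (mulI (rho : rop _ _))) -kron1 -hl kron_sumr mul_sumr rtr_sum.
apply: eq_bigr => k _ /=; rewrite -rtrD -mulDr; congr (rtr (_ ** _)); apply: ropP => p q.
by rewrite ropD /kron ropB -mulrDl addrCA subrr addr0.
Qed.
Lemma test_ge0 b : 0 <= m b.
Proof.
apply: sumr_ge0 => k _; apply: rtr_mul_ge0; first by case: hrho.
exact: (psd_tensor (psd_test b k) (psd_kraus_sq k)).
Qed.
Lemma acc_bounds : 0 <= mu <= 1.
Proof. by have := test_ge0 true; have := test_ge0 false; have := test_sum; rewrite test_true => *; apply/andP; lra. Qed.

Lemma outcome_rho s : F (@tpow R A Y n rho) s = \prod_i m (s i).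
Proof.
apply: (@toC_inj R); rewrite rmorph_prod /= /F toC_sum.
transitivity (\sum_(k : Kn) \prod_i tr ((rho : rop _ _) ** kron (Wb (s i) (k i) : rop A A) (M (k i)))).
  apply: eq_bigr => k _; rewrite -tr_mul_psd.
  - rewrite tensn_kraus_sq /WT kron_tp tpowE tpM; exact: tr_tp.
  - by case: (state_tpow n hrho).
  by rewrite tensn_kraus_sq; apply: (psd_tensor (psd_test_tensn k s)); apply: psd_tensn => i; apply: psd_kraus_sq.
rewrite -(bigA_distr_bigA (fun i k => tr ((rho : rop _ _) ** kron (Wb (s i) k : rop A A) (M k)))).
apply: eq_bigr => i _; rewrite /m toC_sum; apply: eq_bigr => k _.
rewrite tr_mul_psd //; first by case: hrho.
exact: (psd_tensor (psd_test _ k) (psd_kraus_sq k)).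
Qed.

Lemma expR_sumE (I : finType) (f : I -> R) : expR (\sum_i f i) = \prod_i expR (f i).
Proof. by elim/big_rec2: _ => [|i y1 y2 _ <-]; rewrite ?expR0 ?expRD. Qed.

Lemma sum_prod_bool (g : bool -> R) :
  \sum_(s : {ffun 'I_n -> bool}) \prod_i g (s i) = (g true + g false) ^+ n.
Proof.
rewrite -(bigA_distr_bigA (fun (i : 'I_n) b => g b)).
by under eq_bigr do rewrite big_bool; rewrite prodr_const card_ord.
Qed.

(** On rho tensored with itself the outcomes are independent by [outcome_rho], so the exponential
    moment factorises and Markov's inequality gives the Chernoff bound. *)
Lemma acc_rho : 1 - expR (- (n%:R * kap)) <= acc L T (@tpow R A Y n rho).
Proof.
have hp : acc L T (@tpow R A Y n rho) = 1 - \sum_(s | ~~ accs s) F (@tpow R A Y n rho) s.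
  rewrite accE -(state_rtr (state_tpow n hrho)) -(outcome_sum (@tpow R A Y n rho)) [in RHS](bigID accs) /=.
  by rewrite addrK.
rewrite hp lerD2l lerN2.
apply: (@le_trans _ _ (\sum_(s : {ffun 'I_n -> bool}) \prod_i (m (s i) * expR (d / 8 * (th - (s i)%:R))))).
  rewrite [X in _ <= X](bigID accs) /= -[X in X <= _]add0r; apply: lerD.
    by apply: sumr_ge0 => s _; apply: prodr_ge0 => i _; rewrite mulr_ge0 ?test_ge0 ?expR_ge0.
  apply: ler_sum => s hs; rewrite outcome_rho big_split /= -expR_sumE.
  rewrite -[X in X <= _]mulr1; apply: ler_wpM2l; first by apply: prodr_ge0 => i _; apply: test_ge0.
  rewrite -[X in X <= _]expR0 ler_expR -mulr_sumr mulr_ge0 //; first by case/andP: hd => *; lra.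
  rewrite sumrB sumr_const card_ord -mulr_natl subr_ge0 ltW // ltNge; exact: hs.
rewrite (sum_prod_bool (fun b : bool => m b * expR (d / 8 * (th - b%:R)))).
have -> : expR (- (n%:R * kap)) = expR (- kap) ^+ n by rewrite -expRM_natl mulrN.
apply: lerXn2r; rewrite ?nnegrE ?expR_ge0 //.
  by rewrite addr_ge0 // mulr_ge0 ?test_ge0 ?expR_ge0.
rewrite test_true subr0; have -> : m false = 1 - mu by have := test_sum; rewrite test_true; lra.
exact: (chernoff_lower acc_bounds hd).
Qed.

Lemma acc_sep_bound (tau : op R (A * Y)%type) : separable tau ->
  \sum_k rtr ((tau : rop _ _) ** kron (\sum_(b : bool) toC (expR (d / 8 * (b%:R - th))) *: (Wb b k : rop A A)) (M k))
   <= expR (- kap).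
Proof.
move=> ht; have st := sep_state ht.
have f1 : \sum_k rtr ((tau : rop _ _) ** kron (Wb false k : rop A A) (M k)) = 1 - acc l W tau.
  have : acc l W tau + \sum_k rtr ((tau : rop _ _) ** kron (Wb false k : rop A A) (M k)) = 1.
    rewrite /acc -big_split -(state_rtr st) -[RHS](congr1 _ (mulI (tau : rop _ _))) -kron1 -hl kron_sumr mul_sumr rtr_sum.
    apply: eq_bigr => k _ /=; rewrite -rtrD -mulDr; congr (rtr (_ ** _)); apply: ropP => p q.
    by rewrite ropD /kron ropB -mulrDl addrCA subrr addr0.
  by move=> <-; rewrite addrC addKr.
have -> : \sum_k rtr ((tau : rop _ _) ** kron (\sum_(b : bool) toC (expR (d / 8 * (b%:R - th))) *: (Wb b k : rop A A)) (M k))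
  = acc l W tau * expR (d / 8 * (1 - th)) + (1 - acc l W tau) * expR (d / 8 * (0 - th)).
  rewrite -f1 /acc !mulr_suml -big_split; apply: eq_bigr => k _ /=.
  rewrite [rtr _ * expR (_ * (1 - th))]mulrC [rtr _ * expR (_ * (0 - th))]mulrC -!rtrZ -!mulZr -rtrD -mulDr; congr (rtr (_ ** _)).
  by apply: ropP => p q; rewrite ropD !ropZ /kron rop_sum big_bool /= mulrDl !mulrA.
apply: chernoff_upper => //.
- apply: sumr_ge0 => k _; apply: rtr_mul_ge0; first by case: st.
  exact: (psd_tensor (psd_test true k) (psd_kraus_sq k)).
- exact: hsep.
by case/andP: acc_bounds.
Qed.

(** Exponential moment of a single-copy outcome given k, kept as an operator on A. *)
Let H k : op R A := \sum_(b : bool) toC (expR (d / 8 * (b%:R - th))) *: (Wb b k : rop A A).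
Lemma psd_mgf k : psd (H k).
Proof. by apply: psd_sum => b _; apply: psdZ; [apply: expR_ge0|apply: psd_test]. Qed.

(** A product of positive operators is a multiple of a separable state, unless a factor is zero, and
    on separable states the exponential moment is bounded by [acc_sep_bound]. *)
Lemma sepbound1 : sepbound H M (expR (- kap)).
Proof.
move=> a b pa pb.
have [ha|ha] := eqVneq (rtr (a : rop A A)) 0.
  by rewrite ha mul0r mulr0 (rtr_psd_eq0 pa ha) big1 // => k _; rewrite mul0l rtr0 mul0r.
have [hb|hb] := eqVneq (rtr (b : rop Y Y)) 0.
  by rewrite hb !mulr0 (rtr_psd_eq0 pb hb) big1 // => k _; rewrite mul0l rtr0 mulr0.
have a0 : 0 < rtr (a : rop A A) by rewrite lt_def ha rtr_ge0.
have b0 : 0 < rtr (b : rop Y Y) by rewrite lt_def hb rtr_ge0.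
set t := rtr (a : rop A A) * rtr (b : rop Y Y); have t0 : 0 < t by rewrite mulr_gt0.
pose tau : op R (A * Y)%type := toC t^-1 *: (tensor a b : rop _ _).
have htau : separable tau.
  apply: sepcone_sep.
    apply: sepconeZ; first by rewrite invr_ge0 ltW.
    by exists unit, (fun=> a), (fun=> b); split=> //; rewrite sum_unit.
  by rewrite rtrZ rtr_tensor // mulVf // gt_eqF.
have := acc_sep_bound htau.
under eq_bigr do rewrite mulZl rtrZ.
rewrite -mulr_sumr mulrC ler_pdivrMr //.
by under eq_bigr do rewrite (rtr_tensor_kron pa pb (psd_mgf _) (psd_kraus_sq _)).
Qed.

(** A separable state of n copies may be correlated between the copies. Markov's inequality replaces
    the acceptance event by the exponential moment, whose operator is a tensor power, and
    [sepbound_tensn] bounds it on each product term of s. *)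
Lemma acc_sep s : separable s -> acc L T s <= expR (- (n%:R * kap)).
Proof.
move=> hs; have ss := sep_state hs; rewrite accE.
apply: (@le_trans _ _ (\sum_(x : {ffun 'I_n -> bool}) expR (\sum_i (d / 8 * ((x i : bool)%:R - th))) * F s x)).
  rewrite [X in _ <= X](bigID accs) /= -[X in X <= _]addr0; apply: lerD; last first.
    by apply: sumr_ge0 => x _; rewrite mulr_ge0 ?expR_ge0 // outcome_ge0 //; case: ss.
  apply: ler_sum => x hx; rewrite -[X in X <= _]mul1r; apply: ler_wpM2r.
    by apply: outcome_ge0; case: ss.
  rewrite -[X in X <= _]expR0 ler_expR -mulr_sumr mulr_ge0 //; first by case/andP: hd => *; lra.
  by rewrite sumrB sumr_const card_ord -mulr_natl subr_ge0.
have [J [a [b [pa pb es]]]] := sep_sepcone hs.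
have -> : \sum_(x : {ffun 'I_n -> bool}) expR (\sum_i (d / 8 * ((x i : bool)%:R - th))) * F s x =
  \sum_j \sum_(k : Kn) rtr ((a j : rop _ _) ** tensn (fun i => (H (k i) : rop A A))) *
     rtr ((b j : rop _ _) ** tensn (fun i => (M (k i) : rop Y Y))).
  under eq_bigr do rewrite /F mulr_sumr.
  rewrite exchange_big [RHS]exchange_big; apply: eq_bigr => k _ /=.
  have -> : tensn (fun i => (H (k i) : rop A A)) = \sum_(x : {ffun 'I_n -> bool}) toC (expR (\sum_i (d / 8 * ((x i : bool)%:R - th)))) *: WT k x.
    rewrite /H -(tensn_sum (fun i (c : bool) => toC (expR (d / 8 * (c%:R - th))) *: (Wb c (k i) : rop A A))).
    apply: eq_bigr => x _; apply: ropP => f g; rewrite ropZ /tensn expR_sumE rmorph_prod -big_split.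
    by apply: eq_bigr => i _.
  under [RHS]eq_bigr do rewrite mul_sumr rtr_sum mulr_suml.
  rewrite [RHS]exchange_big; apply: eq_bigr => x _ /=.
  rewrite es mul_suml rtr_sum mulr_sumr; apply: eq_bigr => j _.
  rewrite tensn_kraus_sq (rtr_tensor_kron (pa j) (pb j) (psd_test_tensn k x)); last by apply: psd_tensn => i; apply: psd_kraus_sq.
  by rewrite mulZr rtrZ mulrA.
apply: (@le_trans _ _ (\sum_j expR (- kap) ^+ n * (rtr (a j : rop _ _) * rtr (b j : rop _ _)))).
  apply: ler_sum => j _.
  exact: (sepbound_tensn (expR_ge0 _) psd_mgf psd_kraus_sq sepbound1 (pa j) (pb j)).
rewrite -mulr_sumr -expRM_natl mulrN.
have -> : \sum_j rtr (a j : rop _ _) * rtr (b j : rop _ _) = 1.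
  by rewrite -(state_rtr ss) es rtr_sum; apply: eq_bigr => j _; rewrite rtr_tensor.
by rewrite mulr1.
Qed.

Lemma measured_tpow : measured L (@tpow R A Y n rho) = @tpow R A B n (measured l rho).
Proof.
rewrite /measured [RHS]tpowE -(tp_sum (fun i k => kron (id1 : rop A A) (l k) ** rho ** (kron (id1 : rop A A) (l k))^H)).
apply: eq_bigr => k _; rewrite -(tensn1 R n A) /L kron_tp tp_ct tpowE !tpM //.
Qed.

Lemma ncopy (dd : R) : (0 < n)%N -> 0 < dd ->
  ER (@tpow R A B n (measured l rho)) <=
   (1 + dd) * (ER (@tpow R A Y n rho) - (1 - expR (- (n%:R * kap))) * (n%:R * kap / ln 2))
   + (1 + dd^-1) * expR (- (n%:R * kap)) * (n%:R * log2 (#|A| * #|B|)%:R) + gentle_cst dd.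
Proof.
move=> n0 dd0; have l2 := @ln2_gt0 R; have k0 : 0 < kap.
  by rewrite /kap divr_gt0 // exprn_gt0 //; case/andP: hd.
have nk : 0 < n%:R * kap by rewrite mulr_gt0 // ltr0n.
have ha := acc_rho.
have e1 : expR (- (n%:R * kap)) < 1 by rewrite -[X in _ < X]expR0 ltr_expR oppr_lt0.
have p0 : 0 < acc L T (@tpow R A Y n rho) by lra.
have := instrument tensn_complete psd_accept psd_reject (state_tpow n hrho) dd0 (expR_gt0 (- (n%:R * kap))) acc_sep p0.
rewrite measured_tpow => h; apply: (le_trans h); rewrite lerD2r.
set p := acc L T _ in ha p0 *; set q := expR _ in ha e1 *.
have eq : log2 q = - (n%:R * kap / ln 2) by rewrite /log2 /q expR_gt0 expRK mulNr.
have eL : log2 #|{: An * Bn}|%:R = n%:R * log2 (#|A| * #|B|)%:R :> R.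
  rewrite card_prod !card_ffun !card_ord -expnMn.
  have [h0|h0] := posnP (#|A| * #|B|)%N.
    by rewrite h0 exp0n // log2_0 mulr0.
  rewrite /log2 !ltr0n expn_gt0 h0 /= natrX lnXn ?ltr0n //.
  by rewrite -[ln _ *+ n]mulr_natl mulrA.
have L0 : 0 <= log2 (#|A| * #|B|)%:R :> R.
  rewrite /log2; case: ifP => // h0; rewrite divr_ge0 ?(ltW l2) // ln_ge0 // ler1n.
  by rewrite -(ltr0n R).
rewrite eL eq; apply: lerD.
  rewrite ler_pM2l; last by lra.
  rewrite lerD2l mulrN lerN2 ler_pM2r //; exact: divr_gt0.
apply: ler_wpM2r; first by rewrite mulr_ge0.
by rewrite ler_pM2l; [lra|have : 0 < dd^-1 by rewrite invr_gt0]; lra.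
Qed.
End Ncopy.

(** * A test separating a state from the separable ones *)

Section Separation.
Variable R : realType.
Local Notation C := R[i].
Local Notation toC := (real_complex R).
Local Notation rop := (rop R).
Local Notation "'id1'" := (@idop R _).

Lemma fn_psd_le (T : finType) (a : op R T) : psd a -> fn (a : rop T T) <= rtr (a : rop T T) ^+ 2.
Proof.
move=> pa; have [U [l [hl l0]]] := psd_spec pa.
rewrite fn_rtr (psd_herm pa) -[X in rtr (_ ** X)](mfun_idE hl) (rtr_mfun_self _ hl).
rewrite expr2 {1}(rtr_spec hl) mulr_suml; apply: ler_sum => i _; apply: ler_wpM2l => //.
exact: spec_le_tr hl l0 i.
Qed.

(** The Hilbert-Schmidt norm dominates every eigenvalue in modulus. *)
Lemma unit_ball_psd (T : finType) (U : rop T T) : U^H = U -> fn U <= 1 -> psd ((id1 : rop T T) + U).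
Proof.
move=> hU f1; have [V [l hl]] := @spectral R T U hU; have [uV _] := hl.
have VV := unitary_r uV.
have el : fn U = \sum_a l a ^+ 2.
  rewrite fn_rtr hU -[X in rtr (_ ** X)](mfun_idE hl) (rtr_mfun_self _ hl).
  by apply: eq_bigr => a _; rewrite expr2.
have -> : (id1 : rop T T) + U = V ** diagop (fun a => 1 + l a) ** V^H.
  rewrite [X in _ + X](mfun_id hl).
  have -> : diagop (fun a => 1 + l a) = (id1 : rop T T) + diagop l.
    by apply: ropP => i j; rewrite ropD !diagopE rmorphD /= mulrDr rmorph1 mulr1.
  by rewrite mulDr mulDl mulI VV.
apply: psd_conj; apply: psd_diag => a.
have : l a ^+ 2 <= 1.
  by apply: le_trans f1; rewrite el (bigD1 a) //= lerDl sumr_ge0 // => i _; apply: sqr_ge0.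
move: (l a) => x; nra.
Qed.

Lemma sqrt_tangent (N x : R) : 0 < N -> 0 <= N ^+ 2 + x -> Num.sqrt (N ^+ 2 + x) <= N + x / (2 * N).
Proof.
move=> N0 h; have e : N + x / (2 * N) = (N ^+ 2 + (N ^+ 2 + x)) / (2 * N) by field; rewrite gt_eqF.
rewrite e ler_pdivlMr ?mulr_gt0 //.
have := sqr_sqrtr h; have := sqrtr_ge0 (N ^+ 2 + x); move: (Num.sqrt _) => s s0 hs.
have := sqr_ge0 (s - N); rewrite sqrrB; lra.
Qed.

Variables (A E : finType).
Local Notation pv := (pov R).
Local Notation Kt := (E + {ffun E -> bool} * {ffun E -> bool})%type.
Local Notation AE := (A * E)%type.

Lemma blkB (X Z : rop AE AE) v : blk (X - Z) v = blk X v - blk Z v.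
Proof.
apply: ropP => a a'; rewrite ropB /blk -sumrB; apply: eq_bigr => c _; rewrite -sumrB.
by apply: eq_bigr => c' _; rewrite ropB mulrBr mulrBl.
Qed.
Lemma blkD (X Z : rop AE AE) v : blk (X + Z) v = blk X v + blk Z v.
Proof.
apply: ropP => a a'; rewrite ropD /blk -big_split; apply: eq_bigr => c _; rewrite -big_split.
by apply: eq_bigr => c' _; rewrite ropD mulrDr mulrDl.
Qed.
Lemma blkZ t (X : rop AE AE) v : blk (t *: X) v = t *: blk X v.
Proof.
apply: ropP => a a'; rewrite ropZ /blk mulr_sumr; apply: eq_bigr => c _; rewrite mulr_sumr.
by apply: eq_bigr => c' _; rewrite ropZ; ring.
Qed.
Lemma blk_contr (X : op R AE) v : blk (X : rop AE AE) v = contr X (outer v).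
Proof.
apply: ropP => a a'; rewrite /blk /contr; apply: eq_bigr => c _; apply: eq_bigr => c' _.
rewrite /outer; ring.
Qed.
Lemma psd_blk (X : op R AE) v : psd X -> psd (blk (X : rop AE AE) v).
Proof. by move=> pX; rewrite blk_contr; apply: psd_contr => //; apply: psd_outer. Qed.
Lemma blk_ct (X : rop AE AE) v : X^H = X -> (blk X v)^H = blk X v.
Proof.
move=> hX; apply: ropP => a a'; rewrite /ct /blk rmorph_sum exchange_big /=.
apply: eq_bigr => c _; rewrite rmorph_sum; apply: eq_bigr => c' _ /=.
rewrite !rmorphM /= conjCK.
have -> : (X (a', c) (a, c'))^* = X (a, c') (a', c) by rewrite -[in RHS]hX.
ring.
Qed.
Lemma sum_outer_pov : \sum_(k : Kt) (outer (pv k) : rop E E) = id1.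
Proof. by apply: ropP => c c'; rewrite rop_sum /outer pov_complete. Qed.
Lemma blk_tr (X : op R AE) : \sum_(k : Kt) rtr (blk (X : rop AE AE) (pv k)) = rtr (X : rop AE AE).
Proof.
under eq_bigr do rewrite blk_contr rtr_contr.
by rewrite -rtr_sum -mul_sumr -kron_sumr sum_outer_pov kron1 mulI.
Qed.
Lemma fn_blk_state (X : op R AE) (k : Kt) : state X -> fn (blk (X : rop AE AE) (pv k)) <= 1.
Proof.
move=> hX; have pX := proj1 hX; apply: (le_trans (fn_psd_le (psd_blk (pv k) pX))).
have h0 := rtr_ge0 (psd_blk (pv k) pX).
have : rtr (blk (X : rop AE AE) (pv k)) <= 1.
  rewrite -(state_rtr hX) -blk_tr (bigD1 k) //= lerDl sumr_ge0 // => j _.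
  exact: rtr_ge0 (psd_blk _ pX).
by move=> h1; rewrite expr_le1.
Qed.

Lemma sep_convex (s t : op R AE) (x : R) : 0 <= x <= 1 -> separable s -> separable t ->
  separable (toC (1 - x) *: (s : rop AE AE) + toC x *: (t : rop AE AE)).
Proof.
move=> /andP[x0 x1] hs ht; apply: sepcone_sep.
  by apply: sepconeD; apply: sepconeZ; rewrite ?subr_ge0 //; apply: sep_sepcone.
by rewrite rtrD !rtrZ (state_rtr (sep_state hs)) (state_rtr (sep_state ht)); lra.
Qed.

(* Take s nearly minimising the smoothed norm \sum_k sqrt (eps^2 + |Z_k|^2), with Z_k
   the blocks of rho - s.  The gradient at s, a family of operators of norm at most 1,
   separates rho from the separable states; W_k is its image under x -> (1 + x) / 2. *)
Lemma separation (rho : op R AE) (m : R) : state rho -> 0 < m ->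
  (forall s, separable s -> m <= nm ((rho : rop AE AE) - s)) ->
  exists W : Kt -> op R A, [/\ forall k, psd (W k), forall k, psd ((id1 : rop A A) - W k) &
    forall s, separable s ->
     \sum_k rtr (blk (s : rop AE AE) (pv k) ** W k)
       <= \sum_k rtr (blk (rho : rop AE AE) (pv k) ** W k) - m / 288].
Proof.
move=> hr m0 hm; have hrH := psd_herm (proj1 hr).
pose Kn : R := #|{: Kt}|%:R.
have Kn0 : 0 < Kn.
  have [[a0 e0] _] := state_ex hr; rewrite ltr0n; apply/card_gt0P; by exists (inl e0).
have p288 : 0 < 288 :> R by rewrite ltr0n.
(* Smoothing over all [Kn] outcomes costs m / 288 in total. The budget is m / 72 = 4 m / 288 from
   the frame: one share for smoothing, one for approximate minimality, and half of the remaining two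
   survives the map x -> (1 + x) / 2. *)
pose ep := m / (288 * Kn); have ep0 : 0 < ep by rewrite (divr_gt0 m0 (mulr_gt0 p288 _)).
pose cc := 1 + 2 * Kn / ep.
have cc0 : 1 <= cc.
  have : 0 < 2 * Kn / ep by rewrite divr_gt0 // mulr_gt0.
  rewrite /cc; lra.
(* Step length of the variation, small enough that both the slack of the near-minimiser and the
   second-order term, of size [tau * cc] after division by tau, cost at most m / 288. *)
pose tau := Num.min 1 (m / (288 * cc)).
have cc1 : 0 < cc by lra.
have t0 : 0 < tau by rewrite lt_min ltr01 (divr_gt0 m0 (mulr_gt0 p288 (lt_le_trans ltr01 cc0))).
have t1 : tau <= 1 by rewrite ge_min lexx.
have tc : tau * cc <= m / 288.
  apply: (@le_trans _ _ (m / (288 * cc) * cc)).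
    by rewrite ler_pM2r // ge_min lexx orbT.
  by rewrite le_eqVlt; apply/orP; left; apply/eqP; field; rewrite gt_eqF.
pose Z (s : op R AE) (k : Kt) : rop A A := blk ((rho : rop AE AE) - s) (pv k).
pose F (s : op R AE) := \sum_k Num.sqrt (ep ^+ 2 + fn (Z s k)).
have F0 s : 0 <= F s by apply: sumr_ge0 => k _; apply: sqrtr_ge0.
(* The slack tau^2 is of second order in the step. It avoids a compactness argument for the
   existence of a minimiser. *)
have [s [hs hmin]] : exists s, separable s /\ forall s', separable s' -> F s <= F s' + tau ^+ 2.
  pose S : set R := [set r | exists s, separable s /\ r = F s]%classic.
  have hlb : has_lbound S by exists 0 => _ [s [_ ->]].
  have hS : has_inf S.
    split=> //; have [r [s [hs _]] _] := ERset_mixed hr.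
    by exists (F s), s.
  have t2 : 0 < tau ^+ 2 by apply: exprn_gt0.
  have [_ [s [hs ->]] hlt] := inf_adherent t2 hS.
  exists s; split=> // s' hs'; apply: (le_trans (ltW hlt)); rewrite lerD2r.
  by apply: ge_inf => //; exists s'.
pose N k := Num.sqrt (ep ^+ 2 + fn (Z s k)).
have N2 k : N k ^+ 2 = ep ^+ 2 + fn (Z s k) by rewrite sqr_sqrtr // addr_ge0 ?fn_ge0 ?sqr_ge0.
have Nep k : ep <= N k.
  by rewrite -[ep]ger0_norm ?(ltW ep0) // -sqrtr_sqr ler_wsqrtr // lerDl fn_ge0.
have N0 k : 0 < N k by apply: lt_le_trans (Nep k).
have ZH s' k : separable s' -> (Z s' k)^H = Z s' k.
  move=> h'; apply: blk_ct; rewrite ctB hrH; congr (_ - _).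
  by apply: psd_herm; case: (sep_state h').
pose U k : rop A A := toC (N k)^-1 *: Z s k.
have UH k : (U k)^H = U k by rewrite ctZ conj_toC ZH.
have fU k : fn (U k) <= 1.
  rewrite fnZ sqn_toC exprVn mulrC ler_pdivrMr ?exprn_gt0 // mul1r N2 lerDr; exact: sqr_ge0.
(* Approximate first-order optimality: s moves towards s' by tau, the square root is bounded by its
   tangent, and the result is divided by tau. *)
have key s' : separable s' -> - (tau * cc) <= \sum_k ip (U k) (Z s' k - Z s k).
  move=> h'; pose V k := Z s' k - Z s k.
  have VE k : V k = blk (s : rop AE AE) (pv k) - blk (s' : rop AE AE) (pv k).
    rewrite /V /Z -blkB -blkB; congr blk; apply: ropP => x y; rewrite !ropE; ring.
  have fV k : fn (V k) <= 4.
    have h1 := fn_blk_state k (sep_state hs); have h2 := fn_blk_state k (sep_state h').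
    rewrite VE fnB; have := ip_le (blk (s : rop AE AE) (pv k)) (- blk (s' : rop AE AE) (pv k)).
    have -> : fn (- blk (s' : rop AE AE) (pv k)) = fn (blk (s' : rop AE AE) (pv k)).
      by rewrite -scaleN1r fnZ sqnN sqn1 mul1r.
    rewrite ipNr; lra.
  have hc := sep_convex (introT andP (conj (ltW t0) t1)) hs h'.
  have := hmin _ hc.
  have FE : F (toC (1 - tau) *: (s : rop AE AE) + toC tau *: (s' : rop AE AE)) =
     \sum_k Num.sqrt (N k ^+ 2 + (2 * tau * ip (Z s k) (V k) + tau ^+ 2 * fn (V k))).
    apply: eq_bigr => k _; congr Num.sqrt; rewrite N2 -addrA; congr (_ + _).
    have -> : Z (toC (1 - tau) *: (s : rop AE AE) + toC tau *: (s' : rop AE AE)) k = Z s k + toC tau *: V k.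
      rewrite VE /Z -blkB -blkZ -blkD; congr blk; apply: ropP => x y.
      rewrite !ropE rmorphB rmorph1 /=; ring.
    rewrite fnD fnZ sqn_toC ipZr; ring.
  rewrite FE => h.
  have pt k : Num.sqrt (N k ^+ 2 + (2 * tau * ip (Z s k) (V k) + tau ^+ 2 * fn (V k))) <=
     N k + tau * ip (U k) (V k) + tau ^+ 2 * (2 / ep).
    apply: (le_trans (sqrt_tangent (N0 k) _)).
      have -> : N k ^+ 2 + (2 * tau * ip (Z s k) (V k) + tau ^+ 2 * fn (V k)) = ep ^+ 2 + fn (Z s k + toC tau *: V k).
        rewrite N2 fnD fnZ sqn_toC ipZr; ring.
      by rewrite addr_ge0 ?sqr_ge0 ?fn_ge0.
    rewrite -addrA lerD2l ipZl.
    have -> : (2 * tau * ip (Z s k) (V k) + tau ^+ 2 * fn (V k)) / (2 * N k) =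
      tau * ((N k)^-1 * ip (Z s k) (V k)) + tau ^+ 2 * (fn (V k) / (2 * N k)).
      by field; rewrite gt_eqF.
    rewrite lerD2l; apply: ler_wpM2l; first exact: sqr_ge0.
    rewrite ler_pdivrMr ?mulr_gt0 //.
    apply: (le_trans (fV k)).
    have -> : 2 / ep * (2 * N k) = 4 * (N k / ep) by field; rewrite gt_eqF.
    by rewrite ler_peMr // ler_pdivlMr // mul1r.
  have hsum := ler_sum (index_enum Kt) (fun k (_ : true) => pt k).
  rewrite !big_split /= sumr_const -mulr_sumr in hsum.
  have eF : F s = \sum_k N k by [].
  have e2 : tau ^+ 2 * (2 / ep) *+ #|xpredT : pred Kt| = tau * (tau * (2 * Kn / ep)).
    rewrite -[LHS]mulr_natr -/Kn; ring.
  have hk : - (tau * (tau * cc)) <= tau * \sum_k ip (U k) (V k).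
    move: h hsum; rewrite e2 eF; set a := \sum_k N k; set b := \sum_k Num.sqrt _; set c := \sum_k ip _ _.
    rewrite /cc => h1 h2; have -> : tau * (tau * (1 + 2 * Kn / ep)) = tau ^+ 2 + tau * (tau * (2 * Kn / ep)) by ring.
    lra.
  by move: hk; rewrite -mulrN ler_pM2l.
exists (fun k => toC 2^-1 *: ((id1 : rop A A) + U k)); split.
- by move=> k; apply: psdZ; [lra|apply: unit_ball_psd].
- move=> k; have -> : (id1 : rop A A) - toC 2^-1 *: (id1 + U k) = toC 2^-1 *: (id1 + - U k).
    have h2 z : z = toC 2^-1 * z + toC 2^-1 * z.
      rewrite -mulrDl -rmorphD /=; have -> : 2^-1 + 2^-1 = 1 :> R by field.
      by rewrite rmorph1 mul1r.
    by apply: ropP => x y; rewrite !ropE [X in X - _ = _]h2; ring.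
  apply: psdZ; first lra; apply: unit_ball_psd; first by rewrite ctN UH.
  by rewrite -scaleN1r fnZ sqnN sqn1 mul1r.
move=> s' h'.
have trW (X : op R AE) : state X -> \sum_k rtr (blk (X : rop AE AE) (pv k) ** (toC 2^-1 *: ((id1 : rop A A) + U k)))
   = 2^-1 * (1 + \sum_k ip (U k) (blk (X : rop AE AE) (pv k))).
  move=> hX; rewrite -(state_rtr hX) -blk_tr -big_split mulr_sumr; apply: eq_bigr => k _ /=.
  by rewrite mulZr rtrZ mulDr mulI rtrD /ip UH [in RHS]rtrC.
rewrite (trW _ (sep_state h')) (trW _ hr).
have := key s' h'.
have -> : \sum_k ip (U k) (Z s' k - Z s k) = \sum_k ip (U k) (blk (rho : rop AE AE) (pv k)) - \sum_k ip (U k) (blk (s' : rop AE AE) (pv k)) - \sum_k ip (U k) (Z s k).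
  rewrite -!sumrB; apply: eq_bigr => k _; rewrite ipBr {1}/Z blkB ipBr //.
(* Pairing the gradient with Z itself gives |Z_k|^2 / N_k >= |Z_k| - ep, and the frame bound sums
   these norms. *)
have hZ : m / 72 - Kn * ep <= \sum_k ip (U k) (Z s k).
  have h1 : m <= 72 * \sum_k nm (Z s k).
    apply: (le_trans (hm s hs)); apply: pov_nm; rewrite ctB hrH; congr (_ - _).
    by apply: psd_herm; case: (sep_state hs).
  have pt k : nm (Z s k) - ep <= ip (U k) (Z s k).
    rewrite ipZl -fn_ip mulrC ler_pdivlMr //.
    have := nm_ge0 (Z s k); have := N2 k; rewrite -nm2; move: (nm _) (N k) (N0 k) => x y y0 hy x0.
    have : y <= x + ep by rewrite -ler_sqr ?nnegrE ?addr_ge0 ?(ltW y0) ?(ltW ep0) //; nra.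
    nra.
  have := ler_sum (index_enum Kt) (fun k (_ : true) => pt k).
  rewrite sumrB sumr_const -[_ *+ _]mulr_natl -/Kn.
  lra.
have eK : Kn * ep = m / 288 by rewrite /ep; field; rewrite gt_eqF.
rewrite eK in hZ; lra.
Qed.
End Separation.

(** * Regularization *)

Section Fekete.
Variable R : realType.

(** Fekete's lemma by Euclidean division: the remainder is at most the constant c, which division by
    n washes out. The quotients start at index 1, as in [ERinf]. *)
Lemma fekete (a : nat -> R) : (forall m n, a (m + n)%N <= a m + a n) -> (forall n, 0 <= a n) ->
  exists2 L : R, ((fun n : nat => a n.+1 / n.+1%:R) @ \oo --> L)%classic & 0 <= L <= a 1%N.
Proof.
move=> sub a0.
pose S : set R := [set r | exists n : nat, r = a n.+1 / n.+1%:R]%classic.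
have u0 n : 0 <= a n.+1 / n.+1%:R by rewrite divr_ge0.
have hlb : has_lbound S by exists 0 => _ [n ->].
have hS : has_inf S by split=> //; exists (a 1%N / 1); exists 0%N.
have lu n : inf S <= a n.+1 / n.+1%:R by apply: ge_inf => //; exists n.
exists (inf S); last first.
  apply/andP; split; first by apply: lb_le_inf; [exists (a 1%N / 1); exists 0%N|move=> _ [n ->]].
  by have := lu 0%N; rewrite divr1.
have hq m q r : a (q * m + r)%N <= q%:R * a m + a r.
  elim: q => [|q IH]; first by rewrite mul0n add0n mul0r add0r.
  rewrite mulSn -addnA; apply: (le_trans (sub _ _)).
  by rewrite -natr1 mulrDl mul1r; lra.
have h1 r : a r <= r%:R * a 1%N + a 0%N.
  by have := hq 1%N r 0%N; rewrite muln1 addn0.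
apply/cvgrPdist_le => e e0.
have e2 : 0 < e / 2 by rewrite divr_gt0.
have [_ [m ->] hm] := inf_adherent e2 hS.
pose c := m.+1%:R * a 1%N + a 0%N.
have c0 : 0 <= c by rewrite addr_ge0 // mulr_ge0.
near=> n.
rewrite distrC ger0_norm ?subr_ge0 // lerBlDl.
have Nn : c / (e / 2) <= n.+1%:R.
  apply: (@le_trans _ _ n%:R); last by rewrite ler_nat.
  near: n; exact: nbhs_infty_ger.
have n1 : 0 < n.+1%:R :> R by rewrite ltr0n.
have m1 : 0 < m.+1%:R :> R by rewrite ltr0n.
have am : a n.+1 <= (n.+1 %/ m.+1)%:R * a m.+1 + c.
  rewrite {1}(divn_eq n.+1 m.+1); apply: (le_trans (hq _ _ _)); rewrite lerD2l.
  apply: (le_trans (h1 _)); rewrite lerD2r; apply: ler_wpM2r => //.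
  by rewrite ler_nat ltnW // ltn_pmod.
have h2 : (n.+1 %/ m.+1)%:R * a m.+1 <= n.+1%:R * (a m.+1 / m.+1%:R).
  rewrite mulrCA mulrC; apply: ler_wpM2l => //.
  by rewrite ler_pdivlMr // -natrM ler_nat leq_trunc_div.
have h3 : c <= n.+1%:R * (e / 2) by rewrite -ler_pdivrMr.
rewrite ler_pdivrMr //.
have h4 : n.+1%:R * (a m.+1 / m.+1%:R) <= n.+1%:R * (inf S + e / 2) by rewrite ler_pM2l // ltW.
have -> : (inf S + e) * n.+1%:R = n.+1%:R * (inf S + e / 2) + n.+1%:R * (e / 2) by field.
apply: (le_trans am); apply: lerD => //; exact: (le_trans h2).
Unshelve. all: end_near.
Qed.
End Fekete.

(** * Subadditivity of E_R and the gain for its regularization *)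

Section Subadd.
Variable R : realType.
Local Notation C := R[i].
Local Notation toC := (real_complex R).
Local Notation rop := (rop R).
Local Notation "'id1'" := (@idop R _).
Implicit Types X Y Z : finType.

Lemma kron_diag X Y (l : X -> R) (m : Y -> R) :
  kron (diagop l) (diagop m) = diagop (fun p : X * Y => l p.1 * m p.2).
Proof.
apply: ropP => -[a b] [a' b']; rewrite /kron !diagopE xpair_eqE /= rmorphM /=.
by case: (a == a'); case: (b == b'); rewrite /= ?mul0r ?mulr0 // !mul1r.
Qed.
Lemma kron_spec X Y (a U : op R X) l (b V : op R Y) m : spec_decomp a U l -> spec_decomp b V m ->
  spec_decomp (kron (a : rop X X) (b : rop Y Y)) (kron (U : rop X X) (V : rop Y Y)) (fun p => l p.1 * m p.2).
Proof.
move=> ha hb; have [uU _] := ha; have [uV _] := hb.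
have uU' : U^H ** U = id1 by exact: uU. have uV' : V^H ** V = id1 by exact: uV.
split; first by rewrite /unitary -[opmul _ _]/((kron (U : rop X X) (V : rop Y Y))^H ** kron U V) kron_ct kronM uU' uV' kron1.
rewrite -[opmul _ _]/(kron (U : rop X X) (V : rop Y Y) ** diagop (fun p : X * Y => l p.1 * m p.2) ** (kron (U : rop X X) (V : rop Y Y))^H).
by rewrite -kron_diag kron_ct !kronM -(mfun_id ha) -(mfun_id hb).
Qed.
Lemma supp_kron1 X Y (a b : op R X) : supp_incl a b ->
  supp_incl (kron (a : rop X X) (id1 : rop Y Y)) (kron (b : rop X X) (id1 : rop Y Y)).
Proof.
move=> h v hv.
have e (d : op R X) p : opapply (kron (d : rop X X) (id1 : rop Y Y)) v p = opapply d (fun x => v (x, p.2)) p.1.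
  rewrite /opapply sum_pair; apply: eq_bigr => x _; rewrite (bigD1 p.2) //= /kron /idop eqxx mulr1 big1 ?addr0 //.
  by move=> y hy; rewrite eq_sym (negbTE hy) mulr0 mul0r.
apply/funext => p; rewrite e.
have hb : opapply b (fun x => v (x, p.2)) = (fun=> 0).
  apply/funext => x; have := congr1 (fun f => f (x, p.2)) hv; by rewrite e.
by rewrite (h _ hb).
Qed.
Lemma supp_1kron X Y (a b : op R Y) : supp_incl a b ->
  supp_incl (kron (id1 : rop X X) (a : rop Y Y)) (kron (id1 : rop X X) (b : rop Y Y)).
Proof.
move=> h v hv.
have e (d : op R Y) p : opapply (kron (id1 : rop X X) (d : rop Y Y)) v p = opapply d (fun y => v (p.1, y)) p.2.
  rewrite /opapply sum_pair (bigD1 p.1) //= [X in _ + X]big1 ?addr0; last first.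
    by move=> x hx; rewrite big1 // => y _; rewrite /kron /idop eq_sym (negbTE hx) !mul0r.
  by apply: eq_bigr => y _; rewrite /kron /idop eqxx mul1r.
apply/funext => p; rewrite e.
have hb : opapply b (fun y => v (p.1, y)) = (fun=> 0).
  apply/funext => y; have := congr1 (fun f => f (p.1, y)) hv; by rewrite e.
by rewrite (h _ hb).
Qed.
Lemma supp_kron X Y (a b : op R X) (a' b' : op R Y) : supp_incl a b -> supp_incl a' b' ->
  supp_incl (kron (a : rop X X) (a' : rop Y Y)) (kron (b : rop X X) (b' : rop Y Y)).
Proof.
move=> h h'; apply/suppP => S Z.
have e (c : op R X) (c' : op R Y) : kron (c : rop X X) (c' : rop Y Y) = kron (c : rop X X) id1 ** kron id1 (c' : rop Y Y).
  by rewrite kronM mul1 mulI.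
have e' (c : op R X) (c' : op R Y) : kron (c : rop X X) (c' : rop Y Y) = kron id1 (c' : rop Y Y) ** kron (c : rop X X) id1.
  by rewrite kronM mul1 mulI.
rewrite e -mulA => /((suppP _ _).1 (@supp_kron1 X Y a b h)); rewrite mulA -e e' -mulA.
by move=> /((suppP _ _).1 (@supp_1kron X Y _ _ h')); rewrite mulA -e'.
Qed.

Lemma log_prod_scalar (o r s o' r' s' : R) : 0 <= r -> 0 <= s -> 0 <= r' -> 0 <= s' ->
  (s = 0 -> o * r = 0) -> (s' = 0 -> o' * r' = 0) ->
  o * o' * (r * r' * (log2 (r * r') - log2 (s * s'))) =
  o * (r * (log2 r - log2 s)) * (o' * r') + o * r * (o' * (r' * (log2 r' - log2 s'))).
Proof.
move=> r0 s0 r0' s0' h h'.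
have [e|e] := eqVneq (o * r) 0.
  have -> : o * o' * (r * r' * (log2 (r * r') - log2 (s * s'))) = o * r * (o' * r' * (log2 (r * r') - log2 (s * s'))) by ring.
  by rewrite (mulrA o r) e !mul0r addr0.
have [e'|e'] := eqVneq (o' * r') 0.
  have -> : o * o' * (r * r' * (log2 (r * r') - log2 (s * s'))) = o' * r' * (o * r * (log2 (r * r') - log2 (s * s'))) by ring.
  by rewrite (mulrA o' r') e' !(mul0r, mulr0) addr0.
have rp : 0 < r by rewrite lt_def r0 andbT; apply: contra e => /eqP ->; rewrite mulr0.
have rp' : 0 < r' by rewrite lt_def r0' andbT; apply: contra e' => /eqP ->; rewrite mulr0.
have sp : 0 < s by rewrite lt_def s0 andbT; apply: contra e => /eqP/h ->.
have sp' : 0 < s' by rewrite lt_def s0' andbT; apply: contra e' => /eqP/h' ->.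
rewrite !log2M //; ring.
Qed.

(** Eigenvalues and overlaps multiply, and the logarithms add on every term of nonzero weight. *)
Lemma relent_kron X Y (a b : op R X) (a' b' : op R Y) : psd a -> psd b -> psd a' -> psd b' ->
  supp_incl a b -> supp_incl a' b' ->
  relent (kron (a : rop X X) (a' : rop Y Y)) (kron (b : rop X X) (b' : rop Y Y)) =
  relent a b * rtr (a' : rop Y Y) + rtr (a : rop X X) * relent a' b'.
Proof.
move=> /psd_spec[U [r [ha r0]]] /psd_spec[V [s [hb s0]]] /psd_spec[U' [r' [ha' r0']]] /psd_spec[V' [s' [hb' s0']]] h h'.
rewrite (relentE (kron_spec ha ha') (kron_spec hb hb')) (relentE ha hb) (relentE ha' hb') (rtr_spec ha) (rtr_spec ha').
have ro (Z : finType) (W W' : op R Z) (x : Z -> R) : unitary W -> unitary W' ->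
  \sum_i x i = \sum_i \sum_j ovl W W' i j * x i.
  by move=> uW uW'; apply: eq_bigr => i _; rewrite -mulr_suml ovl_row // mul1r.
rewrite (ro _ U V r (proj1 ha) (proj1 hb)) (ro _ U' V' r' (proj1 ha') (proj1 hb')).
rewrite sum_pair !mulr_suml -big_split; apply: eq_bigr => i _ /=.
rewrite !mulr_sumr -big_split; apply: eq_bigr => j _ /=.
rewrite sum_pair mulr_suml [X in _ = _ + X]mulr_suml -big_split; apply: eq_bigr => k _ /=.
rewrite !mulr_sumr -big_split; apply: eq_bigr => q _ /=.
have -> : ovl (kron (U : rop X X) (U' : rop Y Y)) (kron (V : rop X X) (V' : rop Y Y)) (i, j) (k, q) = ovl U V i k * ovl U' V' j q.
  by rewrite /ovl kron_ct kronM /kron /= sqnM.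
apply: log_prod_scalar => //.
  exact: (supp_spec h ha hb).
exact: (supp_spec h' ha' hb').
Qed.

Definition fsplit m n X (f : {ffun 'I_(m + n) -> X}) : {ffun 'I_m -> X} * {ffun 'I_n -> X} :=
  ([ffun j => f (lshift n j)], [ffun j => f (rshift m j)]).
Lemma fsplit_bij m n X : bijective (@fsplit m n X).
Proof.
exists (@fcat m n X) => [f|[f g]].
  apply/ffunP => i; rewrite ffunE; case: fintype.splitP => j e; rewrite ffunE; congr (f _); exact/val_inj.
by congr (_, _); apply/ffunP => i; rewrite ffunE ?fcat_l ?fcat_r.
Qed.
(** Regroups m + n copies into the first m and the last n, each again a bipartite system. *)
Definition hsplit m n X Y (p : {ffun 'I_(m + n) -> X} * {ffun 'I_(m + n) -> Y}) :=
  ((((fsplit p.1).1, (fsplit p.2).1) : {ffun 'I_m -> X} * {ffun 'I_m -> Y}),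
   (((fsplit p.1).2, (fsplit p.2).2) : {ffun 'I_n -> X} * {ffun 'I_n -> Y})).
Lemma hsplit_bij m n X Y : bijective (@hsplit m n X Y).
Proof.
have [k hk kh] := fsplit_bij m n X; have [k' hk' kh'] := fsplit_bij m n Y.
exists (fun q => (k (q.1.1, q.2.1), k' (q.1.2, q.2.2))) => [[f g]|[[a b] [c d]]].
  by congr (_, _); [exact: (hk f)|exact: (hk' g)].
by rewrite /hsplit; cbn [fst snd]; rewrite kh kh'.
Qed.
Lemma tpow_split m n X Y (rho : op R (X * Y)%type) :
  @tpow R X Y (m + n) rho = reidx (@hsplit m n X Y) (kron (@tpow R X Y m rho : rop _ _) (@tpow R X Y n rho : rop _ _)).
Proof.
apply: ropP => p q; rewrite /tpow /reidx /kron /hsplit /= big_split_ord; congr (_ * _);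
  by apply: eq_bigr => i _; rewrite !ffunE.
Qed.

Lemma sepcone_hsplit m n X Y (s : op R ({ffun 'I_m -> X} * {ffun 'I_m -> Y})%type)
   (t : op R ({ffun 'I_n -> X} * {ffun 'I_n -> Y})%type) :
  sepcone s -> sepcone t -> sepcone (reidx (@hsplit m n X Y) (kron (s : rop _ _) (t : rop _ _))).
Proof.
move=> [K [a [b [pa pb ->]]]] [K' [a' [b' [pa' pb' ->]]]].
exists (K * K')%type, (fun k => reidx (@fsplit m n X) (tensor (a k.1) (a' k.2))),
   (fun k => reidx (@fsplit m n Y) (tensor (b k.1) (b' k.2))); split.
- by move=> k; apply: psd_reidx; apply: psd_tensor.
- by move=> k; apply: psd_reidx; apply: psd_tensor.
apply: ropP => p q; rewrite rop_sum sum_pair /reidx /kron !rop_sum mulr_suml; apply: eq_bigr => k _.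
rewrite mulr_sumr; apply: eq_bigr => k' _.
rewrite /tensor /hsplit /=; ring.
Qed.

(** The product of nearly optimal separable states for m and n copies, regrouped by parties, is an
    admissible state for m + n copies. *)
Lemma ER_subadd m n X Y (rho : op R (X * Y)%type) : state rho ->
  ER (@tpow R X Y (m + n) rho) <= ER (@tpow R X Y m rho) + ER (@tpow R X Y n rho).
Proof.
move=> hr; apply/ler_addgt0Pr => e e0; have e2 : 0 < e / 2 by rewrite divr_gt0.
have sm := state_tpow m hr; have sn := state_tpow n hr.
have [_ [s [hs [hs1 ->]]] h1] := ER_approx sm e2.
have [_ [t [ht [ht1 ->]]] h2] := ER_approx sn e2.
have ss := sep_state hs; have st := sep_state ht.
set r1 := @tpow R X Y m rho in sm hs1 h1 *; set r2 := @tpow R X Y n rho in sn ht1 h2 *.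
have bh := hsplit_bij m n X Y.
pose k : op R _ := kron (s : rop _ _) (t : rop _ _).
have sk : state k.
  split; first by apply: (psd_tensor (proj1 ss) (proj1 st)).
  by rewrite -[tr k]/(tr (tensor s t)) tr_tensor (proj2 ss) (proj2 st) mulr1.
have skr : psd (kron (r1 : rop _ _) (r2 : rop _ _)) by apply: (psd_tensor (proj1 sm) (proj1 sn)).
have hle : ER (@tpow R X Y (m + n) rho) <= relent (@tpow R X Y (m + n) rho) (reidx (@hsplit m n X Y) k).
  apply: ER_le; first exact: state_tpow.
  exists (reidx (@hsplit m n X Y) k); split.
    apply: sepcone_sep; first by apply: sepcone_hsplit; apply: sep_sepcone.
    exact: state_rtr (state_reidx bh sk).
  split=> //; rewrite tpow_split; apply: supp_reidx => //; exact: supp_kron.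
apply: (le_trans hle); rewrite tpow_split relent_reidx //; last 2 first.
- by case: skr.
- by case: sk => [[]].
rewrite /k relent_kron //; [|by case: sm|by case: ss|by case: sn|by case: st].
rewrite (state_rtr sm) (state_rtr sn); lra.
Qed.

Lemma ER_tpow1 X Y (rho : op R (X * Y)%type) : state rho -> ER (@tpow R X Y 1 rho) <= ER rho.
Proof.
move=> hr.
have cb (Z : finType) : bijective (fun f : {ffun 'I_1 -> Z} => f ord0).
  exists (fun z : Z => [ffun _ : 'I_1 => z]) => [f|z]; last by rewrite ffunE.
  by apply/ffunP => i; rewrite ffunE (ord1 i).
have := ER_reidx (cb X) (cb Y) hr.
have -> // : reidx (fun p : {ffun 'I_1 -> X} * {ffun 'I_1 -> Y} => (p.1 ord0, p.2 ord0)) rho = @tpow R X Y 1 rho.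
by apply: ropP => p q; rewrite /reidx /tpow big_ord1.
Qed.

Lemma ERinf_cvg X Y (rho : op R (X * Y)%type) : state rho ->
  ((fun n : nat => ER (@tpow R X Y n.+1 rho) / n.+1%:R : R) @ \oo --> ERinf rho)%classic /\
  0 <= ERinf rho <= ER rho.
Proof.
move=> hr.
have [L tensn_complete /andP[L0 L1]] := @fekete R (fun n => ER (@tpow R X Y n rho))
  (fun m n => ER_subadd m n hr) (fun n => ER_ge0 (state_tpow n hr)).
have -> : ERinf rho = L by apply/cvg_lim.
by split=> //; rewrite L0 (le_trans L1) // ER_tpow1.
Qed.

(** Divided by the number of copies, [ncopy] loses its additive terms in the limit and leaves a
    bound with factor 1 + dd for each fixed dd > 0. Only afterwards does dd tend to 0, since the
    losses involve dd^-1. *)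
Lemma ERinf_main X Y B (K : finType) (l : K -> rop B Y) (W : K -> op R X) (rho : op R (X * Y)%type) (d : R) :
  \sum_k (l k)^H ** l k = id1 -> (forall k, psd (W k)) -> (forall k, psd ((id1 : rop X X) - W k)) ->
  state rho -> 0 < d <= 1 -> (forall s, separable s -> acc l W s <= acc l W rho - d) ->
  ERinf (measured l rho) + d ^+ 2 / 32 / ln 2 <= ERinf rho.
Proof.
move=> hl pW pW1 hr hd hsep; have l2 := @ln2_gt0 R.
have sm := state_measured hl hr.
set kap := d ^+ 2 / 32; have k0 : 0 < kap by rewrite divr_gt0 // exprn_gt0 //; case/andP: hd.
have [c1 _] := ERinf_cvg hr; have [c2 _] := ERinf_cvg sm.
set Lg := log2 (#|X| * #|B|)%:R : R.
have Lg0 : 0 <= Lg.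
  rewrite /Lg /log2; case: ifP => // h0; rewrite divr_ge0 ?(ltW l2) // ln_ge0 // ler1n.
  by rewrite -(ltr0n R).
have step (dd : R) : 0 < dd -> ERinf (measured l rho) <= (1 + dd) * (ERinf rho - kap / ln 2).
  move=> dd0.
  pose cs := (1 + dd) / ln 2 + (1 + dd^-1) * (Lg / kap) + gentle_cst dd.
  have di : 0 < dd^-1 by rewrite invr_gt0.
  have pt n : ER (@tpow R X B n.+1 (measured l rho)) / n.+1%:R <=
     (1 + dd) * (ER (@tpow R X Y n.+1 rho) / n.+1%:R - kap / ln 2) + cs * harmonic n.
    have n0 : 0 < n.+1%:R :> R by rewrite ltr0n.
    have h := @ncopy R X Y B K l W rho hl pW pW1 hr d hd hsep n.+1 dd isT dd0.
    rewrite -/kap in h; set q := expR _ in h.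
    have nk : 0 < n.+1%:R * kap by rewrite mulr_gt0.
    have q0 : 0 < q by apply: expR_gt0.
    (* The error probability decays faster than the terms linear in n grow, so their product stays
       bounded. *)
    have hq : q * (n.+1%:R * kap) <= 1.
      rewrite /q expRN mulrC ler_pdivrMr ?expR_gt0 // mul1r.
      by have := expR_ge1Dx (n.+1%:R * kap); lra.
    rewrite ler_pdivrMr //; apply: (le_trans h).
    have -> : ((1 + dd) * (ER (@tpow R X Y n.+1 rho) / n.+1%:R - kap / ln 2) + cs * harmonic n) * n.+1%:R
      = (1 + dd) * ER (@tpow R X Y n.+1 rho) - (1 + dd) * (n.+1%:R * kap / ln 2) + cs.
      by rewrite /harmonic /=; field; rewrite !gt_eqF.
    have b1 : (1 + dd) * (q * (n.+1%:R * kap / ln 2)) <= (1 + dd) / ln 2.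
      rewrite ler_pM2l; last by lra.
      rewrite mulrA -[X in _ <= X]mul1r ler_pM2r ?invr_gt0 //.
    have b2 : (1 + dd^-1) * q * (n.+1%:R * Lg) <= (1 + dd^-1) * (Lg / kap).
      rewrite -mulrA ler_pM2l; last by lra.
      rewrite ler_pdivlMr //.
      have -> : q * (n.+1%:R * Lg) * kap = q * (n.+1%:R * kap) * Lg by ring.
      by rewrite -[X in _ <= X]mul1r; apply: ler_wpM2r.
    rewrite /cs -/Lg mulrBr mulrBl mul1r mulrBr; lra.
  have cg : ((fun n : nat => (1 + dd) * (ER (@tpow R X Y n.+1 rho) / n.+1%:R - kap / ln 2) + cs * harmonic n : R) @ \oo
     --> (1 + dd) * (ERinf rho - kap / ln 2) + cs * 0)%classic.
    apply: cvgD.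
      by apply: cvgMr; apply: cvgB => //; apply: cvg_cst.
    by apply: cvgMr; apply: cvg_harmonic.
  rewrite mulr0 addr0 in cg.
  by apply: (ler_cvg_to c2 cg); near=> n; apply: pt.
  Unshelve. all: end_near.
rewrite -lerBrDr leNgt; apply/negP => hlt.
set x := ERinf rho - kap / ln 2 in step hlt; set y := ERinf _ in step hlt.
have x1 : 0 < `|x| + 1 by rewrite ltr_wpDl.
(* This dd raises x by at most half of y - x, whatever the sign of x, and so contradicts x < y. *)
have dd0 : 0 < (y - x) / 2 / (`|x| + 1) by rewrite !divr_gt0 // subr_gt0.
have := step _ dd0.
have : (y - x) / 2 / (`|x| + 1) * x <= (y - x) / 2.
  rewrite mulrAC ler_pdivrMr //; apply: ler_wpM2l; first by rewrite ltW // divr_gt0 // subr_gt0.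
  by have := ler_norm x; lra.
lra.
Qed.
End Subadd.

(** * Reduced states *)

Section LocalMaps.
Variable R : realType.
Local Notation C := R[i].
Local Notation toC := (real_complex R).
Local Notation rop := (rop R).
Local Notation "'id1'" := (@idop R _).

Section Instrument.
Variables (A Y Z K : finType) (l : K -> rop Z Y).
Hypothesis hl : \sum_k (l k)^H ** l k = id1.

Lemma measured_entry (s : op R (A * Y)%type) p q :
  measured l s p q = \sum_k \sum_y \sum_y' l k p.2 y * s (p.1, y) (q.1, y') * (l k q.2 y')^*.
Proof.
rewrite /measured rop_sum; apply: eq_bigr => k _.
rewrite {1}/mul sum_pair (bigD1 q.1) //= [X in _ + X]big1 ?addr0; last first.
  move=> x hx; rewrite big1 // => y _; rewrite /ct /kron /idop /= eq_sym (negbTE hx) mul0r conjC0 mulr0 //.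
rewrite [RHS]exchange_big; apply: eq_bigr => y' _ /=.
rewrite /mul sum_pair (bigD1 p.1) //= [X in _ + X]big1 ?addr0; last first.
  move=> x hx; rewrite big1 // => y _; rewrite /kron /idop /= eq_sym (negbTE hx) !mul0r //.
rewrite mulr_suml; apply: eq_bigr => y _.
by rewrite /kron /ct /idop /= !eqxx !mul1r.
Qed.

Lemma measured_sep (s : op R (A * Y)%type) : separable s -> separable (measured l s).
Proof.
move=> hs; apply: sepcone_sep; last exact: state_rtr (state_measured hl (sep_state hs)).
by apply: sepcone_sum => k _; apply: sepcone_conj; apply: sep_sepcone.
Qed.

Lemma ER_measured (s : op R (A * Y)%type) : state s -> ER (measured l s) <= ER s.
Proof.
move=> hs; apply: lb_le_inf; first exact: ER_nonempty.
move=> r [t [ht [h ->]]]; have pt := proj1 (sep_state ht).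
have ps := proj1 hs.
apply: (@le_trans _ _ (relent (measured l s) (measured l t))).
  apply: ER_le; first exact: state_measured.
  exists (measured l t); split; first exact: measured_sep.
  by split=> //; apply: conj_sum_supp.
have := @dpi R _ _ unit K s t (fun _ k => kron (id1 : rop A A) (l k)) _ ps pt h.
rewrite !sum_unit; apply.
under eq_bigr do rewrite kron_ct kronM ct1 mul1.
by rewrite -kron_sumr hl kron1.
Qed.
End Instrument.

(** Measuring each copy separately is a local measurement on the n copies, so monotonicity holds
    before the limit. *)
Lemma ERinf_measured (A Y Z K : finType) (l : K -> rop Z Y) (s : op R (A * Y)%type) :
  \sum_k (l k)^H ** l k = id1 -> state s -> ERinf (measured l s) <= ERinf s.
Proof.
move=> hl hs.
have [c1 _] := ERinf_cvg hs; have [c2 _] := ERinf_cvg (state_measured hl hs).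
apply: (ler_cvg_to c2 c1); apply: nearW => n.
rewrite ler_pM2r ?invr_gt0 ?ltr0n // -measured_tpow.
apply: ER_measured; last exact: state_tpow.
exact: tensn_complete.
Qed.

Variables A B E : finType.
Local Notation Kt := (E + {ffun E -> bool} * {ffun E -> bool})%type.
(** Measures E in the frame and keeps B. Once k is forgotten this is the partial trace over E, but
    the test on A may use k before that. *)
Let lB (k : Kt) : rop B (B * E)%type := fun b y => (b == y.1)%:R * (pov R k y.2)^*.
(** Reads B in the standard basis and keeps E, so forgetting b is the partial trace over B. *)
Let vE (b : B) : rop E (B * E)%type := fun c y => (b == y.1)%:R * (c == y.2)%:R.

Lemma lB_sq k : (lB k)^H ** lB k = kron (id1 : rop B B) (outer (pov R k) : rop E E).
Proof.
apply: ropP => -[b c] [b' c']; rewrite /mul (bigD1 b) //= [X in _ + X]big1 ?addr0; last first.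
  by move=> x hx; rewrite /ct /lB /= (negbTE hx) mul0r conjC0 mul0r.
by rewrite /ct /lB /kron /outer /= eqxx mul1r conjCK /idop mulrCA.
Qed.
Lemma lB_complete : \sum_k (lB k)^H ** lB k = id1.
Proof. by under eq_bigr do rewrite lB_sq; rewrite -kron_sumr sum_outer_pov kron1. Qed.
Lemma red_ABE (s : op R (A * (B * E))%type) : red_AB s = measured lB s.
Proof.
apply: ropP => -[a b] [a' b']; rewrite measured_entry /red_AB /=.
transitivity (\sum_c \sum_c' (\sum_k pov R k c' * (pov R k c)^*) * s (a, (b, c)) (a', (b', c'))).
  apply: eq_bigr => c _; rewrite (bigD1 c) //= [X in _ + X]big1 ?addr0; last first.
    by move=> c' hc; rewrite pov_complete (negbTE hc) mul0r.
  by rewrite pov_complete eqxx mul1r.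
transitivity (\sum_c \sum_k \sum_c' pov R k c' * (pov R k c)^* * s (a, (b, c)) (a', (b', c'))).
  by apply: eq_bigr => c _; rewrite exchange_big; apply: eq_bigr => c' _; rewrite mulr_suml.
rewrite exchange_big; apply: eq_bigr => k _ /=.
rewrite sum_pair (bigD1 b) //= [X in _ + X]big1 ?addr0; last first.
  by move=> x hx; rewrite big1 // => y _; rewrite big1 // => z _; rewrite /lB /= eq_sym (negbTE hx) !mul0r.
apply: eq_bigr => c _.
rewrite sum_pair (bigD1 b') //= [X in _ + X]big1 ?addr0; last first.
  by move=> x hx; rewrite big1 // => y _; rewrite /lB /= (eq_sym b') (negbTE hx) !mul0r conjC0 mulr0.
apply: eq_bigr => c' _; rewrite /lB /= !eqxx !mul1r conjCK; ring.
Qed.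

Lemma vE_complete : \sum_b (vE b)^H ** vE b = id1.
Proof.
apply: ropP => -[b c] [b' c']; rewrite rop_sum (bigD1 b) //= [X in _ + X]big1 ?addr0; last first.
  move=> x hx; rewrite /mul big1 // => y _; rewrite /ct /vE /= (negbTE hx) mul0r conjC0 mul0r //.
rewrite /mul (bigD1 c) //= [X in _ + X]big1 ?addr0; last first.
  by move=> x hx; rewrite /ct /vE /= (negbTE hx) mulr0 conjC0 mul0r.
by rewrite /ct /vE /= !eqxx mulr1 conjC1 mul1r /idop xpair_eqE -natrM mulnb.
Qed.
Lemma red_ACE (s : op R (A * (B * E))%type) : red_AC s = measured vE s.
Proof.
apply: ropP => -[a c] [a' c']; rewrite measured_entry /red_AC /=; apply: eq_bigr => b _.
rewrite (bigD1 (b, c)) //= [X in _ + X]big1 ?addr0; last first.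
  move=> -[x y] hx; rewrite big1 // => z _.
  by rewrite /vE /= -natrM mulnb -xpair_eqE eq_sym (negbTE hx) !mul0r.
rewrite (bigD1 (b, c')) //= [X in _ + X]big1 ?addr0; last first.
  move=> -[x y] hx.
  by rewrite /vE /= -[X in _ * X^*]natrM mulnb -xpair_eqE (eq_sym (b, c')) (negbTE hx) conjC0 mulr0.
by rewrite /vE /= !eqxx !mul1r conjC1 mulr1.
Qed.

(** The test leaves B alone, so acceptance depends on the marginal on AE only, through the frame
    blocks; it is the functional built in [separation]. *)
Lemma acc_lB (W : Kt -> op R A) (s : op R (A * (B * E))%type) :
  acc lB W s = \sum_k rtr (blk (red_AC s : rop _ _) (pov R k) ** W k).
Proof.
rewrite /acc; apply: eq_bigr => k _; rewrite lB_sq -contr_rtr; congr (rtr (_ ** _)).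
apply: ropP => a a'; rewrite /contr /blk /red_AC sum_pair exchange_big; apply: eq_bigr => c _ /=.
transitivity (\sum_b \sum_c' s (a, (b, c)) (a', (b, c')) * (pov R k c' * (pov R k c)^*)).
  apply: eq_bigr => b _; rewrite sum_pair (bigD1 b) //= [X in _ + X]big1 ?addr0; last first.
    by move=> x hx; rewrite big1 // => y _; rewrite /kron /idop /= (negbTE hx) mul0r mulr0.
  by apply: eq_bigr => c' _; rewrite /kron /idop /= eqxx mul1r.
rewrite exchange_big; apply: eq_bigr => c' _ /=.
rewrite mulr_sumr mulr_suml; apply: eq_bigr => b _; ring.
Qed.

Lemma state_red_AC (s : op R (A * (B * E))%type) : state s -> state (red_AC s).
Proof. by rewrite red_ACE; apply: state_measured; apply: vE_complete. Qed.
Lemma sep_red_AC (s : op R (A * (B * E))%type) : separable s -> separable (red_AC s).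
Proof. by rewrite red_ACE; apply: measured_sep; apply: vE_complete. Qed.
Lemma ERinf_red_AB (s : op R (A * (B * E))%type) : state s -> ERinf (red_AB s) <= ERinf s.
Proof. by rewrite red_ABE; apply: ERinf_measured; apply: lB_complete. Qed.

Lemma ERinf_gap (rho : op R (A * (B * E))%type) m : state rho -> 0 < m ->
  (forall s, separable s -> m <= nm ((red_AC rho : rop _ _) - s)) ->
  ERinf (red_AB rho) + (m / 288) ^+ 2 / 32 / ln 2 <= ERinf rho.
Proof.
move=> hr m0 hm; have [W [pW pW1 hW]] := separation (state_red_AC hr) m0 hm.
have hsep s : separable s -> acc lB W s <= acc lB W rho - m / 288.
  by move=> hs; rewrite !acc_lB; apply: hW; apply: sep_red_AC.
have m288 : 0 < m / 288 by rewrite (divr_gt0 m0) // ltr0n.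
rewrite red_ABE; apply: (@ERinf_main R _ _ _ _ lB W) => //; first exact: lB_complete.
(* Any separable state shows m / 288 <= 1, the gap being a difference of two acceptance
   probabilities. *)
have [_ [s [hs _]] _] := ER_approx hr (@ltr01 R).
have /andP[_ h1] := acc_bounds lB_complete pW pW1 hr.
have /andP[h0 _] := acc_bounds lB_complete pW pW1 (sep_state hs).
have := hsep _ hs; rewrite m288 /=; lra.
Qed.
End LocalMaps.

(** * The continuity estimate inverted, and the one-sided inequalities *)

Section Bounds.
Variable R : realType.
Local Notation rop := (rop R).
Variables A E : finType.
Local Notation lg := (log2 (minn #|A| #|E|)%:R : R).

(* When lg = 0 the quotient is x / 0 = 0, as in the theorem. *)
Definition sepgap (g x : R) : R := x `^ (2 / g) / (Cent g `^ (2 / g) * (#|{: A * E}|%:R * lg `^ (2 / g))).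

Lemma sepgap_ge0 g x : 0 <= sepgap g x.
Proof. by rewrite divr_ge0 // ?mulr_ge0 ?powR_ge0. Qed.

(** [EF_cont] raised to the power 2 / g: the distance appears squared and the square root of the
    dimension becomes the dimension. A free x below E_F lets E_R^oo use the same bound. *)
Lemma sepgap_le (r s : op R (A * E)%type) g x : state r -> separable s -> 0 < g -> g < 1 ->
  0 <= x -> x <= EF r -> sepgap g x <= fn ((r : rop _ _) - s).
Proof.
move=> hr hs g0 g1 x0 hx.
have p0 : 0 < 2 / g by rewrite divr_gt0.
have C0 : 0 < Cent g by apply: Cent_ge0.
rewrite -nm2 /sepgap.
have [hd|hd] := leqP (minn #|A| #|E|) 1.
  have -> : lg = 0.
    by move: hd; case: (minn _ _) => [|[|]] // _; rewrite ?log2_1 ?log2_0.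
  by rewrite powR0 ?gt_eqF // !mulr0 invr0 mulr0 sqr_ge0.
have L0 : 0 < lg.
  by rewrite /log2 ltr0n (ltn_trans _ hd) // divr_gt0 ?(@ln2_gt0 R) // ln_gt0 // ltr1n.
have h := le_trans hx (EF_cont hr hs (proj1 (sep_state hs)) hd g0 g1).
set N := #|{: A * E}|%:R in h *.
have N0 : 0 < N.
  by rewrite /N ltr0n card_prod muln_gt0; move: hd; rewrite leq_min => /andP[h1 h2]; rewrite !(ltn_trans _ h1) ?(ltn_trans _ h2).
set t := nm _ in h *; have t0 : 0 <= t by apply: nm_ge0.
have sN : 0 <= Num.sqrt N by apply: sqrtr_ge0.
have h2 : x `^ (2 / g) <= (Cent g * lg * (Num.sqrt N * t) `^ g) `^ (2 / g).
  by apply: ge0_ler_powR => //; rewrite ?nnegrE ?(ltW p0) // mulr_ge0 ?powR_ge0 // mulr_ge0 // ltW.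
rewrite ler_pdivrMr ?mulr_gt0 ?powR_gt0 //; apply: (le_trans h2).
have u0 : 0 <= Num.sqrt N * t by rewrite mulr_ge0.
set u := Num.sqrt N * t in u0 *.
rewrite powRM ?powR_ge0 ?mulr_ge0 ?(ltW C0) ?(ltW L0) // powRM ?(ltW C0) ?(ltW L0) //.
rewrite -powRrM (_ : g * (2 / g) = 2); last by field; rewrite gt_eqF.
by rewrite powR_mulrn // /u exprMn sqr_sqrtr ?(ltW N0) // le_eqVlt; apply/orP; left; apply/eqP; ring.
Qed.
End Bounds.

Section OneSided.
Variable R : realType.
Local Notation rop := (rop R).
Variables A B E : finType.

Lemma EF_sepgap (rho : op R (A * (B * E))%type) g : state rho -> 0 < g -> g < 1 ->
  EF (red_AB rho) + sepgap A E g (EF (red_AC rho)) / (4 * ln 2 * 72 ^+ 2) <= EF rho.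
Proof.
move=> hr g0 g1; apply: lb_le_inf; first exact: EFset_nonempty.
move=> r /(EF_main hr)[s hs hle]; apply: le_trans hle; rewrite lerD2l.
rewrite ler_pM2r; last by rewrite invr_gt0 !mulr_gt0 ?(@ln2_gt0 R).
have h := state_red_AC hr.
by apply: sepgap_le => //; apply: EF_ge0.
Qed.

Lemma ERinf_sepgap (rho : op R (A * (B * E))%type) g : state rho -> 0 < g -> g < 1 ->
  ERinf (red_AB rho) + sepgap A E g (ERinf (red_AC rho)) / (288 ^+ 2 * 32 * ln 2) <= ERinf rho.
Proof.
move=> hr g0 g1; have h := state_red_AC hr.
have [_ /andP[e0 e1]] := ERinf_cvg h.
have e2 : ERinf (red_AC rho) <= EF (red_AC rho) by apply: (le_trans e1); apply: ER_le_EF.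
set q := sepgap _ _ _ _; have q0 : 0 <= q by apply: sepgap_ge0.
(* A zero gap yields no test, and monotonicity of E_R^oo under the partial trace gives the claim;
   otherwise sqrt q is the distance fed to [ERinf_gap]. *)
have [->|qn] := eqVneq q 0; first by rewrite mul0r addr0; apply: ERinf_red_AB.
have qp : 0 < q by rewrite lt_def qn.
have := @ERinf_gap R A B E rho (Num.sqrt q) hr.
rewrite sqrtr_gt0 qp expr_div_n sqr_sqrtr // => /(_ isT) hg.
apply: le_trans (hg _); last first.
  move=> s hs; rewrite -ler_sqr ?nnegrE ?sqrtr_ge0 ?nm_ge0 // sqr_sqrtr // nm2.
  by apply: sepgap_le.
by rewrite lerD2l !invfM !mulrA.
Qed.
End OneSided.

(** * Exchange of B and C, and the final constants *)

Section Swap.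
Variable R : realType.
Variables A B E : finType.
Definition swapBC (rho : op R (A * (B * E))%type) : op R (A * (E * B))%type :=
  reidx (fun p => (p.1, (p.2.2, p.2.1))) rho.

Lemma bij_ffun (S T : finType) n (f : S -> T) : bijective f ->
  bijective (fun u : {ffun 'I_n -> S} => [ffun i => f (u i)]).
Proof.
move=> [k hk kh]; exists (fun u : {ffun 'I_n -> T} => [ffun i => k (u i)]) => u;
  by apply/ffunP => i; rewrite !ffunE ?hk ?kh.
Qed.
Lemma state_swapBC rho : state rho -> state (swapBC rho).
Proof. by apply: state_reidx; apply: bij_pair (bijective_id A) (swap_bij E B). Qed.
Lemma EF_swapBC rho : state rho -> EF (swapBC rho) <= EF rho.
Proof.
move=> hr; apply: lb_le_inf; first exact: EFset_nonempty.
move=> r h; apply: EF_le; exact: (EFset_reidx (swap_bij E B) h).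
Qed.
Lemma ERinf_swapBC rho : state rho -> ERinf (swapBC rho) <= ERinf rho.
Proof.
move=> hr; have [c1 _] := ERinf_cvg hr; have [c2 _] := ERinf_cvg (state_swapBC hr).
apply: (ler_cvg_to c2 c1); apply: nearW => n.
rewrite ler_pM2r ?invr_gt0 ?ltr0n //.
have := ER_reidx (bijective_id {ffun 'I_n.+1 -> A}) (bij_ffun n.+1 (swap_bij E B)) (state_tpow n.+1 hr).
rewrite (_ : reidx _ _ = @tpow R A (E * B)%type n.+1 (swapBC rho)) //.
apply: ropP => p q; rewrite /reidx /tpow; apply: eq_bigr => i _.
by rewrite !ffunE.
Qed.
End Swap.

Lemma sepgapE (R : realType) (m n : nat) (p x f : R) : p != 0 ->
  sepgap 'I_m 'I_n (2 / p) x / f =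
  (Cent (2 / p) `^ p)^-1 / f * x `^ p / (m%:R * n%:R * log2 (minn m n)%:R `^ p).
Proof.
move=> p0; rewrite /sepgap card_prod !card_ord natrM.
have -> : 2 / (2 / p) = p by rewrite invfM invrK mulVKf.
rewrite invfM mulrA [_ * x `^ p]mulrC mulrA; exact: mulrAC.
Qed.

Theorem theorem3 (R : realType) (eta eta' : R) :
  0 < eta -> 0 < eta' ->
  exists c c' : R, 0 < c /\ 0 < c' /\
  forall (dA dB dC : nat) (rho : op R ('I_dA * ('I_dB * 'I_dC))%type),
    state rho ->
    let dAB := minn dA dB in
    let dAC := minn dA dC in
    let rAB := red_AB rho in
    let rAC := red_AC rho in
    let lAB := log2 dAB%:R in
    let lAC := log2 dAC%:R in
    let dA' : R := dA%:R in
    let dB' : R := dB%:R in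
    let dC' : R := dC%:R in
    EF rho >= Num.max
      (EF rAB + c * EF rAC `^ (4 + eta) / (dA' * dC' * lAC `^ (4 + eta)))
      (EF rAC + c * EF rAB `^ (4 + eta) / (dA' * dB' * lAB `^ (4 + eta)))
    /\
    ERinf rho >= Num.max
      (ERinf rAB + c' * ERinf rAC `^ (2 + eta') / (dA' * dC' * lAC `^ (2 + eta')))
      (ERinf rAC + c' * ERinf rAB `^ (2 + eta') / (dA' * dB' * lAB `^ (2 + eta'))).
Proof.
move=> eta0 eta0'; have l2 := @ln2_gt0 R.
(* An exponent p is reached with g = 2 / p, and p > 2 is what puts g in (0, 1). *)
have gP (p : R) : 2 < p -> [/\ 0 < 2 / p, 2 / p < 1 & p != 0].
  move=> hp; have p0 : 0 < p by lra.
  split; rewrite ?divr_gt0 ?gt_eqF // ltr_pdivrMr // mul1r //.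
have [|g0 g1 gn] := gP (4 + eta); first by lra.
have [|g0' g1' gn'] := gP (2 + eta'); first by lra.
pose k (p : R) : R := (Cent (2 / p) `^ p)^-1.
have k0 p : 2 / p < 1 -> 0 < k p by move=> h; rewrite invr_gt0 powR_gt0 // Cent_ge0.
(* The two denominators come from [EF_sepgap] and [ERinf_sepgap]; dimensions do not enter. *)
pose e : R := 4 * ln 2 * 72 ^+ 2; pose e' : R := 288 ^+ 2 * 32 * ln 2.
exists (k (4 + eta) / e), (k (2 + eta') / e'); split; first by rewrite divr_gt0 ?k0 // !mulr_gt0.
have e0' : 0 < e' by rewrite (mulr_gt0 _ l2) // (mulr_gt0 (exprn_gt0 _ _)) // ltr0n.
split; first exact: divr_gt0 (k0 _ g1') e0'.
move=> dA dB dC rho hr /=; rewrite !ge_max.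
have hs := state_swapBC hr.
split; apply/andP; split.
- by have := EF_sepgap hr g0 g1; rewrite sepgapE.
(* The second member of each maximum is the first one for the state with B and C exchanged, whose
   marginals are convertible to those of rho in the other order. *)
- by have := le_trans (EF_sepgap hs g0 g1) (EF_swapBC hr); rewrite sepgapE.
- by have := ERinf_sepgap hr g0' g1'; rewrite sepgapE.
by have := le_trans (ERinf_sepgap hs g0' g1') (ERinf_swapBC hr); rewrite sepgapE.
Qed.
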